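(* Let $d\ge 3$, $s\ge 0$, $n\ge d+s+1$ be integers. Then for any $P\in\mathcal{P}(d,n,s)$ and any $1\le i\le d-1$ we have $f_i(S(d,n,s))\le f_i(P)$.
   Context: $f_i(P)$ denotes the number of $i$-dimensional faces of a polytope $P$. $\mathcal{P}(d,n,s)$ is the family of $d$-polytopes with $n$ vertices having a facet $F$ with exactly $d+s$ vertices such that every facet other than $F$ is a simplex. A simplicial polytope is stacked if it is obtained from a simplex by repeatedly adding a new vertex beyond a facet and taking the convex hull. $S(d,n,s)$ denotes a $d$-polytope obtained by taking a stacked $(d-1)$-polytope $F$ with $d+s$ vertices, forming a pyramid over $F$, and stacking $n-d-s-1$ times over facets different from $F$; its $f$-vector is $f_0=n$, $f_k=\binom{d}{k}n-\binom{d+1}{k+1}k$ for $1\le k\le d-3$, $f_{d-2}=\binom{d}{d-2}n-\binom{d+1}{d-1}(d-2)-s$, $f_{d-1}=(d-1)n-(d+1)(d-2)-s$. *)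

(* Defs.v *)
From HB Require Import structures.
From mathcomp Require Import all_boot all_order all_algebra finmap.
From mathcomp Require Import boolp classical_sets functions cardinality reals.
From mathcomp Require Import convex.

Set Implicit Arguments.
Unset Strict Implicit.
Unset Printing Implicit Defensive.

Import Order.TTheory GRing.Theory Num.Theory.

Local Open Scope classical_set_scope.
Local Open Scope ring_scope.

Definition conv_hull (R : realType) (m : nat) (A : set 'rV[R]_m) :
    set 'rV[R]_m :=
  smallest (@convex_set R 'rV[R]_m) A.

Definition aff_hull (R : realType) (m : nat) (A : set 'rV[R]_m) :
    set 'rV[R]_m :=
  [set x | exists (k : nat) (v : 'I_k -> 'rV[R]_m) (w : 'I_k -> R),
     [/\ forall i, A (v i), \sum_i w i = 1 & x = \sum_i w i *: v i]].

(* The dimension of a nonempty set is that of its affine hull. The empty set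
   has no dimension here: it is only ever needed in dimension >= 0. *)
Definition has_dim (R : realType) (m : nat) (A : set 'rV[R]_m) (k : nat) :
    Prop :=
  exists (x : 'rV[R]_m) (U : {vspace 'rV[R]_m}),
    aff_hull A = [set x + u | u in [set` U]] /\ \dim U = k.

Definition aff_independent (R : realType) (m k : nat)
    (v : 'I_k -> 'rV[R]_m) : Prop :=
  forall w : 'I_k -> R,
    \sum_i w i = 0 -> \sum_i w i *: v i = 0 -> forall i, w i = 0.

Definition is_polytope (R : realType) (m : nat) (P : set 'rV[R]_m) : Prop :=
  exists V : seq 'rV[R]_m, P = conv_hull [set` V].

Definition is_simplex (R : realType) (m : nat) (T : set 'rV[R]_m) : Prop :=
  exists (k : nat) (v : 'I_k.+1 -> 'rV[R]_m),
    aff_independent v /\ T = conv_hull (range v).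

Definition supporting (R : realType) (m : nat) (P : set 'rV[R]_m)
    (f : {scalar 'rV[R]_m}) (b : R) (F : set 'rV[R]_m) : Prop :=
  (forall x, P x -> f x <= b) /\ F = P `&` [set x | f x = b].

(* [f] may be 0, so the empty set and [P] itself are (improper) faces. *)
Definition is_face (R : realType) (m : nat) (P F : set 'rV[R]_m) : Prop :=
  exists f b, supporting P f b F.

(* [fset_set] is only meaningful on finite sets; a polytope has finitely many
   faces. *)
Definition fnum (R : realType) (m : nat) (i : nat) (P : set 'rV[R]_m) : nat :=
  #|` fset_set [set F | is_face P F /\ has_dim F i] |%fset.

Definition is_facet (R : realType) (m : nat) (P F : set 'rV[R]_m) : Prop :=
  is_face P F /\ exists k : nat, has_dim P k.+1 /\ has_dim F k.

Definition simplicial (R : realType) (m : nat) (P : set 'rV[R]_m) : Prop :=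
  is_polytope P /\ forall G, is_facet P G -> is_simplex G.

(* On the affine hull of [P] the pair [(f, b)] supporting a facet is unique up
   to a positive factor; [beyond] and [beneath] are only used for points of
   that affine hull, where they do not depend on the choice of [(f, b)]. *)
Definition beyond (R : realType) (m : nat) (P F : set 'rV[R]_m)
    (x : 'rV[R]_m) : Prop :=
  exists f b, supporting P f b F /\ b < f x.

Definition beneath (R : realType) (m : nat) (P F : set 'rV[R]_m)
    (x : 'rV[R]_m) : Prop :=
  exists f b, supporting P f b F /\ f x < b.

(* [Q] arises from [P] by stacking over the facet [G]: the new vertex [v] is
   beyond [G] and beneath every other facet. *)
Definition stacking (R : realType) (m : nat) (P G Q : set 'rV[R]_m) : Prop :=
  is_facet P G /\
  exists v : 'rV[R]_m,
    [/\ aff_hull P v, beyond P G v,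
        forall H, is_facet P H -> H <> G -> beneath P H v
      & Q = conv_hull (P `|` [set v])].

(* [Q] arises from [P] by stacking [k] times, each time over a facet (of the
   current polytope) that belongs to [allowed]. *)
Fixpoint iter_stacking (R : realType) (m : nat)
    (allowed : set (set 'rV[R]_m)) (k : nat) (P Q : set 'rV[R]_m) : Prop :=
  if k is k'.+1 then
    exists G P' : set 'rV[R]_m,
      [/\ allowed G, stacking P G P' & iter_stacking allowed k' P' Q]
  else P = Q.

Definition stacked (R : realType) (m : nat) (P : set 'rV[R]_m) : Prop :=
  simplicial P /\
  exists (T : set 'rV[R]_m) (k : nat), is_simplex T /\ iter_stacking setT k T P.

Definition is_pyramid (R : realType) (m : nat) (F T : set 'rV[R]_m) : Prop :=
  exists a : 'rV[R]_m, ~ aff_hull F a /\ T = conv_hull (F `|` [set a]).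

Definition polytope_family (R : realType) (m d n s : nat) :
    set (set 'rV[R]_m) :=
  [set P | [/\ is_polytope P, has_dim P d, fnum 0 P = n
    & exists F, [/\ is_facet P F, fnum 0 F = (d + s)%N
      & forall G, is_facet P G -> G <> F -> is_simplex G]]].

Definition is_S (R : realType) (m d n s : nat) (Q : set 'rV[R]_m) : Prop :=
  exists F T : set 'rV[R]_m,
    [/\ stacked F /\ has_dim F d.-1, fnum 0 F = (d + s)%N, is_pyramid F T
      & iter_stacking [set~ F] (n - d - s - 1) T Q].

(* Main.v *)
(* Homogenize the vertices of P to a finite configuration of vectors; faces are
   zero sets of nonnegative functionals. A rotation argument on functionals shows
   that every interval of length two in the face lattice is a diamond, that the
   facets through a face are connected through ridges, and that the vertices off
   the special facet K are connected in every vertex figure. The rest is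
   combinatorial. In a simplicial pseudomanifold of facets with q >= 3 vertices,
   a vertex set A disjoint from a facet meets at least q|A| edges (Gromov): for
   q = 3 by the relative Euler characteristic of the open star of A, and for
   q > 3 by adding the vertex stars one after the other. Applied to the links of
   the vertices off K, |K| = q + s, this shows that the vertices off K meet at
   least q|V \ K| + s edges. With the lower bound theorem for K this bounds f_1,
   and counting faces through their vertices gives all f_k by induction on q.
   Conversely a stacking adds at most C(d, i) faces of dimension i, and d - 1
   facets, and it destroys no vertex; hence S(d, n, s) attains these bounds. *)

From HB Require Import structures.
From mathcomp Require Import all_boot all_order all_algebra.
From mathcomp Require Import boolp.
From mathcomp Require Import zify ring lra.

Set Implicit Arguments.
Unset Strict Implicit.
Unset Printing Implicit Defensive.

Import Order.TTheory GRing.Theory Num.Theory.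

(** * Faces of a finite point configuration *)

Local Open Scope ring_scope.

(** Links leave the class under study, so two kinds of complexes are carried along: the link of a
    vertex of K again has one exceptional facet ([pair]), the link of a vertex off K is a simplicial
    pseudomanifold ([spx]). Both are axiomatised by what passes to links: facet size, two facets at
    each ridge, connected stars. The axioms do not say that the complex is a sphere; the only
    topology is linear algebra over F_2 for q = 3, where no orientation has to be chosen. The
    obstacle is K, which may have many more than q vertices. Stars are therefore added only at
    vertices off K, so that in this count a vertex on K brings one edge instead of q. The edges
    inside K are bounded by the lower bound theorem one dimension lower. For q > 3 the two add up to
    the usual bound on f_1, free of s; the number of vertices of K enters only for ridges and
    facets. Ranks are dimensions plus one: a face of dimension k is an index set of rank k + 1. Thus
    q = d, facets have rank q and the polytope has rank q + 1. *)

Section Config.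

Variables (R : realFieldType) (N : nat) (I : finType) (y : I -> 'rV[R]_N).

Definition ev (x : 'rV[R]_N) (c : 'cV[R]_N) : R := (x *m c) 0 0.

Lemma evDr x c c' : ev x (c + c') = ev x c + ev x c'.
Proof. by rewrite /ev mulmxDr mxE. Qed.
Lemma evZr x a c : ev x (a *: c) = a * ev x c.
Proof. by rewrite /ev -scalemxAr mxE. Qed.
Lemma evNr x c : ev x (- c) = - ev x c.
Proof. by rewrite /ev mulmxN mxE. Qed.
Lemma ev0r x : ev x 0 = 0.
Proof. by rewrite /ev mulmx0 mxE. Qed.
Lemma evDl x x' c : ev (x + x') c = ev x c + ev x' c.
Proof. by rewrite /ev mulmxDl mxE. Qed.
Lemma evZl a x c : ev (a *: x) c = a * ev x c.
Proof. by rewrite /ev -scalemxAl mxE. Qed.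
Lemma evNl x c : ev (- x) c = - ev x c.
Proof. by rewrite /ev mulNmx mxE. Qed.
Lemma ev_suml (J : Type) (r : seq J) (P : pred J) (F : J -> 'rV_N) c :
  ev (\sum_(j <- r | P j) F j) c = \sum_(j <- r | P j) ev (F j) c.
Proof. by rewrite /ev mulmx_suml summxE. Qed.

(* S is the face of the configuration T exposed by the functional c; a face is
   identified with the set of indices of the points on it. *)
Definition expo c (T S : {set I}) :=
  (forall i, i \in T -> 0 <= ev (y i) c) /\ S = [set i in T | ev (y i) c == 0].

Definition spn (S : {set I}) := (\sum_(i in S) <<y i>>)%MS.
Definition rk S := \rank (spn S).

Lemma spn_mem (S : {set I}) i : i \in S -> (y i <= spn S)%MS.
Proof. by move=> iS; rewrite (sumsmx_sup i) // genmxE. Qed.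

Lemma spn_subP (S : {set I}) m (W : 'M_(m, N)) :
  reflect (forall i, i \in S -> (y i <= W)%MS) (spn S <= W)%MS.
Proof.
apply: (iffP sumsmx_subP) => h i /h; by rewrite genmxE.
Qed.

Lemma spnS (S T : {set I}) : S \subset T -> (spn S <= spn T)%MS.
Proof. by move=> /subsetP ST; apply/spn_subP => i /ST; apply: spn_mem. Qed.

Lemma rkS (S T : {set I}) : S \subset T -> (rk S <= rk T)%N.
Proof. by move=> /spnS; apply: mxrankS. Qed.

Lemma spn_ev0 (S : {set I}) x c : (x <= spn S)%MS ->
  (forall i, i \in S -> ev (y i) c = 0) -> ev x c = 0.
Proof.
move=> xS h; have : (spn S <= kermx c)%MS.
  apply/spn_subP => i /h; rewrite /ev => e; apply/sub_kermxP.
  by apply/matrixP => a b; rewrite !ord1 e mxE.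
by move=> /(submx_trans xS) /sub_kermxP; rewrite /ev => ->; rewrite mxE.
Qed.

(** Some column of the cokernel of W does not kill x. The value -1 is chosen because [rotation] and
    [atom_neg] ask for a point with a negative value. *)
Lemma sep m (W : 'M_(m, N)) x : ~~ (x <= W)%MS ->
  exists2 c, (forall z, (z <= W)%MS -> ev z c = 0) & ev x c = -1.
Proof.
rewrite submxE => /matrix0Pn[a [j]]; rewrite ord1 => nz.
have evc z : ev z (col j (cokermx W)) = (z *m cokermx W) 0 j.
  by rewrite /ev colE mulmxA -colE mxE.
exists (- ((x *m cokermx W) 0 j)^-1 *: col j (cokermx W)) => [z zW|].
  by move: zW; rewrite submxE evZr evc => /eqP ->; rewrite [X in _ * X]mxE mulr0.
by rewrite evZr evc mulNr mulVf.
Qed.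

Lemma expo_sub c (T S : {set I}) : expo c T S -> S \subset T.
Proof. by case=> _ ->; apply/subsetP => i; rewrite inE => /andP[]. Qed.

Lemma expo0 c T (S : {set I}) i : expo c T S -> i \in S -> ev (y i) c = 0.
Proof. by case=> _ ->; rewrite inE => /andP[_ /eqP]. Qed.

Lemma expo_gt0 c (T S : {set I}) i : expo c T S -> i \in T -> i \notin S -> 0 < ev (y i) c.
Proof.
by case=> h -> iT; rewrite inE iT /= lt0r => ->; rewrite h.
Qed.

Lemma expo_restr c (T S U : {set I}) : expo c T S -> S \subset U -> U \subset T ->
  expo c U S.
Proof.
move=> e /subsetP SU /subsetP UT; split=> [i /UT|]; first by case: e => h _; apply: h.
apply/setP => i; apply/idP/idP => [iS|].
  by rewrite inE SU // (expo0 e iS) eqxx.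
by rewrite inE => /andP[/UT iT i0]; case: e => _ ->; rewrite inE iT.
Qed.

Lemma expo_refl T : expo 0 T T.
Proof.
split=> [i _|]; first by rewrite ev0r.
by apply/setP => i; rewrite inE ev0r eqxx andbT.
Qed.

Lemma expo_closed c (T S : {set I}) i : expo c T S -> i \in T -> (y i <= spn S)%MS -> i \in S.
Proof.
move=> e iT yi; case: (e) => _ ->; rewrite inE iT /=; apply/eqP.
by apply: spn_ev0 yi _ => j; apply: expo0 e.
Qed.

Lemma expo_rk_lt c T S : expo c T S -> S != T -> (rk S < rk T)%N.
Proof.
move=> e ST; rewrite ltnNge; apply/negP => le.
case/eqP: ST; apply/eqP; rewrite eqEsubset (expo_sub e); apply/subsetP => i iT.
apply: (expo_closed e) => //; apply: submx_trans (spn_mem iT) _.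
by rewrite -(geq_leqif (mxrank_leqif_sup (spnS (expo_sub e)))).
Qed.

Lemma expo_rk_eq c T S : expo c T S -> rk S = rk T -> S = T.
Proof.
by move=> e h; apply/eqP; apply: contraT => /(expo_rk_lt e); rewrite h ltnn.
Qed.

Lemma expoI c c' T S S' : expo c T S -> expo c' T S' -> expo (c + c') T (S :&: S').
Proof.
move=> [h ->] [h' ->]; split=> [i iT|]; first by rewrite evDr addr_ge0 ?h ?h'.
apply/setP => i; rewrite !inE evDr; case: (boolP (i \in T)) => //= iT.
by rewrite paddr_eq0 ?h ?h'.
Qed.

(* Perturb a large multiple of the outer functional. *)
Lemma expo_trans c0 c (U T S : {set I}) : expo c0 U T -> expo c T S ->
  exists2 c', expo c' U S & forall i, i \in T -> ev (y i) c' = ev (y i) c.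
Proof.
move=> e0 e.
pose M := \sum_(i in U :\: T) (`|ev (y i) c| / ev (y i) c0 + 1).
have pos i : i \in U :\: T -> 0 < ev (y i) (M *: c0 + c).
  rewrite inE => /andP[iT iU]; have c0i := expo_gt0 e0 iU iT.
  have : `|ev (y i) c| / ev (y i) c0 + 1 <= M.
    rewrite /M (bigD1 i) /= ?inE ?iT ?iU // lerDl sumr_ge0 // => j.
    rewrite inE => /andP[/andP[jT jU] _]; have c0j := expo_gt0 e0 jU jT.
    by rewrite addr_ge0 ?ler01 // divr_ge0 // ltW.
  rewrite evDr evZr -(ler_pM2r c0i) mulrDl mul1r divfK ?gt_eqF // => le.
  have := ler_norm (- ev (y i) c); rewrite normrN; lra.
have eqT i : i \in T -> ev (y i) (M *: c0 + c) = ev (y i) c.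
  by move=> iT; rewrite evDr evZr (expo0 e0 iT) mulr0 add0r.
exists (M *: c0 + c) => //; split=> [i iU|].
  case: (boolP (i \in T)) => iT; first by rewrite eqT //; case: e => h _; apply: h.
  by rewrite ltW // pos // inE iT.
apply/setP => i; rewrite inE; case: (boolP (i \in T)) => iT.
  rewrite eqT // (subsetP (expo_sub e0) i iT) /=.
  by case: e => _ ->; rewrite inE iT.
rewrite (contraNF (subsetP (expo_sub e) i)) //.
case: (boolP (i \in U)) => //= iU; rewrite gt_eqF // pos // inE iT //.
Qed.

(** * Tilting functionals: atoms, coatoms and the diamond property *)

(** The ratio test of linear programming: t is the least value of c / (-X) over the points where X
    is negative, hence the largest t for which c + t X stays nonnegative on T. A minimiser joins the
    face. *)
Lemma rotation c (T S : {set I}) X i0 : expo c T S ->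
  (forall i, i \in S -> ev (y i) X = 0) -> i0 \in T -> ev (y i0) X < 0 ->
  exists t S', [/\ 0 < t, expo (c + t *: X) T S', S \subset S' &
    exists2 j, j \in S' & j \notin S].
Proof.
move=> e XS i0T Xi0.
pose A := [pred i | (i \in T) && (ev (y i) X < 0)].
have A0 : A i0 by rewrite /= i0T.
case: (arg_minP (fun i => ev (y i) c / - ev (y i) X) A0) => j /andP[jT Xj] jmin.
have jS : j \notin S by apply/negP => /XS h; move: Xj; rewrite h ltxx.
have cj := expo_gt0 e jT jS.
set t := _ / _ in jmin; exists t.
have tp : 0 < t by rewrite divr_gt0 // oppr_gt0.
exists [set i in T | ev (y i) (c + t *: X) == 0]; split=> //.
- split=> // i iT; rewrite evDr evZr.
  have ci : 0 <= ev (y i) c by case: e => h _; apply: h.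
  case: (leP 0 (ev (y i) X)) => Xi; first by rewrite addr_ge0 // mulr_ge0 // ltW.
  have : t <= ev (y i) c / - ev (y i) X by apply: jmin; rewrite /= iT.
  by rewrite ler_pdivlMr ?oppr_gt0 //; lra.
- apply/subsetP => i iS; rewrite inE (subsetP (expo_sub e) i iS) evDr evZr.
  by rewrite (expo0 e iS) XS // mulr0 addr0 /=.
exists j => //; rewrite inE jT evDr evZr /t /=.
have : ev (y j) X != 0 by rewrite lt_eqF.
by move=> ?; apply/eqP; field.
Qed.

Lemma rk_lt_ex m (W : 'M[R]_(m, N)) (T : {set I}) : (\rank W < rk T)%N ->
  exists2 j, j \in T & ~~ (y j <= W)%MS.
Proof.
move=> lt; apply/exists_inP; apply: contraLR lt; rewrite negb_exists_in -leqNgt.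
by move=> /forall_inP h; apply/mxrankS/spn_subP => i /h; rewrite negbK.
Qed.

Lemma rk_addmx m (W : 'M[R]_(m, N)) (x : 'rV_N) : (\rank (W + x)%MS <= (\rank W).+1)%N.
Proof.
rewrite (leq_trans (mxrank_adds_leqif _ _)) // -[X in (_ <= X)%N]addn1 leq_add2l.
exact: rank_leq_row.
Qed.

(** Tilting by X yields a face above S whose new points are all negative under X. If it is smaller
    than T, induction takes place inside it, and [expo_trans] carries the atom found there back to
    T. *)
Lemma atom_neg c (T S : {set I}) X i0 : expo c T S ->
  (forall i, i \in S -> ev (y i) X = 0) -> i0 \in T -> ev (y i0) X < 0 ->
  exists c' T', [/\ expo c' T T', S \subset T', rk T' = (rk S).+1 &
    forall i, i \in T' -> i \notin S -> ev (y i) X < 0].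
Proof.
move: {2}(#|T|) (leqnn #|T|) => n; elim: n T i0 c => [|n IH] T i0 c.
  by rewrite leqn0 cards_eq0 => /eqP -> _ _; rewrite inE.
move=> Tn e XS i0T Xi0.
have shrink c1 S1 j : expo c1 T S1 -> S \subset S1 -> S1 != T -> j \in S1 ->
    j \notin S -> ev (y j) X < 0 ->
    exists c' T', [/\ expo c' T T', S \subset T', rk T' = (rk S).+1 &
      forall i, i \in T' -> i \notin S -> ev (y i) X < 0].
  move=> e1 SS1 S1T jS1 jS Xj; have S1sT := expo_sub e1.
  have [|c2 [T2 [e2 h1 h2 h3]]] := IH S1 j _ _ (expo_restr e SS1 S1sT) XS jS1 Xj.
    rewrite -ltnS (leq_trans _ Tn) //; apply: proper_card.
    by rewrite properEneq S1T.
  have [c3 e3 _] := expo_trans e1 e2.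
  by exists c3, T2.
have [t [S1 [tp e1 SS1 [j jS1 jS]]]] := rotation e XS i0T Xi0.
have neg i : i \in S1 -> i \notin S -> ev (y i) X < 0.
  move=> iS1 iS; have iT := subsetP (expo_sub e1) i iS1.
  have := expo_gt0 e iT iS; have := expo0 e1 iS1; rewrite evDr evZr => h1 h2.
  rewrite -(pmulr_rlt0 _ tp); lra.
case: (eqVneq S1 T) => [S1T|S1T]; last by apply: (shrink _ S1 j e1) => //; apply: neg.
subst S1; have ST : S != T by apply: contraNneq jS => ->.
have rlt := expo_rk_lt e ST.
case: (eqVneq (rk T) (rk S).+1) => rT.
  by exists 0, T; split=> //; apply: expo_refl.
(* The tilt by X has swallowed all of T, whose rank is still too large. A second tilt, by a
   functional that vanishes at j as well, leaves the value at j positive; so j stays outside and the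
   new face is proper. *)
have [|k kT kW] := @rk_lt_ex _ (spn S + y j)%MS T.
  by rewrite (leq_ltn_trans (rk_addmx _ _)) // ltn_neqAle eq_sym rT.
have [X2 X20 X2k] := sep kW.
have [||t2 [S2 [t2p e2 SS2 [l lS2 lS]]]] := @rotation _ _ _ X2 k e _ kT.
- by move=> i iS; apply: X20; rewrite (submx_trans (spn_mem iS)) // addsmxSl.
- by rewrite X2k ltrN10.
apply: (shrink _ S2 l e2 SS2) => //; last by apply: neg => //; apply: (subsetP (expo_sub e2)).
apply/negP => /eqP S2T; move: (jS1); rewrite -S2T => /(expo0 e2).
rewrite evDr evZr X20 ?addsmxSr // mulr0 addr0 => h.
by have := expo_gt0 e (subsetP (expo_sub e1) j jS1) jS; rewrite h ltxx.
Qed.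

(** Dual to [atom_neg]: a point violating some inequality that is tight on S violates a facet
    inequality that is tight on S. Each tilt uses a functional vanishing on S and at x, so that the
    value at x never changes while the face grows. *)
Lemma coatom_neg c (T S : {set I}) x : expo c T S -> (x <= spn T)%MS -> ev x c < 0 ->
  exists c' S', [/\ expo c' T S', S \subset S', (rk S').+1 = rk T & ev x c' < 0].
Proof.
move: {2}(#|T :\: S|) (leqnn #|T :\: S|) => n; elim: n S c => [|n IH] S c.
  rewrite leqn0 cards_eq0 setD_eq0 => TS e xT; rewrite (spn_ev0 xT) ?ltxx // => i iT.
  by apply: (expo0 e); apply: (subsetP TS).
move=> le e xT cx.
have ST : S != T.
  by apply: contraTneq cx => ST; rewrite (spn_ev0 xT) ?ltxx // -ST => i; apply: expo0 e.
have := expo_rk_lt e ST; rewrite leq_eqVlt => /orP[/eqP rST|rlt].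
  by exists c, S.
have [|j jT jW] := @rk_lt_ex _ (spn S + x)%MS T; first exact: leq_ltn_trans (rk_addmx _ _) _.
have [X X0 Xj] := sep jW.
have [||t [S1 [tp e1 SS1 [k kS1 kS]]]] := @rotation _ _ _ X j e _ jT.
- by move=> i iS; apply: X0; rewrite (submx_trans (spn_mem iS)) // addsmxSl.
- by rewrite Xj ltrN10.
have [||c' [S' [e' SS' r' x']]] := IH _ _ _ e1 xT.
- rewrite -ltnS (leq_trans _ le) //; apply: proper_card; apply/properP; split.
    by apply: setDS.
  by exists k; rewrite !inE ?kS ?kS1 //=; apply: (subsetP (expo_sub e1)).
- by rewrite evDr evZr X0 ?addsmxSr // mulr0 addr0.
by exists c', S'; split=> //; apply: subset_trans SS1 SS'.
Qed.

Lemma rk_addmx_eq m (W : 'M[R]_(m, N)) (x : 'rV_N) : ~~ (x <= W)%MS ->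
  \rank (W + x)%MS = (\rank W).+1.
Proof.
move=> nx; apply/eqP; rewrite eqn_leq rk_addmx /=.
rewrite (ltn_leqif (mxrank_leqif_sup (addsmxSl W x))).
by apply: contra nx => /(submx_trans _); apply; apply: addsmxSr.
Qed.

(** The quotient of the two spans is a line, generated by any point off S. Signs of functionals
    vanishing on S are compared through the coefficient a. *)
Lemma spn_cover c (T S : {set I}) j x : expo c T S -> rk T = (rk S).+1 ->
  j \in T -> j \notin S -> (x <= spn T)%MS ->
  exists a, (x - a *: y j <= spn S)%MS.
Proof.
move=> e rT jT jS xT.
have njS : ~~ (y j <= spn S)%MS by apply: contra jS; apply: expo_closed e jT.
have sub : (spn S + y j <= spn T)%MS by rewrite addsmx_sub spnS ?(expo_sub e) ?spn_mem.
have : (spn T <= spn S + y j)%MS.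
  by rewrite -(geq_leqif (mxrank_leqif_sup sub)) (rk_addmx_eq njS) -rT.
move=> /(submx_trans xT) /sub_addsmxP[[u v] ->] /=.
by exists (v 0 0); rewrite [v]mx11_scalar mul_scalar_mx mxE eqxx mulr1n addrK submxMl.
Qed.

(** [atom_neg] for -c1 gives an atom whose new points have c1 > 0, so that none of them lies on
    T1. *)
Lemma diamond_ex c c1 (T S T1 : {set I}) : expo c T S -> expo c1 T T1 ->
  S \subset T1 -> T1 != T ->
  exists c2 T2, [/\ expo c2 T T2, S \subset T2, rk T2 = (rk S).+1 & T2 :&: T1 = S].
Proof.
move=> e e1 ST1 T1T.
have [j jT jT1] : exists2 j, j \in T & j \notin T1.
  by apply/subsetPn; apply: contra T1T => TT1; rewrite eqEsubset (expo_sub e1).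
have [||c2 [T2 [e2 ST2 r2 neg]]] := @atom_neg _ _ _ (- c1) j e _ jT.
- by move=> i iS; rewrite evNr (expo0 e1) ?oppr0 // (subsetP ST1).
- by rewrite evNr oppr_lt0 (expo_gt0 e1).
exists c2, T2; split=> //; apply/eqP; rewrite eqEsubset subsetI ST2 ST1 !andbT.
apply/subsetP => i; rewrite inE => /andP[iT2 iT1]; apply: contraT => iS.
by have := neg i iT2 iS; rewrite evNr (expo0 e1 iT1) oppr0 ltxx.
Qed.

Lemma atomI c c1 c2 (T S T1 T2 : {set I}) : expo c T S -> expo c1 T T1 -> expo c2 T T2 ->
  S \subset T1 -> S \subset T2 -> rk T1 = (rk S).+1 -> rk T2 = (rk S).+1 ->
  T1 != T2 -> T1 :&: T2 = S.
Proof.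
move=> e e1 e2 S1 S2 r1 r2 T12.
have eI := expoI e1 e2.
have SI : S \subset T1 :&: T2 by rewrite subsetI S1.
have eS := expo_restr e SI (expo_sub eI).
symmetry; apply: (expo_rk_eq eS); apply/eqP; rewrite eqn_leq rkS //=.
rewrite -ltnS -{1}r1; apply: expo_rk_lt (expo_restr eI (subsetIl _ _) (expo_sub e1)) _.
apply: contraNneq T12 => h; apply/eqP.
have T12 : T1 \subset T2 by rewrite -h subsetIr.
by apply: (expo_rk_eq (expo_restr e1 T12 (expo_sub e2))); rewrite r1.
Qed.

(** Modulo the span of S, a point t3 of the third atom is u t1 + v t2. The functional of T1 shows v
    > 0 and that of T2 shows u > 0. Then the functional of T3 would be positive at t3, where it
    vanishes. *)
Lemma diamond_uniq c c1 c2 c3 (T S T1 T2 T3 : {set I}) : expo c T S ->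
  expo c1 T T1 -> expo c2 T T2 -> expo c3 T T3 ->
  S \subset T1 -> S \subset T2 -> S \subset T3 ->
  rk T1 = (rk S).+1 -> rk T2 = (rk S).+1 -> rk T3 = (rk S).+1 ->
  rk T = (rk S).+2 -> T1 != T2 -> T3 != T1 -> T3 != T2 -> False.
Proof.
move=> e e1 e2 e3 S1 S2 S3 r1 r2 r3 rT n12 n31 n32.
have ex (U : {set I}) : S \subset U -> rk U = (rk S).+1 -> exists2 j, j \in U & j \notin S.
  move=> SU rU; apply/subsetPn; apply/negP => US.
  by have := rkS US; rewrite rU ltnn.
have [t1 t1T t1S] := ex _ S1 r1; have [t2 t2T t2S] := ex _ S2 r2.
have [t3 t3T t3S] := ex _ S3 r3.
have inter (U V : {set I}) j : U :&: V = S -> j \in U -> j \notin S -> j \notin V.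
  by move=> <- jU; rewrite inE jU.
have I12 := atomI e e1 e2 S1 S2 r1 r2 n12.
have I31 := atomI e e3 e1 S3 S1 r3 r1 n31.
have I32 := atomI e e3 e2 S3 S2 r3 r2 n32.
have inT (U : {set I}) d j : expo d T U -> j \in U -> j \in T by move=> /expo_sub/subsetP; apply.
have a1 : ~~ (y t1 <= spn S)%MS by apply: contra t1S; apply: (expo_closed e); apply: inT e1 _.
have a2 : ~~ (y t2 <= spn S + y t1)%MS.
  have t21 : t2 \notin T1 by apply: (inter T2) => //; rewrite setIC.
  apply: contra t21 => h; apply: (expo_closed e1); first exact: inT e2 _.
  by apply: (submx_trans h); rewrite addsmx_sub spnS ?spn_mem.
have sub : (spn S + y t1 + y t2 <= spn T)%MS.
  by rewrite !addsmx_sub spnS ?(expo_sub e) ?spn_mem ?(inT _ _ _ e1 t1T) ?(inT _ _ _ e2 t2T).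
have : (spn T <= spn S + y t1 + y t2)%MS.
  by rewrite -(geq_leqif (mxrank_leqif_sup sub)) (rk_addmx_eq a2) (rk_addmx_eq a1) -rT.
move=> /(submx_trans (spn_mem (inT _ _ _ e3 t3T))) /sub_addsmxP[[w v] /= E].
have : ((w *m (spn S + y t1)%MS) <= spn S + y t1)%MS by apply: submxMl.
move=> /sub_addsmxP[[w' u] /= E']; rewrite E' [u]mx11_scalar [v]mx11_scalar !mul_scalar_mx in E.
have ev3 d : (forall i, i \in S -> ev (y i) d = 0) ->
   ev (y t3) d = u 0 0 * ev (y t1) d + v 0 0 * ev (y t2) d.
  move=> dS; rewrite E !evDl !evZl (@spn_ev0 S (w' *m _) d) ?add0r //.
  exact: submxMl.
have zS d (U : {set I}) : expo d T U -> S \subset U -> forall i, i \in S -> ev (y i) d = 0.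
  by move=> ed SU i iS; apply: (expo0 ed); apply: (subsetP SU).
have p12 : 0 < ev (y t2) c1.
  by apply: (expo_gt0 e1 (inT _ _ _ e2 t2T)); apply: (inter T2) => //; rewrite setIC.
have p13 : 0 < ev (y t3) c1 by apply: (expo_gt0 e1 (inT _ _ _ e3 t3T)); apply: (inter T3).
have p21 : 0 < ev (y t1) c2 by apply: (expo_gt0 e2 (inT _ _ _ e1 t1T)); apply: (inter T1).
have p23 : 0 < ev (y t3) c2 by apply: (expo_gt0 e2 (inT _ _ _ e3 t3T)); apply: (inter T3).
have p31 : 0 < ev (y t1) c3.
  by apply: (expo_gt0 e3 (inT _ _ _ e1 t1T)); apply: (inter T1) => //; rewrite setIC.
have p32 : 0 < ev (y t2) c3.
  by apply: (expo_gt0 e3 (inT _ _ _ e2 t2T)); apply: (inter T2) => //; rewrite setIC.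
move: p13 p23; rewrite (ev3 _ (zS _ _ e1 S1)) (ev3 _ (zS _ _ e2 S2)).
rewrite (expo0 e1 t1T) (expo0 e2 t2T) !mulr0 add0r addr0.
rewrite !pmulr_lgt0 // => v0 u0.
have := ev3 _ (zS _ _ e3 S3); rewrite (expo0 e3 t3T) => h.
by have := addr_gt0 (mulr_gt0 u0 p31) (mulr_gt0 v0 p32); rewrite -h ltxx.
Qed.

Definition faceof (T S : {set I}) := exists c, expo c T S.

Definition coatom (T S F : {set I}) := [/\ faceof T F, (rk F).+1 = rk T & S \subset F].

Lemma ev_sum_gt0 c (T S U : {set I}) i : expo c T S -> U \subset T -> i \in U ->
  i \notin S -> 0 < ev (\sum_(j in U) y j) c.
Proof.
move=> e UT iU iS; rewrite ev_suml (bigD1 i) //= ltr_wpDr //.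
  by apply: sumr_ge0 => j /andP[jU _]; case: e => h _; apply/h/(subsetP UT).
by apply: (expo_gt0 e) => //; apply: (subsetP UT).
Qed.

(* The coatom G is reached from F by walking so that the ratio of the facet
   functional at a point g of the relative interior of G to its value at an
   interior point p decreases. *)
Lemma coatom_connected (T S : {set I}) (P : {set I} -> Prop) : faceof T S ->
  (forall F F' U, P F -> coatom T S F -> coatom T S F' -> faceof T U ->
     (rk U).+2 = rk T -> S \subset U -> U \subset F -> U \subset F' -> P F') ->
  forall F G, P F -> coatom T S F -> coatom T S G -> P G.
Proof.
move=> fS closedP F0 G PF0 cF0 cG.
have /choice[phi phiP] : forall F, exists c, faceof T F -> expo c T F.
  move=> F; by have [[c e]|nf] := pselect (faceof T F); [exists c | exists 0 => /nf].
pose g := \sum_(i in G) y i; pose p := \sum_(i in T) y i.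
pose A := [pred F | `[< P F /\ coatom T S F >]].
have A0 : A F0 by apply/asboolP.
case: (arg_minP (fun F => ev g (phi F) / ev p (phi F)) A0) => F /asboolP[PF cF] Fmin.
case: (eqVneq F G) => [<- //|FG]; exfalso.
have [fF rF SF] := cF; have [fG rG SG] := cG.
have eF := phiP _ fF; have eG := phiP _ fG.
have GT := expo_sub eG; have FT := expo_sub eF.
have neT (H : {set I}) : (rk H).+1 = rk T -> faceof T H -> exists2 j, j \in T & j \notin H.
  move=> rH [d ed]; apply/subsetPn; apply/negP => /rkS; by rewrite -rH ltnn.
have ppos (H : {set I}) : (rk H).+1 = rk T -> faceof T H -> 0 < ev p (phi H).
  by move=> rH fH; have [j jT jH] := neT _ rH fH; apply: (ev_sum_gt0 (phiP _ fH)) jH.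
have [i iG iF] : exists2 i, i \in G & i \notin F.
  apply/subsetPn; apply: contra FG => GF; apply/eqP; symmetry.
  by apply: (expo_rk_eq (expo_restr eG GF FT)); apply/eq_add_S; rewrite rF.
have gF : 0 < ev g (phi F) by apply: (ev_sum_gt0 eF GT iG).
have gG : ev g (phi G) = 0.
  by rewrite ev_suml big1 // => j; apply: expo0 eG.
have pF := ppos _ rF fF; have pG := ppos _ rG fG.
set r := ev g (phi F) / ev p (phi F) in Fmin.
have r0 : 0 < r by rewrite divr_gt0.
(* x lies on the hyperplane of F and on the wrong side of G. Within F it therefore violates a ridge
   U containing the intersection of F and G. The other facet F' through U has x on its negative
   side, which says that its ratio is smaller than r. *)
pose x := g - r *: p.
have xF : ev x (phi F) = 0.
  by rewrite evDl evNl evZl /r divfK ?subrr // gt_eqF.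
have xG : ev x (phi G) < 0.
  by rewrite evDl evNl evZl gG add0r oppr_lt0 mulr_gt0.
have sumT (U : {set I}) : U \subset T -> ((\sum_(i in U) y i)%R <= spn T)%MS.
  by move=> UT; apply: summx_sub => j jU; apply: spn_mem; apply: (subsetP UT).
have xT : (x <= spn T)%MS.
  by apply: addmx_sub; [apply: sumT | rewrite eqmx_opp; apply/scalemx_sub/sumT].
have xsF : (x <= spn F)%MS.
  have [j jT jF] := neT _ rF fF.
  have [a] := spn_cover eF (esym rF) jT jF xT.
  move=> h; have := spn_ev0 h (fun k => @expo0 _ _ _ k eF).
  rewrite evDl evNl evZl xF add0r => /eqP; rewrite oppr_eq0 mulf_eq0.
  rewrite [X in _ || X]gt_eqF ?(expo_gt0 eF) // orbF => /eqP a0.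
  by move: h; rewrite a0 scale0r subr0.
have eGF : expo (phi G) F (F :&: G).
  split=> [j jF|]; first by case: eG => h _; apply/h/(subsetP FT).
  apply/setP => j; rewrite !inE; case: (boolP (j \in F)) => //= jF.
  by have /setP/(_ j) := proj2 eG; rewrite inE (subsetP FT).
have [c' [U [eU GU rU xU]]] := coatom_neg eGF xsF xG.
have [c'' eUT _] := expo_trans eF eU.
have FneT : F != T.
  by apply: contraTneq isT => h; move: rF; rewrite h => /esym/n_Sn.
have [c2 [F' [e' UF' r' I']]] := diamond_ex eUT eF (expo_sub eU) FneT.
have SU : S \subset U by apply: subset_trans GU; rewrite subsetI SF SG.
have cF' : coatom T S F'.
  by split; [exists c2 | rewrite r' rU rF | apply: subset_trans SU UF'].
have PF' : P F'.
  apply: (closedP F F' U) => //; [by exists c''|by rewrite rU rF|exact: expo_sub eU].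
have [fF' rF' _] := cF'.
have := Fmin F' (introT (asboolP _) (conj PF' cF')); apply/negP; rewrite -ltNge.
have eF' := phiP _ fF'.
have [j jF jU] : exists2 j, j \in F & j \notin U.
  by apply/subsetPn; apply/negP => /rkS; rewrite -rU ltnn.
have [a h] := spn_cover eU (esym rU) jF jU xsF.
have := spn_ev0 h (fun k => @expo0 _ _ _ k eU).
have jT := subsetP FT j jF.
have jF' : j \notin F' by apply: contra jU => jF'; rewrite -I' inE jF'.
have p1 := expo_gt0 eU jF jU; have p2 := expo_gt0 eF' jT jF'.
rewrite evDl evNl evZl => /subr0_eq xa.
have a0 : a < 0 by rewrite -(pmulr_llt0 _ p1) -xa.
have : ev (x - a *: y j) (phi F') = 0.
  by apply: (spn_ev0 h) => k kU; apply: (expo0 eF'); apply: (subsetP UF').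
rewrite evDl evNl evZl => /subr0_eq xa'.
have : ev x (phi F') < 0 by rewrite xa' pmulr_llt0.
by rewrite evDl evNl evZl subr_lt0 ltr_pdivrMr // ppos.
Qed.

Definition atom (T S K A : {set I}) :=
  [/\ faceof T A, rk A = (rk S).+1, S \subset A & ~~ (A \subset K)].

(* A projective transformation sending K to infinity: one walks from A to B so
   that the ratio of a functional exposing B to the functional of K decreases. *)
Lemma atom_connected h (T S K : {set I}) (P : {set I} -> Prop) :
  faceof T S -> expo h T K -> S \subset K ->
  (forall A B U, P A -> atom T S K A -> atom T S K B -> faceof T U ->
     rk U = (rk S).+2 -> A \subset U -> B \subset U -> P B) ->
  forall A B, P A -> atom T S K A -> atom T S K B -> P B.
Proof.
move=> [c eS] eK SK closedP A0 B PA0 aA0 aB.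
have [[psi eB] rB SB nB] := aB.
pose ratio i := ev (y i) psi / ev (y i) h.
(* Any point of A off K may be picked: both functionals vanish on S, and A spans only one dimension
   more, so the ratio is constant there. The default 0 never occurs for an atom not contained in
   K. *)
pose r (A : {set I}) := if [pick i in A :\: K] is Some i then ratio i else 0.
have rP (A : {set I}) : atom T S K A -> exists i, [/\ i \in A, i \notin K & r A = ratio i].
  case=> _ _ _ /subsetPn[i iA iK]; rewrite /r; case: pickP => [j|/(_ i)].
    by rewrite inE => /andP[jK jA]; exists j.
  by rewrite !inE iA iK.
pose Q := [pred A | `[< P A /\ atom T S K A >]].
have Q0 : Q A0 by apply/asboolP.
case: (arg_minP r Q0) => A /asboolP[PA aA] Amin.
case: (eqVneq A B) => [<- //|AB]; exfalso.
have [i [iA iK ri]] := rP _ aA.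
have [[cA eA] rA SA nA] := aA.
have iS : i \notin S by apply: contra iK; apply: (subsetP SK).
have IAB := atomI eS eA eB SA SB rA rB AB.
have iT := subsetP (expo_sub eA) i iA.
have hi := expo_gt0 eK iT iK.
have iB : i \notin B by apply: contra iS => iB; rewrite -IAB inE iA.
have pi := expo_gt0 eB iT iB.
have r0 : 0 < r A by rewrite ri divr_gt0.
(* X vanishes on A and is negative on B off K. So some U above A has X < 0 at its new points. On the
   other atom B' of the diamond between S and U, 0 <= psi < r A * h: hence h > 0, B' is not
   contained in K, and its ratio is smaller. *)
pose X := psi - r A *: h.
have evX j : ev (y j) X = ev (y j) psi - r A * ev (y j) h by rewrite evDr evNr evZr.
have XS j : j \in S -> ev (y j) X = 0.
  move=> jS; rewrite evX (expo0 eB) ?(subsetP SB) // (expo0 eK) ?(subsetP SK) //.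
  by rewrite mulr0 subrr.
have XA j : j \in A -> ev (y j) X = 0.
  move=> jA; have eSA := expo_restr eS SA (expo_sub eA).
  have [a hj] := spn_cover eSA rA iA iS (spn_mem jA).
  have := spn_ev0 hj XS; rewrite evDl evNl evZl => /subr0_eq ->.
  by rewrite evX ri /ratio divfK ?subrr ?mulr0 // gt_eqF.
have [b bB bK] := subsetPn nB.
have bT := subsetP (expo_sub eB) b bB.
have Xb : ev (y b) X < 0.
  by rewrite evX (expo0 eB) // add0r oppr_lt0 mulr_gt0 // (expo_gt0 eK).
have [c1 [U [eU AU rU neg]]] := atom_neg eA XA bT Xb.
have UT := expo_sub eU.
have SU := subset_trans SA AU.
have nAU : A != U by apply: contraTneq isT => e; move: rU; rewrite e => /n_Sn.
have [c2 [B' [e2 SB' r2 I2]]] :=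
  diamond_ex (expo_restr eS SU UT) (expo_restr eA AU UT) SA nAU.
have [c3 e3 _] := expo_trans eU e2.
have BU := expo_sub e2.
have key k : k \in B' -> k \notin S -> 0 < ev (y k) h /\ ratio k < r A.
  move=> kB kS; have kU := subsetP BU k kB; have kT := subsetP UT k kU.
  have kA : k \notin A by apply: contra kS => kA; rewrite -I2 inE kB.
  have := neg k kU kA; rewrite evX subr_lt0 => lt.
  have psik : 0 <= ev (y k) psi by case: eB => q _; apply: q.
  have hk : 0 < ev (y k) h by rewrite -(pmulr_rgt0 _ r0); apply: le_lt_trans lt.
  by split=> //; rewrite /ratio ltr_pdivrMr.
have aB' : atom T S K B'.
  split=> //; first by exists c3.
  have [k kB kS] : exists2 k, k \in B' & k \notin S.
    by apply/subsetPn; apply/negP => /rkS; rewrite r2 ltnn.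
  have [hk _] := key k kB kS.
  apply/subsetPn; exists k => //; apply: contraL hk => /(expo0 eK) ->.
  by rewrite ltxx.
have PB' : P B'.
  by apply: (closedP A B' U) => //; [exists c1 | rewrite rU rA].
have := Amin B' (introT (asboolP _) (conj PB' aB')); apply/negP; rewrite -ltNge.
have [k [kB kK ->]] := rP _ aB'.
by have [|_] := key k kB; first by apply: contra kK; apply: (subsetP SK).
Qed.

End Config.

(** * Simplicial complexes given by their facets *)

Local Close Scope ring_scope.

Section Complex.

Variable T : finType.
Implicit Types (F G S : {set T}) (Fs : {set {set T}}).

(* The faces are the subsets of the facets, and fk k collects those with k
   vertices, hence of dimension k - 1. *)
Definition isf Fs S := [exists F in Fs, S \subset F].
Definition fk k Fs := [set S : {set T} | (#|S| == k) && isf Fs S].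

(** Strong connectedness of the star of S, through ridges and within the star. It is stated as an
    induction principle for arbitrary predicates, so that no paths have to be built or transported
    to links. *)
Definition star_conn q Fs S := forall (P : {set T} -> Prop) F G,
  F \in Fs -> G \in Fs -> S \subset F -> S \subset G -> P F ->
  (forall F F', F \in Fs -> F' \in Fs -> S \subset F -> S \subset F' -> P F ->
     #|F :&: F'| = q.-1 -> P F') -> P G.

(* The facets of a (q-1)-dimensional normal pseudomanifold. *)
Record spx q Fs : Prop := Spx {
  spx_card : forall F, F \in Fs -> #|F| = q;
  spx_two : forall F S, F \in Fs -> S \subset F -> #|S| = q.-1 ->
    #|[set G in Fs | S \subset G]| = 2;
  spx_conn : forall S, #|S|.+2 <= q -> star_conn q Fs S }.

Definition lk v Fs := [set F :\ v | F in [set F in Fs | v \in F]].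

Lemma in_lk v Fs G : (G \in lk v Fs) = (v \notin G) && (v |: G \in Fs).
Proof.
apply/imsetP/andP => [[F]|[vG vF]].
  by rewrite inE => /andP[FF vF ->]; rewrite setD11 setD1K.
by exists (v |: G); rewrite ?inE ?vF ?eqxx //= setU1K.
Qed.

Lemma isfP Fs S : reflect (exists2 F, F \in Fs & S \subset F) (isf Fs S).
Proof. exact: exists_inP. Qed.

Lemma isf_sub Fs S S' : S \subset S' -> isf Fs S' -> isf Fs S.
Proof.
by move=> s /isfP[F F1 F2]; apply/isfP; exists F => //; apply: subset_trans F2.
Qed.

Lemma isf_lk v Fs S : isf (lk v Fs) S = (v \notin S) && isf Fs (v |: S).
Proof.
apply/isfP/andP => [[G]|[vS /isfP[F FF]]].
  rewrite in_lk => /andP[vG GF] SG; split; first by apply: contra vG; apply: (subsetP SG).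
  by apply/isfP; exists (v |: G) => //; apply: setUS.
rewrite subUset sub1set => /andP[vF SF]; exists (F :\ v).
  by rewrite in_lk setD11 setD1K.
by rewrite subsetD1 SF.
Qed.

Lemma lk_cardE v F q : v \in F -> #|F| = q -> #|F :\ v| = q.-1.
Proof. by move=> vF <-; rewrite (cardsD1 v F) vF. Qed.

Lemma setU1_inj v S S' : v \notin S -> v \notin S' -> v |: S = v |: S' -> S = S'.
Proof. by move=> h h' e; rewrite -(setU1K h) e setU1K. Qed.

Lemma lk_star v Fs S : v \notin S ->
  #|[set G in lk v Fs | S \subset G]| = #|[set G in Fs | v |: S \subset G]|.
Proof.
move=> vS; rewrite -(card_in_imset (f := fun G => v |: G) (D := [set G in lk v Fs | S \subset G])).
  apply: eq_card => G; rewrite inE; apply/imsetP/andP => [[H]|[GF]].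
    rewrite inE in_lk -andbA => /and3P[vH HF SH] ->; split=> //; exact: setUS.
  rewrite subUset sub1set => /andP[vG SG]; exists (G :\ v); last by rewrite setD1K ?vG.
  by rewrite inE in_lk setD11 setD1K // GF subsetD1 SG.
move=> G G'; rewrite !inE !in_lk -!andbA => /and3P[vG _ _] /and3P[vG' _ _].
exact: setU1_inj.
Qed.

Lemma lk_star_conn q v Fs S : 1 < q -> v \notin S -> star_conn q Fs (v |: S) ->
  star_conn q.-1 (lk v Fs) S.
Proof.
move=> q1 vS h P F G; rewrite !in_lk => /andP[vF F1] /andP[vG G1] SF SG PF cl.
suff: P ((v |: G) :\ v) by rewrite setU1K.
apply: (h (fun H => P (H :\ v)) (v |: F)) => //; rewrite ?setUS ?setU1K //.
move=> H H' H1 H1'; rewrite !subUset !sub1set => /andP[vH SH] /andP[vH' SH'] PH c.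
apply: (cl (H :\ v)) => //; rewrite ?in_lk ?setD11 ?setD1K ?subsetD1 ?SH ?SH' //.
by rewrite -setDIl; apply: lk_cardE => //; rewrite inE vH.
Qed.

(** The ridge and star hypotheses concern only sets through v. So the lemma also serves the links of
    a [pair] at vertices off K, although a [pair] violates these axioms along K. *)
Lemma lk_spx q v Fs : 2 < q -> 
  (forall F, F \in Fs -> #|F| = q) ->
  (forall F S, F \in Fs -> v \in S -> S \subset F -> #|S| = q.-1 ->
    #|[set G in Fs | S \subset G]| = 2) ->
  (forall S, v \in S -> #|S|.+2 <= q -> star_conn q Fs S) -> spx q.-1 (lk v Fs).
Proof.
move=> q2 u t c; split.
- move=> F; rewrite in_lk => /andP[vF /u]; rewrite cardsU1 vF; lia.
- move=> F S; rewrite in_lk => /andP[vF FF] SF cS.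
  have vS : v \notin S by apply: contra vF; apply: (subsetP SF).
  rewrite lk_star //; apply: (t _ _ FF); rewrite ?setU11 ?setUS //.
  by rewrite cardsU1 vS cS; lia.
- move=> S cS; have [vS|vS] := boolP (v \in S).
    move=> P F G; rewrite in_lk => /andP[vF _] _ /subsetP/(_ v vS).
    by rewrite (negbTE vF).
  apply: lk_star_conn => //; first lia.
  by apply: c; rewrite ?setU11 // cardsU1 vS; lia.
Qed.

Lemma spx_lk q v Fs : 2 < q -> spx q Fs -> spx q.-1 (lk v Fs).
Proof.
move=> q2 [u t c]; apply: lk_spx => // [F S FF _|S _]; [exact: t | exact: c].
Qed.

Lemma mem_cover Fs v : (v \in cover Fs) = isf Fs [set v].
Proof.
apply/bigcupP/isfP => -[F FF].
  by exists F; rewrite ?sub1set.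
by rewrite sub1set; exists F.
Qed.

Lemma card_fk1 Fs : #|fk 1 Fs| = #|cover Fs|.
Proof.
rewrite -(card_imset (mem (cover Fs)) (@set1_inj T)); apply: eq_card => S.
rewrite inE; apply/andP/imsetP => [[/cards1P[v ->] h]|[v h ->]].
  by exists v => //=; rewrite mem_cover.
by rewrite cards1 -mem_cover.
Qed.

Lemma sum_lk (X : {set {set T}}) k : (forall S, S \in X -> #|S| = k) ->
  \sum_v #|[set S in X | v \in S]| = k * #|X|.
Proof.
move=> h; transitivity (\sum_v \sum_(S in X) (v \in S : nat)).
  apply: eq_bigr => v _; rewrite -sum1_card big_mkcond [RHS]big_mkcond /=.
  by apply: eq_bigr => S _; rewrite inE; case: (S \in X); case: (v \in S).
rewrite exchange_big /= mulnC -sum_nat_const; apply: eq_bigr => S /h <-.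
by rewrite -sum1_card [RHS]big_mkcond; apply: eq_bigr => v _; case: (v \in S).
Qed.

Lemma fk_lk v k Fs : #|fk k (lk v Fs)| = #|[set S in fk k.+1 Fs | v \in S]|.
Proof.
rewrite -(card_in_imset (f := fun G => v |: G) (D := fk k (lk v Fs))).
  apply: eq_card => G; rewrite inE; apply/imsetP/andP => [[H]|[]].
    rewrite !inE isf_lk => /and3P[/eqP cH vH h] ->.
    by rewrite !inE cardsU1 vH cH h !eqxx.
  rewrite inE => /andP[/eqP cG h] vG; exists (G :\ v); last by rewrite setD1K.
  by rewrite !inE isf_lk setD11 setD1K // h (lk_cardE vG cG) eqxx.
by move=> G G'; rewrite !inE !isf_lk => /and3P[_ vG _] /and3P[_ vG' _]; apply: setU1_inj.
Qed.

(** Double counting of incident pairs of a vertex and a face; this is how all bounds pass from links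
    to the complex. *)
Lemma sum_fk_lk k Fs : \sum_(v in cover Fs) #|fk k (lk v Fs)| = k.+1 * #|fk k.+1 Fs|.
Proof.
rewrite -(sum_lk (X := fk k.+1 Fs) (k := k.+1)); last by move=> S; rewrite inE => /andP[/eqP].
rewrite [LHS]big_mkcond; apply: eq_bigr => v _; case: ifP => [_|]; first exact: fk_lk.
move=> /negbT nv; rewrite -(cards0 {set T}); apply: eq_card => S; rewrite !inE.
apply/esym/negbTE; apply: contra nv => /andP[/andP[_ h] vS]; rewrite mem_cover.
by apply: isf_sub h; rewrite sub1set.
Qed.

Lemma fk_full q Fs : (forall F, F \in Fs -> #|F| = q) -> fk q Fs = Fs.
Proof.
move=> u; apply/setP => S; rewrite inE; apply/andP/idP => [[/eqP cS /isfP[F FF SF]]|SF].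
  suff -> : S = F by []. 
  by apply/eqP; rewrite eqEcard SF (u _ FF) cS /=.
by rewrite u // eqxx; split=> //; apply/isfP; exists S.
Qed.

Definition meet k Fs (A : {set T}) := [set S in fk k Fs | ~~ [disjoint S & A]].

Lemma meet_sub k Fs (A B : {set T}) : A \subset B -> meet k Fs A \subset meet k Fs B.
Proof.
move=> AB; apply/subsetP => S; rewrite !inE => /andP[-> /=].
by apply: contra => h; apply: disjointWr h.
Qed.

(** * Edges meeting a vertex set *)

Lemma sum_card_swap (A B : {set {set T}}) (r : {set T} -> {set T} -> bool) :
  \sum_(a in A) #|[set b in B | r a b]| = \sum_(b in B) #|[set a in A | r a b]|.
Proof.
transitivity (\sum_(a in A) \sum_(b in B) (r a b : nat)).
  apply: eq_bigr => a _; rewrite -sum1_card big_mkcond [RHS]big_mkcond /=.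
  by apply: eq_bigr => b _; rewrite inE; case: (b \in B); case: (r a b).
rewrite exchange_big; apply: eq_bigr => b _.
rewrite -sum1_card big_mkcond [RHS]big_mkcond /=.
by apply: eq_bigr => a _; rewrite inE; case: (a \in A); case: (r a b).
Qed.

Lemma card_subsets_meet (F C : {set T}) k :
  #|[set S : {set T} | [&& S \subset F, #|S| == k & ~~ [disjoint S & C]]]|
    + 'C(#|F :\: C|, k) = 'C(#|F|, k).
Proof.
rewrite -!cards_draws.
rewrite -[RHS](cardsID [set S : {set T} | [disjoint S & C]]) addnC; congr (_ + _).
  by apply: eq_card => S; rewrite !inE subsetD andbAC.
by apply: eq_card => S; rewrite !inE andbA andbC.
Qed.

Lemma addF2_eq (a b : 'F_2) : (a + b = 0 -> a = b)%R.
Proof.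
by move: a b; case=> [[|[|//]] ?] [[|[|//]] ?] // _; apply/val_inj.
Qed.

Lemma sumF2_pair (X : {set {set T}}) (x x' : {set T}) (f : {set T} -> 'F_2) :
  #|X| = 2 -> x \in X -> x' \in X -> (\sum_(z in X) f z = 0)%R -> f x = f x'.
Proof.
move=> c xX x'X; case: (eqVneq x x') => [-> //|n] h.
have e : X = [set x; x'].
  apply/eqP; rewrite eq_sym eqEcard cards2 n c andbT.
  by apply/subsetP => z; rewrite !inE => /orP[]/eqP ->.
by move: h; rewrite e big_setU1 ?inE //= big_set1 => /addF2_eq.
Qed.

Lemma sum_enum_val (U : finType) (V : nmodType) (A : {set U}) (g : U -> V) :
  (\sum_(i < #|A|) g (enum_val i) = \sum_(x in A) g x)%R.
Proof. by rewrite [RHS]big_enum_val. Qed.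

Definition edge_in Fs a b := isf Fs [set a; b].

(* Relative chain complex over F_2 of the open star of C: its H_0 vanishes
   because C is connected and has an edge leaving it, and its 2-cycles are
   constant on triangles, so that the Euler characteristic is at most 1. *)
Lemma surface_count Fs (C : {set T}) c0 u0 :
  (forall F, F \in Fs -> #|F| = 3) ->
  (forall F S, F \in Fs -> S \subset F -> #|S| = 2 -> ~~ [disjoint S & C] ->
    #|[set G in Fs | S \subset G]| = 2) ->
  (forall c, c \in C -> star_conn 3 Fs [set c]) ->
  (forall (P : T -> Prop) a b, a \in C -> b \in C -> P a ->
    (forall a b, a \in C -> b \in C -> edge_in Fs a b -> P a -> P b) -> P b) ->
  c0 \in C -> u0 \notin C -> edge_in Fs c0 u0 ->
  3 * #|C| + #|[set F in Fs | #|F :&: C| == 1]| <= #|meet 2 Fs C| + 3.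
Proof.
move=> u two starC connC c0C u0C e0.
pose FC := [set F in Fs | ~~ [disjoint F & C]].
pose EC := meet 2 Fs C.
have ECP S : S \in EC -> [/\ #|S| = 2, isf Fs S & exists2 c, c \in C & c \in S].
  rewrite !inE -andbA => /and3P[/eqP ? ?]; rewrite -setI_eq0 => /set0Pn[c].
  by rewrite inE => /andP[? ?]; split=> //; exists c.
have mem2 c a b : c \in C -> c \in [set a; b] -> a != b -> edge_in Fs a b -> [set a; b] \in EC.
  move=> cC cab ab h; rewrite !inE cards2 ab eqxx /= -/(edge_in Fs a b) h /=.
  by rewrite -setI_eq0; apply/set0Pn; exists c; rewrite inE cab.
have FCP F : F \in FC -> F \in Fs /\ exists2 c, c \in C & c \in F.
  rewrite inE => /andP[-> ]; rewrite -setI_eq0 => /set0Pn[c].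
  by rewrite inE => /andP[? ?]; split=> //; exists c.
have FCI F c : F \in Fs -> c \in C -> c \in F -> F \in FC.
  by move=> FF cC cF; rewrite inE FF -setI_eq0; apply/set0Pn; exists c; rewrite inE cF cC.
have twoE S : S \in EC -> [set F in FC | S \subset F] = [set F in Fs | S \subset F].
  move=> /ECP[_ _ [c cC cS]]; apply/setP => F; rewrite !inE.
  case: (boolP (S \subset F)) => SF; rewrite ?andbF // !andbT.
  case: (boolP (F \in Fs)) => //= FF.
  by have := FCI F c FF cC (subsetP SF c cS); rewrite inE FF.
have cardE S : S \in EC -> #|[set F in FC | S \subset F]| = 2.
  move=> SE; rewrite twoE //; move: SE; rewrite !inE -andbA => /and3P[/eqP cS /isfP[F FF SF] m].
  exact: two FF SF cS m.
have EF S F : F \in Fs -> S \subset F -> #|S| = 2 -> ~~ [disjoint S & C] -> S \in EC.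
  by move=> FF SF cS m; rewrite !inE cS eqxx m andbT; apply/isfP; exists F.
(* A triangle with two or three vertices in C has three edges meeting C, one with a single vertex in
   C only two; every edge meeting C lies in two triangles. *)
have count : 2 * #|EC| + #|[set F in Fs | #|F :&: C| == 1]| = 3 * #|FC|.
  have -> : 2 * #|EC| = \sum_(F in FC) #|[set S in EC | S \subset F]|.
    rewrite -[RHS](sum_card_swap EC FC (fun S F => S \subset F)).
    by rewrite (eq_bigr _ cardE) sum_nat_const mulnC.
  have -> : #|[set F in Fs | #|F :&: C| == 1]| = \sum_(F in FC) (#|F :&: C| == 1).
    rewrite -sum1_card big_mkcond [RHS]big_mkcond /=; apply: eq_bigr => F _; rewrite !inE -setI_eq0 -cards_eq0.
    by case: (F \in Fs) => //=; case: #|_| => [|[|?]].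
  rewrite -big_split /= mulnC -[RHS]sum_nat_const; apply: eq_bigr => F /FCP[FF [c cC cF]].
  have -> : [set S in EC | S \subset F] =
      [set S : {set T} | [&& S \subset F, #|S| == 2 & ~~ [disjoint S & C]]].
    apply/setP => S; rewrite !inE; apply/andP/and3P => [[/andP[/andP[? ?] ?] ?]|[c1 c2 c3]] //.
    by split=> //; rewrite c2 c3 /= andbT; apply/isfP; exists F.
  have := card_subsets_meet F C 2; rewrite (u _ FF).
  have := cardsID C F; rewrite (u _ FF).
  have : 0 < #|F :&: C| by apply/card_gt0P; exists c; rewrite inE cF cC.
  by case: #|F :&: C| => [//|[|[|[|?]]]] _; case: #|F :\: C| => [|[|[|[|?]]]] //= _;
     rewrite /binomial /=; lia.
(* The boundary maps modulo all faces that miss C. Their product vanishes because a triangle has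
   exactly two edges at each of its vertices. *)
pose D2 : 'M['F_2]_(#|FC|, #|EC|) :=
  (\matrix_(i < #|FC|, j < #|EC|) (enum_val j \subset enum_val i)%:R)%R.
pose D1 : 'M['F_2]_(#|EC|, #|C|) := (\matrix_(i < #|EC|, j < #|C|) (enum_val j \in enum_val i)%:R)%R.
have D21 : (D2 *m D1 = 0)%R.
  apply/matrixP => i j; rewrite !mxE.
  under eq_bigr do rewrite !mxE.
  rewrite (sum_enum_val EC (fun S => (S \subset enum_val i)%:R * (enum_val j \in S)%:R)%R).
  set F := enum_val i; set c := enum_val j.
  have [FF _] := FCP F (enum_valP i); have cC : c \in C := enum_valP j.
  have -> : (\sum_(S in EC) (S \subset F)%:R * (c \in S)%:R =
     #|[set S in EC | (S \subset F) && (c \in S)]|%:R :> 'F_2)%R.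
    rewrite -sum1_card natr_sum big_mkcond [RHS]big_mkcond /=; apply: eq_bigr => S _.
    rewrite [in RHS]inE; case: (S \in EC) => //=.
    by case: (S \subset F); case: (c \in S); rewrite ?(mul1r, mul0r, mulr0).
  case: (boolP (c \in F)) => cF; last first.
    rewrite (_ : [set S in EC | _] = set0) ?cards0 //; apply/setP => S; rewrite !inE.
    apply/negbTE/negP => /andP[_ /andP[SF cS]]; case/negP: cF; exact: (subsetP SF).
  have -> : [set S in EC | (S \subset F) && (c \in S)] = [set [set c; x] | x in F :\ c].
    apply/setP => S; apply/idP/imsetP => [|[x]].
      rewrite inE => /and3P[/ECP[cS _ _] SF cinS].
      have /cards1P[x xE] : #|S :\ c| == 1 by rewrite (lk_cardE cinS cS).
      exists x; last by rewrite -xE setD1K.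
      have : x \in S :\ c by rewrite xE inE.
      by rewrite !inE => /andP[-> /(subsetP SF)].
    rewrite !inE => /andP[xc xF] ->.
    have sub : [set c; x] \subset F by rewrite subUset !sub1set cF.
    rewrite cards2 [c == x]eq_sym xc eqxx set21 sub !andbT; apply/andP; split.
      by apply/isfP; exists F.
    by rewrite -setI_eq0; apply/set0Pn; exists c; rewrite inE set21.
  rewrite card_in_imset; first by rewrite (lk_cardE cF (u _ FF)); apply/eqP.
  move=> x x'; rewrite !inE => /andP[xc _] /andP[xc' _]; move=> h; apply: set1_inj.
  by apply: (setU1_inj _ _ h); rewrite inE eq_sym.
(* A functional on C killed by the transpose takes equal values at the ends of every edge inside C,
   and it vanishes at c0 because the edge to u0 has only one end in C. *)
have rank1 : \rank D1 = #|C|.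
  rewrite -mxrank_tr; apply/eqP; change (row_free D1^T); apply: inj_row_free => w w0.
  have zero S : S \in EC -> (\sum_(c in C) w 0 (enum_rank_in c0C c) * (c \in S)%:R = 0)%R.
    move=> SE; have := congr1 (fun M : 'rV_ _ => M 0%R (enum_rank_in SE S)) w0.
    rewrite !mxE => h; apply: etrans h.
    rewrite -(sum_enum_val C (fun c => w 0%R (enum_rank_in c0C c) * (c \in S)%:R)%R).
    by apply: eq_bigr => i _; rewrite !mxE enum_valK_in enum_rankK_in.
  pose f c := w 0%R (enum_rank_in c0C c).
  suff fz c : c \in C -> f c = 0%R.
    apply/rowP => i; rewrite mxE -(fz _ (enum_valP i)) /f enum_valK_in //.
  move=> cC; apply: (connC (fun c => f c = 0%R) c0 c) => //.
    have n : c0 != u0 by apply: contraNneq u0C => <-.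
    have := zero _ (mem2 c0 c0 u0 c0C (set21 _ _) n e0).
    rewrite (bigD1 c0) //= set21 mulr1 big1 ?addr0 // => x /andP[xC xc].
    rewrite !inE (negbTE xc) /=; case: eqP => [xu|]; last by rewrite mulr0.
    by rewrite -xu xC in u0C.
  move=> a b aC bC eab fa; case: (eqVneq a b) => [<- //|n].
  have := zero _ (mem2 a a b aC (set21 _ _) n eab).
  rewrite (bigD1 a) //= set21 mulr1 (bigD1 b) /= ?bC 1?eq_sym // set22 mulr1.
  rewrite [w _ _]fa add0r big1 ?addr0 // => x /andP[/andP[_ xa] xb].
  by rewrite !inE (negbTE xa) (negbTE xb) mulr0.
(* The two triangles at an edge meeting C get the same coefficient in a cycle. Connected stars and
   the connectedness of C make all coefficients equal, so the kernel has dimension at most one. *)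
have rank2 : #|FC| <= (\rank D2).+1.
  have /isfP[F0 F0F] := e0; rewrite subUset !sub1set => /andP[c0F0 _].
  have F0C : F0 \in FC := FCI _ _ F0F c0C c0F0.
  have : (kermx D2 <= (const_mx 1%R : 'rV['F_2]_#|FC|))%MS.
    apply/row_subP => r; have : (row r (kermx D2) *m D2 = 0)%R.
      by rewrite -row_mul mulmx_ker row0.
    set w := row r _ => w0.
    pose f F := w 0%R (enum_rank_in F0C F).
    have fE F F' S : S \in EC -> F \in Fs -> F' \in Fs -> S \subset F -> S \subset F' -> f F = f F'.
      move=> SE FF FF' SF SF'; have [_ _ [c cC cS]] := ECP _ SE.
      apply: (sumF2_pair (X := [set F in FC | S \subset F])); rewrite ?cardE //.
      - by rewrite inE SF andbT (FCI _ _ FF cC) // (subsetP SF).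
      - by rewrite inE SF' andbT (FCI _ _ FF' cC) // (subsetP SF').
      have := congr1 (fun M : 'rV_ _ => M 0%R (enum_rank_in SE S)) w0.
      rewrite [LHS]mxE [RHS]mxE => h; apply: etrans h.
      transitivity (\sum_(F in FC) f F * (S \subset F)%:R)%R.
        rewrite big_mkcond [RHS]big_mkcond /=; apply: eq_bigr => G _; rewrite inE.
        by case: (G \in FC); case: (S \subset G); rewrite ?(mulr0, mulr1).
      rewrite -(sum_enum_val FC (fun F => f F * (S \subset F)%:R)%R).
      by apply: eq_bigr => i _; rewrite /f enum_valK_in [D2 _ _]mxE enum_rankK_in.
    have fstar c F F' : c \in C -> F \in Fs -> F' \in Fs -> c \in F -> c \in F' -> f F = f F'.
      move=> cC FF FF' cF cF'.
      apply: (starC c cC (fun G => f F = f G) F F'); rewrite ?sub1set //.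
      move=> G G' GF GF'; rewrite !sub1set => cG cG' -> cGG.
      apply: (fE _ _ (G :&: G')); rewrite ?subsetIl ?subsetIr //.
      apply: (EF _ G) => //; rewrite ?subsetIl //.
      by rewrite -setI_eq0; apply/set0Pn; exists c; rewrite !inE cG cG' cC.
    have fall F : F \in FC -> f F = f F0.
      move=> /FCP[FF [c cC cF]].
      apply: (connC (fun c => forall F, F \in Fs -> c \in F -> f F = f F0) c0 c) => //.
        by move=> G GF cG; apply: (fstar c0).
      move=> a b aC bC /isfP[G GF]; rewrite subUset !sub1set => /andP[aG bG] ha H HF bH.
      by rewrite (fstar b H G) // ha.
    have -> : w = (f F0 *: const_mx 1)%R.
      apply/rowP => i; rewrite !mxE mulr1 -(fall _ (enum_valP i)) /f enum_valK_in.
      by rewrite !mxE.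
    exact: scalemx_sub.
  move=> /mxrankS; rewrite mxrank_ker; have := rank_leq_row (const_mx 1%R : 'rV['F_2]_#|FC|).
  have := rank_leq_row D2; clear; lia.
(* The ranks add up to at most |EC|, so |FC| - 1 + |C| <= |EC|; tripling this and inserting [count]
   gives the claim. *)
have := mulmx0_rank_max D21; rewrite rank1 => h.
by rewrite -/EC; move: h rank2 count; clear; lia.
Qed.

Lemma mem_cover_lk b x Fs : (x \in cover (lk b Fs)) = (b != x) && edge_in Fs b x.
Proof. by rewrite mem_cover isf_lk inE. Qed.

Lemma edge_inC Fs a b : edge_in Fs a b = edge_in Fs b a.
Proof. by rewrite /edge_in setUC. Qed.

Lemma edge_inP Fs F a b : F \in Fs -> a \in F -> b \in F -> edge_in Fs a b.
Proof. by move=> FF aF bF; apply/isfP; exists F => //; rewrite subUset !sub1set aF. Qed.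

Lemma meetP k Fs (A S : {set T}) :
  reflect [/\ #|S| = k, isf Fs S & exists2 a, a \in A & a \in S] (S \in meet k Fs A).
Proof.
rewrite !inE -setI_eq0; apply: (iffP andP) => [[/andP[/eqP ? ?] /set0Pn[a]]|[-> -> [a aA aS]]].
  by rewrite inE => /andP[? ?]; split=> //; exists a.
by rewrite eqxx; split=> //; apply/set0Pn; exists a; rewrite inE aS.
Qed.

Lemma ndisjP (A B : {set T}) : reflect (exists2 a, a \in A & a \in B) (~~ [disjoint A & B]).
Proof.
rewrite -setI_eq0; apply: (iffP (set0Pn _)) => -[a].
  by rewrite inE => /andP[]; exists a.
by move=> aA aB; exists a; rewrite inE aA.
Qed.

Lemma disjW (A B : {set T}) a : [disjoint A & B] -> a \in A -> a \notin B.
Proof. by move=> d aA; apply: contraTN d => aB; apply/ndisjP; exists a. Qed.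

Lemma facet_frontier q Fs (C : {set T}) Phi G : 1 < q -> spx q Fs -> Phi \in Fs ->
  [disjoint Phi & C] -> G \in Fs -> ~~ [disjoint G & C] ->
  exists F F', [/\ F \in Fs, F' \in Fs, ~~ [disjoint F & C], [disjoint F' & C] &
    #|F :&: F'| = q.-1].
Proof.
move=> q1 [u t c] PF dP GF; apply: contraNP => no.
apply: (c set0 _ (fun F => [disjoint F & C]) Phi G); rewrite ?cards0 ?sub0set //.
move=> F F' FF F'F _ _ d e; apply: contraT => n; case: no.
by exists F', F; split=> //; rewrite setIC.
Qed.

(** These triangles pay for the 3 lost in [surface_count]. Let the edge xy separate a triangle F
    meeting C from F' missing C. At a vertex off C the number of triangles with exactly one vertex
    in C is even, so x and y each lie on a second one. Neither of these contains both x and y, since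
    F and F' are the only triangles at xy; so the two are distinct. *)
Lemma spx3_frontier Fs (C : {set T}) Phi G : spx 3 Fs -> Phi \in Fs -> [disjoint Phi & C] ->
  G \in Fs -> ~~ [disjoint G & C] -> 2 < #|[set F in Fs | #|F :&: C| == 1]|.
Proof.
move=> sF PF dP GF nG.
have [F [F' [FF F'F nF dF' c2]]] := facet_frontier (q := 3) isT sF PF dP GF nG.
have /cards2P[x [y [xy E]]] : #|F :&: F'| == 2 by rewrite c2.
have mem z : z \in [set x; y] -> [/\ z \in F, z \in F' & z \notin C].
  by rewrite -E inE => /andP[? zF']; split=> //; apply: disjW dF' zF'.
have cF : #|F :&: C| == 1.
  have /ndisjP[a aF aC] := nF.
  rewrite eqn_leq; apply/andP; split; last by apply/card_gt0P; exists a; rewrite inE aF.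
  have := cardsID (F :&: F') F; rewrite (setIidPr (subsetIl _ _)) c2 (spx_card sF FF) => h.
  have : #|F :&: C| <= #|F :\: (F :&: F')|.
    apply/subset_leq_card/subsetP => z; rewrite !inE => /andP[zF zC]; rewrite zF /= andbT.
    by apply/negP => zF'; have := disjW dF' zF'; rewrite zC.
  by move: h; clear; lia.
(* Parity: count the pairs of a triangle at w and a vertex of C on it. Each edge from w into C lies
   in two triangles, and a triangle with two vertices in C counts twice. *)
pose cut w := [set H in Fs | (w \in H) && (#|H :&: C| == 1)].
have even w : w \notin C -> ~~ odd #|cut w|.
  move=> wC; pose X := [set H in Fs | w \in H].
  have e1 : \sum_(H in X) #|H :&: C| = \sum_(a in C) #|[set H in X | a \in H]|.
    transitivity (\sum_(H in X) \sum_(a in C) (a \in H : nat)).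
      apply: eq_bigr => H _; rewrite -sum1_card big_mkcond [RHS]big_mkcond /=.
      by apply: eq_bigr => a _; rewrite inE; case: (a \in H); case: (a \in C).
    rewrite exchange_big /=; apply: eq_bigr => a _.
    rewrite -sum1_card big_mkcond [RHS]big_mkcond /=.
    by apply: eq_bigr => H _; rewrite !inE; case: (H \in Fs); case: (w \in H); case: (a \in H).
  have e2 : \sum_(H in X) #|H :&: C| = #|cut w| + 2 * \sum_(H in X) (#|H :&: C| == 2).
    rewrite big_distrr /= -sum1_card [X in X + _]big_mkcond [X in _ = _ + X]big_mkcond -big_split /=.
    rewrite [LHS]big_mkcond; apply: eq_bigr => H _; rewrite !inE.
    case: (boolP (H \in Fs)) => //= HF; case: (boolP (w \in H)) => //= wH.
    have : #|H :&: C| <= #|H :\ w|.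
      apply/subset_leq_card/subsetP => z; rewrite !inE => /andP[-> zC]; rewrite andbT.
      by apply: contraNneq wC => <-.
    by rewrite (lk_cardE wH (spx_card sF HF)); case: #|_| => [|[|[|]]].
  have e3 : 2 %| \sum_(a in C) #|[set H in X | a \in H]|.
    apply: dvdn_sum => a aC.
    have -> : [set H in X | a \in H] = [set H in Fs | [set w; a] \subset H].
      by apply/setP => H; rewrite !inE subUset !sub1set andbA.
    case: (set_0Vmem [set H in Fs | [set w; a] \subset H]) => [->|[H]]; first by rewrite cards0.
    rewrite inE => /andP[HF wa]; rewrite (spx_two sF HF wa) //.
    by rewrite cards2 (_ : w != a) //; apply: contraNneq wC => ->.
  by move: e3; rewrite -e1 e2 dvdn_addl ?dvdn_mulr // dvdn2.
have other z : z \in [set x; y] -> exists H, [/\ H \in Fs, #|H :&: C| == 1, H != F & z \in H].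
  move=> zxy; have [zF zF' zC] := mem z zxy.
  have Fcut : F \in cut z by rewrite inE FF zF.
  have : 0 < #|cut z :\ F|.
    by have := even z zC; rewrite (cardsD1 F) Fcut /=; case: #|_|.
  by move=> /card_gt0P[H]; rewrite !inE => /and4P[n HF zH cH]; exists H.
have excl H : H \in Fs -> #|H :&: C| == 1 -> H != F -> ~~ ([set x; y] \subset H).
  move=> HF cH n; apply/negP => s.
  have := spx_two sF FF (subsetIl F F') c2; rewrite E => two.
  have : #|[set F; F'; H]| <= 2.
    rewrite -two; apply/subset_leq_card/subsetP => Z; rewrite !inE -orbA.
    by case/or3P => /eqP ->; rewrite ?FF ?F'F ?HF ?s -?E ?subsetIl ?subsetIr.
  have n1 : F != F' by apply: contraNneq nF => ->.
  have n2 : F' != H.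
    apply: contraTneq cH => <-; rewrite (_ : F' :&: C = set0) ?cards0 //; apply/eqP.
    by rewrite setI_eq0.
  by rewrite -setUA cardsU1 !inE negb_or cards2 n1 n2 (eq_sym F) n.
have [H [HF cH nH xH]] := other x (set21 _ _).
have [H' [H'F cH' nH' yH']] := other y (set22 _ _).
have : #|[set F; H; H']| <= #|[set F in Fs | #|F :&: C| == 1]|.
  apply/subset_leq_card/subsetP => Z; rewrite !inE -orbA.
  by case/or3P => /eqP ->; rewrite ?FF ?HF ?H'F ?cF ?cH ?cH'.
rewrite -setUA cardsU1 !inE negb_or cards2 !(eq_sym F) nH nH' /=.
have -> // : H != H'.
apply: contraTneq (excl _ HF cH nH) => e; rewrite negbK subUset !sub1set xH e yH' //.
Qed.

(** Connected components C of A are split off one at a time, since [surface_count] needs C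
    connected. No edge meets both C and the rest of A, so the edge counts add. *)
Lemma gromov3 Fs (A : {set T}) Phi : spx 3 Fs -> Phi \in Fs -> [disjoint Phi & A] ->
  A \subset cover Fs -> 3 * #|A| <= #|meet 2 Fs A|.
Proof.
move=> sF PF; move: {2}(#|A|) (leqnn #|A|) => n; elim: n A => [|n IH] A.
  by rewrite leqn0 cards_eq0 => /eqP -> _ _; rewrite cards0.
move=> An dP Ac; case: (set_0Vmem A) => [->|[c0 c0A]]; first by rewrite cards0.
pose e : rel T := fun a b => [&& a \in A, b \in A & edge_in Fs a b].
have esym : symmetric e by move=> a b; rewrite /e edge_inC andbCA.
have csym : connect_sym e by apply: sym_connect_sym.
pose C := [set b in A | connect e c0 b].
have c0C : c0 \in C by rewrite inE c0A connect0.
have CA : C \subset A by apply/subsetP => z; rewrite inE => /andP[].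
have Cedge a b : a \in C -> b \in A -> edge_in Fs a b -> b \in C.
  rewrite !inE => /andP[aA ca] bA ab; rewrite bA (connect_trans ca) //.
  by apply: connect1; rewrite /e aA bA.
have dPC : [disjoint Phi & C] by apply: disjointWr dP.
have [G GF c0G] : exists2 G, G \in Fs & c0 \in G.
  by have /bigcupP[G] := subsetP Ac c0 c0A; exists G.
have nG : ~~ [disjoint G & C] by apply/ndisjP; exists c0.
have [F [F' [FF F'F nF dF' c2]]] := facet_frontier (q := 3) isT sF PF dPC GF nG.
have [w] : exists w, w \in F :&: F' by apply/card_gt0P; rewrite c2.
rewrite inE => /andP[wF wF']; have wC := disjW dF' wF'.
have /ndisjP[c cF cC] := nF.
have h1 := spx3_frontier sF PF dPC GF nG.
have h2 : 3 * #|C| + #|[set F in Fs | #|F :&: C| == 1]| <= #|meet 2 Fs C| + 3.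
  apply: (surface_count (c0 := c) (u0 := w)) => //.
  - exact: spx_card sF.
  - by move=> H S HF SH cS _; apply: (spx_two sF HF SH cS).
  - by move=> z _; apply: (spx_conn sF); rewrite cards1.
  - move=> P a b aC bC Pa cl.
    have : connect e a b.
      by move: aC bC; rewrite !inE csym => /andP[_ ca] /andP[_ cb]; apply: connect_trans ca cb.
    case/connectP => p; elim: p a aC Pa => [|z p IHp] a aC Pa /=; first by move=> _ ->.
    move=> /andP[/and3P[aA zA az] pz] l; have zC := Cedge _ _ aC zA az.
    by apply: (IHp z) => //; apply: cl az Pa.
  by apply: (edge_inP FF).
have h3 : 3 * #|A :\: C| <= #|meet 2 Fs (A :\: C)|.
  apply: IH; last by apply: subset_trans Ac; apply: subsetDl.
    rewrite -ltnS; apply: leq_trans An; apply: proper_card; apply/properP.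
    by split; [apply: subsetDl | exists c0 => //; rewrite inE c0C].
  by apply: disjointWr dP; apply: subsetDl.
have : #|meet 2 Fs C :|: meet 2 Fs (A :\: C)| <= #|meet 2 Fs A|.
  by apply: subset_leq_card; rewrite subUset !meet_sub // subsetDl.
rewrite cardsU (_ : _ :&: _ = set0) ?cards0.
  by have := cardsID C A; rewrite (setIidPr CA); move: h1 h2 h3; clear; lia.
apply/setP => S; rewrite inE [RHS]inE; apply/negbTE/negP => /andP[].
case/meetP => cS fS [a aC aS] /meetP[_ _ [b]]; rewrite inE => /andP[nb bA] bS.
case/negP: nb; apply: (Cedge a) => //; apply: isf_sub fS.
by rewrite subUset !sub1set aS.
Qed.

(* The open star of b contributes the edges of the link and the edges at b;
   an edge meeting D outside the star is not among them. *)
Lemma star_step Fs (Q : pred {set T}) b (D X : {set T}) : b \notin D ->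
  X \subset D :&: cover (lk b Fs) ->
  (forall e, e \in meet 2 (lk b Fs) X -> Q e) ->
  (forall w, w \in D :&: cover (lk b Fs) -> Q [set b; w]) ->
  #|meet 2 (lk b Fs) X| + #|D :&: cover (lk b Fs)|
     + #|[set e in meet 2 Fs (D :\: cover (lk b Fs)) | Q e]|
    <= #|[set e in meet 2 Fs D | Q e]|.
Proof.
move=> bD XW Q1 Q2; set W := D :&: _.
pose E1 := meet 2 (lk b Fs) X; pose E2 := [set [set b; w] | w in W].
pose E3 := [set e in meet 2 Fs (D :\: cover (lk b Fs)) | Q e].
have XD a : a \in X -> a \in D by move/(subsetP XW); rewrite inE => /andP[].
have WP w : w \in W -> [/\ w \in D, b != w & edge_in Fs b w].
  by rewrite inE mem_cover_lk => /and3P[].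
have cE2 : #|E2| = #|W|.
  rewrite card_in_imset // => w w' /WP[_ bw _] /WP[_ bw' _] h; apply: set1_inj.
  by apply: (setU1_inj _ _ h); rewrite inE.
have d12 : E1 :&: E2 = set0.
  apply/setP => S; rewrite inE [RHS]inE; apply/negbTE/negP => /andP[/meetP[_ h _]].
  by case/imsetP => w _ E; move: h; rewrite isf_lk E set21.
have d123 : (E1 :|: E2) :&: E3 = set0.
  apply/setP => S; rewrite inE [RHS]inE; apply/negbTE/negP => /andP[h].
  rewrite inE => /andP[/meetP[_ _ [a]]]; rewrite inE => /andP[na aD] aS _.
  move: h; rewrite inE => /orP[/meetP[_ h _]|/imsetP[w wW E]].
    by case/negP: na; rewrite mem_cover; apply: isf_sub h; rewrite sub1set.
  move: aS; rewrite E !inE => /orP[]/eqP ea; first by rewrite ea (negbTE bD) in aD.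
  by move: wW; rewrite inE -ea (negbTE na) andbF.
have sub : (E1 :|: E2) :|: E3 \subset [set e in meet 2 Fs D | Q e].
  rewrite !subUset; apply/andP; split; first (apply/andP; split).
  - apply/subsetP => S S1; rewrite inE (Q1 _ S1) andbT.
    have /meetP[cS h [a aX aS]] := S1; apply/meetP; split=> //.
      by move: h; rewrite isf_lk => /andP[_]; apply: isf_sub; apply: subsetUr.
    by exists a => //; apply: XD.
  - apply/subsetP => S /imsetP[w wW ->]; rewrite inE (Q2 _ wW) andbT.
    have [wD bw h] := WP w wW; apply/meetP; split=> //; first by rewrite cards2 bw.
    by exists w => //; rewrite set22.
  - have sDD := meet_sub 2 Fs (subsetDl D (cover (lk b Fs))).
    by apply/subsetP => S /setIdP[S1 QS]; rewrite inE (subsetP sDD) ?QS.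
have := subset_leq_card sub.
by rewrite cardsU d123 cards0 subn0 cardsU d12 cards0 subn0 cE2.
Qed.

Lemma lk_facet b Fs Psi : Psi \in Fs -> b \in Psi -> Psi :\ b \in lk b Fs.
Proof. by move=> h bP; rewrite in_lk setD11 setD1K. Qed.

Lemma lk_coverP b Fs F x : F \in Fs -> b \in F -> x \in F -> x != b -> x \in cover (lk b Fs).
Proof. by move=> FF bF xF n; rewrite mem_cover_lk eq_sym n (edge_inP FF). Qed.

(** Pick b on a facet Psi that misses A such that b has neighbours W in A. The link of b has the
    facet Psi minus b missing W, so by induction on q it holds (q - 1)|W| edges meeting W; the edges
    from b to W add |W| more. The rest of A is smaller and is still missed by Psi. *)
Lemma gromov q Fs (A : {set T}) Phi : 2 < q -> spx q Fs -> Phi \in Fs -> [disjoint Phi & A] ->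
  A \subset cover Fs -> q * #|A| <= #|meet 2 Fs A|.
Proof.
move: q Fs A Phi; elim=> [//|q IHq] Fs A Phi; rewrite leq_eqVlt => /orP[/eqP <-|q2].
  exact: gromov3.
move=> sF; move: {2}(#|A|) (leqnn #|A|) => n; elim: n A Phi => [|n IH] A Phi.
  by rewrite leqn0 cards_eq0 => /eqP -> *; rewrite cards0 muln0.
move=> An PF dP Ac; case: (set_0Vmem A) => [->|[a0 a0A]]; first by rewrite cards0 muln0.
have /bigcupP[G GF a0G] := subsetP Ac a0 a0A.
have [b [Psi [PsF bP dPs [w wA wl]]]] : exists b Psi, [/\ Psi \in Fs, b \in Psi,
    [disjoint Psi & A] & exists2 w, w \in A & w \in cover (lk b Fs)].
  have nG : ~~ [disjoint G & A] by apply/ndisjP; exists a0.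
  have q1 : 1 < q.+1 by move: q2; clear; lia.
  have [F [F' [FF F'F nF dF' c]]] := facet_frontier q1 sF PF dP GF nG.
  have [b] : exists b, b \in F :&: F' by apply/card_gt0P; rewrite c; move: q2; clear; lia.
  rewrite inE => /andP[bF bF']; exists b, F'; split=> //.
  have /ndisjP[w wF wA] := nF; exists w => //; apply: lk_coverP FF bF wF _.
  by apply: contraTneq wA => ->; apply: disjW dF' bF'.
have bA : b \notin A by apply: disjW dPs bP.
pose W := A :&: cover (lk b Fs).
have step := @star_step Fs xpredT b A W bA (subxx _) (fun _ _ => isT) (fun _ _ => isT).
have link : q * #|W| <= #|meet 2 (lk b Fs) W|.
  apply: (IHq _ _ (Psi :\ b)) => //; [exact: (@spx_lk q.+1 b Fs (ltnW q2) sF) | exact: lk_facet | |exact: subsetIr].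
  by apply: disjointWl (subsetDl _ _) _; apply: disjointWr dPs; apply: subsetIl.
have rest : q.+1 * #|A :\: cover (lk b Fs)| <= #|meet 2 Fs (A :\: cover (lk b Fs))|.
  apply: (IH _ Psi) => //; last by apply: subset_trans Ac; apply: subsetDl.
    rewrite -ltnS; apply: leq_trans An; apply: proper_card; apply/properP.
    by split; [apply: subsetDl | exists w => //; rewrite inE wl].
  by apply: disjointWr dPs; apply: subsetDl.
have pT B : [set e in meet 2 Fs B | xpredT e] = meet 2 Fs B.
  by apply/setP => e; rewrite inE andbT.
rewrite !pT in step; have := cardsID (cover (lk b Fs)) A; rewrite -/W.
by rewrite -/W in step; move: step link rest; clear; nia.
Qed.

Definition bd q Fs (K : {set T}) := [set F :&: K | F in [set F in Fs | #|F :&: K| == q.-1]].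

(* The facets other than K of a q-polytope all of whose facets except K are
   simplices; bd is the boundary complex of K. *)
Record pair q Fs (K : {set T}) : Prop := Pair {
  pr_card : forall F, F \in Fs -> #|F| = q;
  pr_two : forall F S, F \in Fs -> S \subset F -> #|S| = q.-1 ->
    #|[set G in Fs | S \subset G]| + (S \subset K) = 2;
  pr_star : forall S, ~~ (S \subset K) -> #|S|.+2 <= q -> star_conn q Fs S;
  pr_bd : spx q.-1 (bd q Fs K);
  pr_notK : forall F, F \in Fs -> ~~ (F \subset K);
  pr_cov : forall S, isf Fs S -> S \subset K -> isf (bd q Fs K) S;
  pr_conn : forall S, S \subset K -> #|S|.+2 <= q -> forall (P : T -> Prop) a b,
    a \notin K -> b \notin K -> isf Fs (a |: S) -> isf Fs (b |: S) -> P a ->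
    (forall a b, a \notin K -> b \notin K -> isf Fs (a |: (b |: S)) -> P a -> P b) -> P b }.

Lemma bdP q Fs K S : reflect (exists F, [/\ F \in Fs, #|F :&: K| = q.-1 & S = F :&: K])
  (S \in bd q Fs K).
Proof.
apply: (iffP imsetP) => [[F]|[F [FF c ->]]].
  by rewrite inE => /andP[FF /eqP c] ->; exists F.
by exists F => //; rewrite inE FF c eqxx.
Qed.

Lemma bd_lk q v Fs (K : {set T}) : 1 < q -> v \in K -> bd q.-1 (lk v Fs) K = lk v (bd q Fs K).
Proof.
move=> q1 vK; apply/setP => S; rewrite in_lk; apply/bdP/andP.
  move=> [F []]; rewrite in_lk => /andP[vF FF] c ->; split; first by rewrite inE (negbTE vF).
  apply/bdP; exists (v |: F); rewrite setIUl (setIidPl _) ?sub1set //; split=> //.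
  by rewrite cardsU1 inE (negbTE vF) c; lia.
move=> [vS /bdP[F [FF c E]]].
have vF : v \in F by have := setU11 v S; rewrite E inE => /andP[].
exists (F :\ v); have E' : (F :\ v) :&: K = S by rewrite setIDAC -E setU1K.
split; rewrite ?E' //; first by rewrite in_lk setD11 setD1K.
by have := congr1 (fun X : {set T} => #|X|) E; rewrite cardsU1 vS c; lia.
Qed.

(** The set K is not shrunk in the link, although v and other points of K may no longer be vertices
    there. For this reason the bounds count [K :&: cover Fs] and not K. *)
Lemma pair_lk q v Fs (K : {set T}) : 3 < q -> v \in K -> pair q Fs K -> pair q.-1 (lk v Fs) K.
Proof.
move=> q3 vK p; split.
- move=> F; rewrite in_lk => /andP[vF /(pr_card p)]; rewrite cardsU1 vF; clear; lia.
- move=> F S; rewrite in_lk => /andP[vF FF] SF cS.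
  have vS : v \notin S by apply: contra vF; apply: (subsetP SF).
  have -> : (S \subset K) = (v |: S \subset K) by rewrite subUset sub1set vK.
  rewrite lk_star //; apply: (pr_two p FF); rewrite ?setUS //.
  by rewrite cardsU1 vS cS; lia.
- move=> S nS cS; have [vS|vS] := boolP (v \in S).
    move=> P F G; rewrite in_lk => /andP[vF _] _ /subsetP/(_ v vS).
    by rewrite (negbTE vF).
  apply: lk_star_conn => //; first lia.
  apply: (pr_star p); first by rewrite subUset negb_and nS orbT.
  by rewrite cardsU1 vS; lia.
- rewrite bd_lk //; last lia.
  by apply: (spx_lk _ _ (pr_bd p)); move: q3; clear; lia.
- move=> F; rewrite in_lk => /andP[vF /(pr_notK p)].
  by rewrite subUset sub1set vK.
- move=> S; rewrite isf_lk => /andP[vS h] SK; rewrite bd_lk //; last lia.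
  by rewrite isf_lk vS (pr_cov p h) // subUset sub1set vK.
move=> S SK cS P a b aK bK; rewrite !isf_lk => /andP[va ha] /andP[vb hb] Pa cl.
have vS : v \notin S by apply: contra va => h; rewrite inE h orbT.
apply: (pr_conn p (S := v |: S) _ _ aK bK) => //; rewrite ?subUset ?sub1set ?vK //.
- by rewrite cardsU1 vS; lia.
- by rewrite setUCA.
- by rewrite setUCA.
move=> x z xK zK h; apply: cl => //; rewrite isf_lk.
have -> : v |: (x |: (z |: S)) = x |: (z |: (v |: S)) by rewrite !(setUCA [set v]).
rewrite h andbT !inE !negb_or vS andbT.
by apply/andP; split; apply: contraNneq xK => e; [rewrite -e | case/negP: zK; rewrite -e].
Qed.

Lemma pair_lk_out q v Fs (K : {set T}) : 2 < q -> v \notin K -> pair q Fs K -> spx q.-1 (lk v Fs).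
Proof.
move=> q2 vK p.
have nS S : v \in S -> ~~ (S \subset K) by move=> vS; apply: contra vK => /subsetP; apply.
apply: lk_spx => // [F|F S FF vS SF cS|S vS cS]; first exact: (pr_card p).
  by have := pr_two p FF SF cS; rewrite (negbTE (nS _ vS)) addn0.
by apply: (pr_star p) => //; apply: nS.
Qed.

Lemma spx2_card Fs : spx 2 Fs -> #|Fs| = #|cover Fs|.
Proof.
move=> s; have := sum_lk (spx_card s).
have -> : \sum_v #|[set S in Fs | v \in S]| = 2 * #|cover Fs|.
  rewrite mulnC -sum_nat_const [RHS]big_mkcond; apply: eq_bigr => v _.
  have -> : [set S in Fs | v \in S] = [set S in Fs | [set v] \subset S].
    by apply/setP => S; rewrite !inE sub1set.
  case: ifP => [/bigcupP[F FF vF]|/negbT nv].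
    by apply: (spx_two s FF); rewrite ?sub1set ?cards1.
  apply/eqP; rewrite cards_eq0; apply/eqP/setP => S; rewrite !inE.
  apply/negbTE; apply: contra nv => /andP[SF]; rewrite sub1set => vS.
  by apply/bigcupP; exists S.
lia.
Qed.

Lemma cover_bd q Fs (K : {set T}) : pair q Fs K -> cover (bd q Fs K) = K :&: cover Fs.
Proof.
move=> p; apply/setP => v; rewrite inE; apply/idP/andP.
  move=> /bigcupP[S /bdP[F [FF _ ->]]]; rewrite inE => /andP[vF ->]; split=> //.
  by apply/bigcupP; exists F.
by move=> [vK]; rewrite !mem_cover => h; apply: (pr_cov p h); rewrite sub1set.
Qed.

Lemma bd_ex q Fs (K : {set T}) F : pair q Fs K -> F \in Fs -> exists2 F', F' \in Fs & #|F' :&: K| = q.-1.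
Proof.
move=> p FF; have : isf Fs set0 by apply/isfP; exists F; rewrite ?sub0set.
by move=> /(pr_cov p)/(_ (sub0set _))/isfP[S /bdP[F' [? ? _]] _]; exists F'.
Qed.

Lemma mem_cover_facet Fs F a : F \in Fs -> a \in F -> a \in cover Fs.
Proof. by move=> FF aF; apply/bigcupP; exists F. Qed.

(** Here C is the set of all vertices off K, connected by [pr_conn]. Every edge of the polygon K
    lies on a triangle with exactly one vertex off K, and a polygon has as many edges as vertices;
    this replaces the count of three in Gromov's argument. *)
Lemma ea3 Fs (K : {set T}) G0 : pair 3 Fs K -> G0 \in Fs ->
  3 * #|cover Fs :\: K| + #|K :&: cover Fs| <= #|meet 2 Fs (cover Fs :\: K)| + 3.
Proof.
move=> p G0F; set A := cover Fs :\: K.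
have AP a : (a \in A) = (a \notin K) && (a \in cover Fs) by rewrite inE.
have [F FF cF] := bd_ex p G0F.
have /subsetPn[c cF1 cK] := pr_notK p FF.
have [u] : exists u, u \in F :&: K by apply/card_gt0P; rewrite cF.
rewrite inE => /andP[uF uK].
have ncover S : ~~ [disjoint S & A] -> ~~ (S \subset K).
  by move=> /ndisjP[x xS]; rewrite AP => /andP[xK _]; apply/subsetPn; exists x.
have h : 3 * #|A| + #|[set F in Fs | #|F :&: A| == 1]| <= #|meet 2 Fs A| + 3.
  apply: (surface_count (c0 := c) (u0 := u)).
  - exact: pr_card p.
  - move=> H S HF SH cS m; have := pr_two p HF SH cS.
    by rewrite (negbTE (ncover _ m)) addn0.
  - move=> x; rewrite AP => /andP[xK _]; apply: (pr_star p); rewrite ?sub1set ?cards1 //.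
  - move=> P a b; rewrite !AP => /andP[aK aV] /andP[bK bV] Pa cl.
    apply: (pr_conn p (S := set0) _ _ aK bK) => //; rewrite ?sub0set ?cards0 ?setU0 -?mem_cover //.
    move=> x z xK zK; rewrite setU0 => xz; apply: cl => //.
      by rewrite AP xK mem_cover; apply: isf_sub xz; apply: subsetUl.
    by rewrite AP zK mem_cover; apply: isf_sub xz; apply: subsetUr.
  - by rewrite AP cK (mem_cover_facet FF).
  - by rewrite AP uK.
  - exact: edge_inP FF _ _.
rewrite -(cover_bd p) -(spx2_card (pr_bd p)).
apply: leq_trans h; rewrite leq_add2l; apply: leq_trans (leq_imset_card _ _) _.
apply/subset_leq_card/subsetP => H; rewrite !inE => /andP[HF /eqP cH]; rewrite HF /=.
have := cardsID K H; rewrite cH (pr_card p HF) => /= e.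
have -> : H :&: A = H :\: K.
  apply/setP => x; rewrite !inE; case: (boolP (x \in H)) => //= xH; rewrite ?andbF //.
  by rewrite (mem_cover_facet HF xH) andbT.
by apply/eqP; move: e; clear; lia.
Qed.

(** With q + s vertices on K this is the surplus of s edges. Gromov's induction is repeated with all
    stars taken at vertices off K, whose links are of type [spx]. *)
Lemma ea q Fs (K : {set T}) G0 : 2 < q -> pair q Fs K -> G0 \in Fs ->
  q * #|cover Fs :\: K| + #|K :&: cover Fs| <= #|meet 2 Fs (cover Fs :\: K)| + q.
Proof.
rewrite leq_eqVlt => /orP[/eqP <-|q3]; first exact: ea3.
move=> p G0F; set A := cover Fs :\: K.
have AP a : (a \in A) = (a \notin K) && (a \in cover Fs) by rewrite inE.
pose Q (e : {set T}) := ~~ [disjoint e & A].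
(* D may contain vertices of K. Such a vertex is credited only with its edge to the chosen b, which
   counts because b is off K; this explains the coefficient 1. *)
have key (D : {set T}) Psi : D \subset cover Fs -> Psi \in Fs -> [disjoint Psi & D] ->
    q * #|D :\: K| + #|D :&: K| <= #|[set e in meet 2 Fs D | Q e]|.
  move: {2}(#|D|) (leqnn #|D|) => n; elim: n D Psi => [|n IH] D Psi.
    by rewrite leqn0 cards_eq0 => /eqP ->; rewrite set0D set0I cards0 muln0.
  move=> Dn Dc PF dP; case: (set_0Vmem D) => [->|[d dD]].
    by rewrite set0D set0I cards0 muln0.
  have [b [Psi' [bK PF' bP dP' [w wD wl]]]] : exists b Psi', [/\ b \notin K, Psi' \in Fs,
      b \in Psi', [disjoint Psi' & D] & exists2 w, w \in D & w \in cover (lk b Fs)].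
    (* If no such b exists, the property of lying on a facet that misses D spreads along edges
       between vertices off K, and reaches a vertex off K of a facet through d. That vertex would
       then qualify as b. *)
    apply: contrapT => no.
    have st b Psi' x H : b \notin K -> Psi' \in Fs -> b \in Psi' -> [disjoint Psi' & D] ->
        H \in Fs -> b \in H -> x \in H -> x \notin D.
      move=> bK PF' bP dP' HF bH xH; apply/negP => xD; case: no; exists b, Psi'; split=> //.
      exists x => //; apply: lk_coverP HF bH xH _.
      by apply: contraTneq xD => ->; apply: disjW dP' bP.
    have /bigcupP[H HF dH] := subsetP Dc d dD.
    have /subsetPn[b bP bK] := pr_notK p PF.
    have /subsetPn[a aH aK] := pr_notK p HF.
    have : exists Psi', [/\ Psi' \in Fs, a \in Psi' & [disjoint Psi' & D]].
      apply: (pr_conn p (S := set0) (sub0set _) _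
        (P := fun a => exists Psi', [/\ Psi' \in Fs, a \in Psi' & [disjoint Psi' & D]]) bK aK).
      - by rewrite cards0; move: q3; clear; lia.
      - by rewrite setU0 -mem_cover (mem_cover_facet PF).
      - by rewrite setU0 -mem_cover (mem_cover_facet HF).
      - by exists Psi.
      move=> x z xK zK; rewrite setU0 => /isfP[G GF]; rewrite subUset !sub1set => /andP[xG zG].
      move=> [Psi1 [P1 x1 d1]]; exists G; split=> //; apply: contraT => /ndisjP[y yG yD].
      by have := st x Psi1 y G xK P1 x1 d1 GF xG yG; rewrite yD.
    by move=> [Psi1 [P1 a1 d1]]; have := st a Psi1 d H aK P1 a1 d1 HF aH dH; rewrite dD.
  have bD : b \notin D by apply: disjW dP' bP.
  have bA : b \in A by rewrite AP bK (mem_cover_facet PF').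
  pose L := cover (lk b Fs); pose X := (D :&: L) :\: K.
  have sub : D :\: L \proper D.
    by apply/properP; split; [apply: subsetDl | exists w => //; rewrite inE wl].
  have step : #|meet 2 (lk b Fs) X| + #|D :&: L| + #|[set e in meet 2 Fs (D :\: L) | Q e]|
      <= #|[set e in meet 2 Fs D | Q e]|.
    apply: star_step => // [|e /meetP[_ _ [x]]|x _]; first exact: subsetDl.
      rewrite !inE => /and3P[xK xD _] xe; apply/ndisjP; exists x => //.
      by rewrite AP xK (subsetP Dc).
    by apply/ndisjP; exists b; rewrite ?set21.
  have link : q.-1 * #|X| <= #|meet 2 (lk b Fs) X|.
    apply: (@gromov _ _ _ (Psi' :\ b)); first by move: q3; clear; lia.
    - by apply: pair_lk_out bK p; move: q3; clear; lia.
    - exact: lk_facet.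
    - apply: disjointWl (subsetDl _ _) _; apply: disjointWr dP'.
      by apply: subset_trans (subsetDl _ _) (subsetIl _ _).
    by apply: subset_trans (subsetDl _ _) (subsetIr _ _).
  have rest := IH (D :\: L) Psi' _ (subset_trans (subsetDl _ _) Dc) PF'
     (disjointWr (subsetDl _ _) dP').
  have {}rest := rest (leq_trans (proper_card sub) Dn).
  have c1 := cardsID L (D :\: K); have c2 := cardsID L (D :&: K).
  have c3 := cardsID K (D :&: L).
  have e1 : (D :\: K) :&: L = X by rewrite /X setIDAC.
  have e2 : (D :\: K) :\: L = (D :\: L) :\: K by rewrite !setDDl setUC.
  have e3 : (D :&: K) :&: L = (D :&: L) :&: K by rewrite setIAC.
  have e4 : (D :&: K) :\: L = (D :\: L) :&: K by rewrite setIDAC.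
  rewrite e1 e2 in c1; rewrite e3 e4 in c2; rewrite -/X in c3.
  have eq1 : q * #|X| = q.-1 * #|X| + #|X| by rewrite -{1}(prednK (n := q)) ?mulSn 1?addnC //; move: q3; clear; lia.
  by rewrite -c1 -c2 mulnDr; move: step link rest c3 eq1; clear; lia.
(* [key] is applied to the complement of a facet F sharing a ridge with K. F has one vertex a off K
   and q - 1 on K, which costs q + (q - 1); the q - 1 edges from a to K inside F are recovered, so
   the loss is q. *)
have [F FF cF] := bd_ex p G0F.
have cFA : #|F :\: K| = 1 by have := cardsID K F; rewrite cF (pr_card p FF); move: q3; clear; lia.
have /cards1P[a aE] : #|F :\: K| == 1 by rewrite cFA.
have aFK : a \in F :\: K by rewrite aE set11.
move: (aFK); rewrite inE => /andP[aK aF].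
have aA : a \in A by rewrite AP aK (mem_cover_facet FF).
have h := key (cover Fs :\: F) F (subsetDl _ _) FF.
have {h} h : q * #|(cover Fs :\: F) :\: K| + #|(cover Fs :\: F) :&: K| <=
    #|[set e in meet 2 Fs (cover Fs :\: F) | Q e]|.
  by apply: h; rewrite -setI_eq0; apply/eqP/setP => x; rewrite !inE; case: (x \in F).
pose E1 := [set e in meet 2 Fs (cover Fs :\: F) | Q e].
pose E2 := [set [set a; x] | x in F :&: K].
have cE2 : #|E2| = q.-1.
  rewrite -cF card_in_imset // => x z; rewrite !inE => /andP[_ xK] /andP[_ zK] e.
  apply: set1_inj; apply: (setU1_inj _ _ e); rewrite inE.
    by apply: contraNneq aK => ->.
  by apply: contraNneq aK => ->.
have dis : E1 :&: E2 = set0.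
  apply/setP => e; rewrite inE [RHS]inE; apply/negbTE/negP => /andP[].
  rewrite inE => /andP[/meetP[_ _ [x]]]; rewrite inE => /andP[xF _] xe _.
  move=> /imsetP[z]; rewrite inE => /andP[zF _] ez; move: xe; rewrite ez !inE.
  by case/orP => /eqP e'; move: xF; rewrite e' ?aF ?zF.
have sub : E1 :|: E2 \subset meet 2 Fs A.
  rewrite subUset; apply/andP; split; apply/subsetP => e.
    by move=> /setIdP[/meetP[ce fe _] Qe]; rewrite !inE ce eqxx fe.
  move=> /imsetP[x]; rewrite inE => /andP[xF xK] ->; apply/meetP; split.
  - by rewrite cards2 (_ : a != x) //; apply: contraNneq aK => ->.
  - exact: edge_inP FF _ _.
  by exists a; rewrite ?set21.
have := subset_leq_card sub; rewrite cardsU dis cards0 subn0 cE2 -/E1 => le.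
have FV : F \subset cover Fs by apply/subsetP => x; apply: mem_cover_facet.
have d1 : #|A| = #|(cover Fs :\: F) :\: K| + 1.
  rewrite -(cardsID F A) addnC; congr (_ + _).
    by apply: eq_card => x; rewrite !inE; do !case: (x \in _).
  rewrite -cFA; apply: eq_card => x; rewrite !inE.
  by case: (boolP (x \in F)) => [/(subsetP FV) ->|]; rewrite ?andbF ?andbT.
have d2 : #|K :&: cover Fs| = #|(cover Fs :\: F) :&: K| + q.-1.
  rewrite -(cardsID F (K :&: cover Fs)) addnC; congr (_ + _).
    by apply: eq_card => x; rewrite !inE; do !case: (x \in _).
  rewrite -cF; apply: eq_card => x; rewrite !inE.
  by case: (boolP (x \in F)) => [/(subsetP FV) ->|]; rewrite ?andbF ?andbT.
by rewrite d1 d2 mulnDr muln1; rewrite -/E1 in h; move: h le q3; clear; lia.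
Qed.

(** * Lower bounds for the face numbers *)

Lemma sum_deg Fs : \sum_(v in cover Fs) #|cover (lk v Fs)| = 2 * #|fk 2 Fs|.
Proof. by rewrite -sum_fk_lk; apply: eq_bigr => v _; rewrite card_fk1. Qed.

Lemma sum_lk_facets q Fs : (forall F, F \in Fs -> #|F| = q.+1) ->
  \sum_(v in cover Fs) #|lk v Fs| = q.+1 * #|Fs|.
Proof.
move=> u; rewrite -[in RHS](fk_full u) -sum_fk_lk; apply: eq_bigr => v _; congr #|pred_of_set _|.
apply/esym/fk_full => F; rewrite in_lk => /andP[vF /u]; rewrite cardsU1 vF; clear; lia.
Qed.

Lemma lk_ex v Fs : v \in cover Fs -> exists F, F \in lk v Fs.
Proof. by move=> /bigcupP[F FF vF]; exists (F :\ v); apply: lk_facet. Qed.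

(** Gromov's inequality for the complement of one facet F, plus the C(q, 2) edges of F. The bound is
    doubled to keep C(q + 1, 2) free of division. *)
Lemma lb_spx_edges q Fs F : 2 < q -> spx q Fs -> F \in Fs ->
  2 * (q * #|cover Fs|) <= 2 * #|fk 2 Fs| + q.+1 * q.
Proof.
move=> q2 s FF; have g := @gromov q Fs (cover Fs :\: F) F q2 s FF.
have {}g : q * #|cover Fs :\: F| <= #|meet 2 Fs (cover Fs :\: F)|.
  apply: g; last exact: subsetDl.
  by rewrite -setI_eq0; apply/eqP/setP => x; rewrite !inE; case: (x \in F).
have FV : F \subset cover Fs by apply/subsetP => x; apply: mem_cover_facet.
have cV := cardsID F (cover Fs); rewrite (setIidPr FV) (spx_card s FF) in cV.
pose B := [set S : {set T} | (S \subset F) && (#|S| == 2)].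
have cB : #|B| = 'C(q, 2) by rewrite cards_draws (spx_card s FF).
have : #|meet 2 Fs (cover Fs :\: F) :|: B| <= #|fk 2 Fs|.
  apply/subset_leq_card/subsetP => S; rewrite in_setU => /orP[/setIdP[] //|].
  by rewrite !inE => /andP[SF ->]; apply/isfP; exists F.
rewrite cardsU (_ : _ :&: B = set0) ?cards0 ?cB; last first.
  apply/setP => S; rewrite inE [RHS]inE; apply/negbTE/negP => /andP[/meetP[_ _ [a]]].
  by rewrite !inE => /andP[aF _] aS /andP[/subsetP/(_ a aS)]; rewrite (negbTE aF).
have := mul_bin_diag q 1; rewrite bin1.
by move: q2 g cV; clear; nia.
Qed.

(** The step from links to faces. The second hypothesis is the bound for links summed over the n
    vertices: degrees sum to 2 f1, and a face with k + 2 vertices is counted k + 2 times. The edge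
    bound is then inserted. *)
Lemma ar_face q k n f f1 : 2 * (q * n) <= 2 * f1 + q.+1 * q ->
  'C(q.-1, k) * (2 * f1) <= k.+2 * f + n * (k * 'C(q, k.+1)) ->
  'C(q, k.+1) * n <= f + k.+1 * 'C(q.+1, k.+2).
Proof.
have := mul_bin_diag q k; have := mul_bin_diag q.+1 k.+1; rewrite /=.
move: 'C(q.-1, k) 'C(q, k.+1) 'C(q.+1, k.+2) => x y z e1 e2 h1 h2.
have h3 := leq_mul (leqnn x) h1.
have e3 : x * (2 * (q * n)) = 2 * k.+1 * y * n by nia.
have e4 : x * (q.+1 * q) = k.+1 * (k.+2 * z) by nia.
rewrite mulnDr e3 e4 in h3.
suff : k.+2 * (y * n) <= k.+2 * (f + k.+1 * z) by rewrite leq_pmul2l.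
by nia.
Qed.

Lemma ar_facet p n N f1 : 2 * (p.+3 * n) <= 2 * f1 + p.+4 * p.+3 ->
  p.+1 * (2 * f1) <= p.+3 * N + n * (p.+3 * p) -> p.+2 * n <= N + p.+4 * p.+1.
Proof.
move=> h1 h2; have h3 := leq_mul (leqnn p.+1) h1.
suff : p.+3 * (p.+2 * n) <= p.+3 * (N + p.+4 * p.+1) by rewrite leq_pmul2l.
by nia.
Qed.

Lemma lb_spx_faces q Fs F : 2 < q -> spx q Fs -> F \in Fs -> forall k, k.+2 < q ->
  'C(q, k.+1) * #|cover Fs| <= #|fk k.+2 Fs| + k.+1 * 'C(q.+1, k.+2).
Proof.
elim: q Fs F => [//|q IH] Fs F q2 s FF [|k] kq.
  have := lb_spx_edges q2 s FF; rewrite bin1 mul1n.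
  by have := mul_bin_diag q.+2 1; rewrite bin1 /=; clear; nia.
apply: (ar_face (lb_spx_edges q2 s FF)).
rewrite -sum_deg -sum_fk_lk -sum_nat_const -big_split big_distrr /=.
have q3 : 2 < q by move: kq; clear; lia.
apply: leq_sum => v /lk_ex[G GF].
by apply: (IH _ G q3 (spx_lk v q2 s) GF); move: kq; clear; lia.
Qed.

Lemma lb_spx_facets q Fs F : spx q.+2 Fs -> F \in Fs ->
  q.+1 * #|cover Fs| <= #|Fs| + q.+3 * q.
Proof.
elim: q Fs F => [|q IH] Fs F s FF.
  by rewrite muln0 addn0 mul1n spx2_card.
apply: (ar_facet (lb_spx_edges _ s FF)) => //.
rewrite -sum_deg -(sum_lk_facets (spx_card s)) -sum_nat_const -big_split big_distrr /=.
apply: leq_sum => v /lk_ex[G GF].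
by apply: (IH _ G (spx_lk v _ s) GF).
Qed.

Lemma card_edges_pair q Fs (K : {set T}) : pair q Fs K ->
  #|fk 2 Fs| = #|meet 2 Fs (cover Fs :\: K)| + #|fk 2 (bd q Fs K)|.
Proof.
move=> p; rewrite -(cardsID [set S : {set T} | S \subset K] (fk 2 Fs)) addnC; congr (_ + _).
  apply: eq_card => S; rewrite !inE; case: (boolP (isf Fs S)) => h; rewrite ?(andbF, andFb) //.
  rewrite andbT; case: (#|S| == 2); rewrite ?andbF //= andbT; congr (~~ _).
  apply/idP/idP => [/subsetP SK|d].
    apply: contraT => /ndisjP[x xS]; rewrite inE => /andP[xK _].
    by rewrite (SK x xS) in xK.
  apply/subsetP => x xS; have := disjW d xS; rewrite inE negb_and negbK => /orP[//|].
  by case/negP; rewrite mem_cover; apply: isf_sub h; rewrite sub1set.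
apply: eq_card => S; rewrite !inE; case: (#|S| == 2) => //=; apply/andP/idP => [[h SK]|].
  exact: (pr_cov p h SK).
move=> /isfP[B /bdP[F [FF _ ->]]]; rewrite subsetI => /andP[SF SK]; split=> //.
by apply/isfP; exists F.
Qed.

Lemma sum_deg_bd q Fs (K : {set T}) : 1 < q -> pair q Fs K ->
  \sum_(v in cover Fs | v \in K) #|K :&: cover (lk v Fs)| = 2 * #|fk 2 (bd q Fs K)|.
Proof.
move=> q1 p; rewrite -sum_deg (cover_bd p).
apply: eq_big => [v|v /andP[_ vK]]; first by rewrite inE andbC.
suff -> : cover (lk v (bd q Fs K)) = K :&: cover (lk v Fs) by [].
apply/setP => x; rewrite inE !mem_cover !isf_lk !inE; case: (v != x) => /=; last by rewrite andbF.
apply/isfP/andP => [[B /bdP[F [FF _ ->]]]|[xK h]].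
  rewrite subUset !sub1set !inE => /andP[/andP[vF _] /andP[xF ->]]; split=> //.
  exact: edge_inP FF _ _.
have /isfP[B BB sB] : isf (bd q Fs K) (v |: [set x]).
  by apply: (pr_cov p h); rewrite subUset !sub1set vK.
by exists B.
Qed.

(* Each edge lies in two facets of the polytope, and one of them is K precisely
   for the edges in K. *)
Lemma facets3 Fs (K : {set T}) : pair 3 Fs K ->
  3 * #|Fs| = 2 * #|meet 2 Fs (cover Fs :\: K)| + #|K :&: cover Fs|.
Proof.
move=> p.
have <- : #|fk 2 (bd 3 Fs K)| = #|K :&: cover Fs|.
  by rewrite (fk_full (spx_card (pr_bd p))) (spx2_card (pr_bd p)) cover_bd.
have two S : S \in fk 2 Fs -> #|[set F in Fs | S \subset F]| + (S \subset K) = 2.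
  by rewrite inE => /andP[/eqP cS /isfP[F FF SF]]; apply: (pr_two p FF).
have e1 : \sum_(S in fk 2 Fs) #|[set F in Fs | S \subset F]| = 3 * #|Fs|.
  rewrite (sum_card_swap (fk 2 Fs) Fs (fun S F => S \subset F)) mulnC -sum_nat_const.
  apply: eq_bigr => F FF; rewrite -[RHS]/(binomial 3 2) -(pr_card p FF) -cards_draws.
  apply: eq_card => S; rewrite !inE; case: (boolP (S \subset F)) => SF; rewrite ?andbF // andbT.
  by case: (#|S| == 2) => //=; apply/isfP; exists F.
have e2 : \sum_(S in fk 2 Fs) (S \subset K : nat) = #|fk 2 (bd 3 Fs K)|.
  rewrite -sum1_card big_mkcond [RHS]big_mkcond; apply: eq_bigr => S _.
  rewrite [in RHS]inE [in LHS]inE; case: (#|S| == 2) => //=.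
  case: (boolP (isf Fs S)) => h.
    case: (boolP (S \subset K)) => SK; first by rewrite (pr_cov p h SK).
    case: ifP => // /isfP[B /bdP[F [_ _ ->]]]; rewrite subsetI => /andP[_ SK'].
    by rewrite SK' in SK.
  case: ifP => // /isfP[B /bdP[F [FF _ ->]]]; rewrite subsetI => /andP[SF _].
  by case/negP: h; apply/isfP; exists F.
have : \sum_(S in fk 2 Fs) 2 = 3 * #|Fs| + #|fk 2 (bd 3 Fs K)|.
  by rewrite -e1 -e2 -big_split /=; apply: eq_bigr => S /two ->.
rewrite sum_nat_const (card_edges_pair p); clear; lia.
Qed.

(** Here a counts the vertices off K, kp those on K, E the edges meeting the former and x the edges
    of K. The weights eliminate E and x from the summed link bound: E has coefficient 2(p + 3)(p +
    2) there, and 2x is left with half of 2(p + 3)(p + 2) - 4, which is p^2 + 5p + 4. *)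
Lemma ar_ridge p a kp E x f : p.+4 * a + kp <= E + p.+4 ->
  2 * (p.+3 * kp) <= 2 * x + p.+4 * p.+3 ->
  p.+3 * p.+2 * (2 * (E + x)) + 2 * p.+3 * kp
     <= 2 * (p.+3 * f) + 2 * (2 * x) + (a + kp) * (p.+1 * p.+4 * p.+3) ->
  p.+4 * p.+3 * (a + kp) + 2 * p.+4 <= 2 * f + 2 * kp + p.+2 * p.+4.+1 * p.+4.
Proof.
move=> h1 h2 h3.
have h4 := leq_mul (leqnn (2 * (p.+3 * p.+2))) h1.
have h5 := leq_mul (leqnn (p * p + 5 * p + 4)) h2.
suff : p.+3 * (p.+4 * p.+3 * (a + kp) + 2 * p.+4) <=
  p.+3 * (2 * f + 2 * kp + p.+2 * p.+4.+1 * p.+4) by rewrite leq_pmul2l.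
by move: h3 h4 h5; clear; lia.
Qed.

(** As in [ar_ridge]: the weight of E is 2(p + 2), and half of 2(p + 2) - 2 is left for 2x. *)
Lemma ar_facet_pair p a kp E x N : p.+4 * a + kp <= E + p.+4 ->
  2 * (p.+3 * kp) <= 2 * x + p.+4 * p.+3 ->
  p.+2 * (2 * (E + x)) + p.+3 * kp <= p.+4 * N + kp + 2 * x + (a + kp) * (p.+4 * p.+1) ->
  p.+3 * (a + kp) + p.+4 <= N + 1 + kp + p.+4.+1 * p.+2.
Proof.
move=> h1 h2 h3.
have h4 := leq_mul (leqnn (2 * p.+2)) h1.
have h5 := leq_mul (leqnn p.+1) h2.
suff : p.+4 * (p.+3 * (a + kp) + p.+4) <= p.+4 * (N + 1 + kp + p.+4.+1 * p.+2) by rewrite leq_pmul2l.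
by move: h3 h4 h5; clear; lia.
Qed.

Lemma card_cover_K Fs (K : {set T}) :
  #|cover Fs| = #|cover Fs :\: K| + #|K :&: cover Fs|.
Proof. by rewrite -(cardsID K (cover Fs)) addnC setIC. Qed.

Lemma sum_cover_K Fs (K : {set T}) c :
  \sum_(v in cover Fs | v \in K) c = #|K :&: cover Fs| * c.
Proof. by rewrite -sum_nat_const; apply: eq_bigl => v; rewrite inE andbC. Qed.

Lemma lb_pair_edges_K p Fs (K : {set T}) G : pair p.+4 Fs K -> G \in Fs ->
  2 * (p.+3 * #|K :&: cover Fs|) <= 2 * #|fk 2 (bd p.+4 Fs K)| + p.+4 * p.+3.
Proof.
move=> pr GF; have [F FF cF] := bd_ex pr GF.
have h : F :&: K \in bd p.+4 Fs K by apply/bdP; exists F.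
by have := lb_spx_edges _ (pr_bd pr) h; rewrite (cover_bd pr); apply.
Qed.

(** The bound inside K has the coefficient q - 1 per vertex of K; the single edge per vertex of K in
    [ea] raises it to q. The sum is the edge bound of a simplicial polytope. *)
Lemma lb_pair_edges p Fs (K : {set T}) G : pair p.+4 Fs K -> G \in Fs ->
  2 * (p.+4 * #|cover Fs|) <= 2 * #|fk 2 Fs| + p.+4.+1 * p.+4.
Proof.
move=> pr GF; have := lb_pair_edges_K pr GF; have := @ea p.+4 _ _ _ isT pr GF.
by rewrite (card_edges_pair pr) (card_cover_K Fs K); clear; lia.
Qed.

Lemma lb_pair_faces q Fs (K : {set T}) G : pair q Fs K -> G \in Fs -> forall k, k.+3 < q ->
  'C(q, k.+1) * #|cover Fs| <= #|fk k.+2 Fs| + k.+1 * 'C(q.+1, k.+2).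
Proof.
elim: q Fs G => [//|q IH] Fs G pr GF [|k] kq.
  case: q IH pr kq => [|[|[|q]]] // _ pr _.
  have := lb_pair_edges pr GF; rewrite bin1 mul1n.
  by have := mul_bin_diag q.+4.+1 1; rewrite bin1 /=; clear; nia.
have q3 : 3 < q by move: kq; clear; lia.
have he : 2 * (q.+1 * #|cover Fs|) <= 2 * #|fk 2 Fs| + q.+2 * q.+1.
  by move: pr; clear -q3 GF; case: q q3 => [|[|[|q]]] // _ pr; apply: lb_pair_edges pr GF.
apply: (ar_face he).
rewrite -sum_deg -sum_fk_lk -sum_nat_const -big_split big_distrr /=.
apply: leq_sum => v /lk_ex[H HF].
have [vK|vK] := boolP (v \in K).
  by apply: (IH _ H (pair_lk (q := q.+1) (ltnW q3) vK pr) HF); move: kq; clear; lia.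
by apply: (lb_spx_faces (ltnW q3) (pair_lk_out (q := q.+1) (ltnW (ltnW q3)) vK pr) HF); move: kq; clear; lia.
Qed.

(** With q = p + 3, the terms 2q on the left and 2(q + s) on the right leave the correction s. It is
    kept in terms of K because in the link of v on K it becomes the degree of v in K, and these
    degrees sum to twice the number of edges of K. Links off K contribute no correction. *)
Lemma lb_pair_ridges p Fs (K : {set T}) G : pair p.+3 Fs K -> G \in Fs ->
  p.+3 * p.+2 * #|cover Fs| + 2 * p.+3 <=
    2 * #|fk p.+2 Fs| + 2 * #|K :&: cover Fs| + p.+1 * p.+4 * p.+3.
Proof.
elim: p Fs G => [|p IH] Fs G pr GF.
  rewrite (card_edges_pair pr) (fk_full (spx_card (pr_bd pr))) (spx2_card (pr_bd pr)).
  rewrite (cover_bd pr) (card_cover_K Fs K).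
  by have := ea3 pr GF; clear; lia.
have h1 := @ea p.+4 _ _ _ isT pr GF; have h2 := lb_pair_edges_K pr GF.
rewrite (card_cover_K Fs K); apply: (ar_ridge h1 h2).
rewrite -(card_edges_pair pr) -(card_cover_K Fs K) -sum_deg -(sum_deg_bd _ pr) //.
rewrite -sum_fk_lk -[2 * p.+3 * _]mulnC -sum_cover_K -[_ * (p.+1 * _ * _)]sum_nat_const.
rewrite !big_distrr /= ![\sum_(_ in _ | _ \in K) _]big_mkcondr -!big_split /=.
apply: leq_sum => v /lk_ex[H HF].
have [vK|vK] := boolP (v \in K).
  exact: (IH _ H (pair_lk (q := p.+4) isT vK pr) HF).
have sp := pair_lk_out (q := p.+4) isT vK pr.
have := lb_spx_faces (q := p.+3) isT sp HF (k := p) (ltnSn _).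
have e1 := mul_bin_diag p.+3 1; have e2 := mul_bin_diag p.+4 1.
rewrite !bin1 /= in e1 e2.
rewrite -/(p.+4) (_ : 'C(p.+3, p.+1) = 'C(p.+3, 2)); last by rewrite -(@bin_sub p.+3 2).
rewrite (_ : 'C(p.+4, p.+2) = 'C(p.+4, 2)); last by rewrite -(@bin_sub p.+4 2).
rewrite -[p.+1 * p.+4 * _]mulnA e1 e2 !addn0 -mulnA [p.+1 * (2 * _)]mulnCA -mulnDr leq_pmul2l //.
Qed.

(** The 1 on the right stands for K itself, which is not in [Fs]. *)
Lemma lb_pair_facets p Fs (K : {set T}) G : pair p.+3 Fs K -> G \in Fs ->
  p.+2 * #|cover Fs| + p.+3 <= #|Fs| + 1 + #|K :&: cover Fs| + p.+4 * p.+1.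
Proof.
elim: p Fs G => [|p IH] Fs G pr GF.
  by have := ea3 pr GF; have := facets3 pr; rewrite (card_cover_K Fs K); clear; lia.
have h1 := @ea p.+4 _ _ _ isT pr GF; have h2 := lb_pair_edges_K pr GF.
rewrite (card_cover_K Fs K); apply: (ar_facet_pair h1 h2).
rewrite -(card_edges_pair pr) -(card_cover_K Fs K) -sum_deg -(sum_deg_bd _ pr) //.
rewrite -(sum_lk_facets (pr_card pr)) -[p.+3 * _]mulnC -sum_cover_K -[#|K :&: _|]muln1.
rewrite -sum_cover_K -[_ * (p.+4 * _)]sum_nat_const.
rewrite !big_distrr /= ![\sum_(_ in _ | _ \in K) _]big_mkcondr -!big_split /=.
apply: leq_sum => v /lk_ex[H HF].
have [vK|vK] := boolP (v \in K).
  exact: (IH _ H (pair_lk (q := p.+4) isT vK pr) HF).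
have sp := pair_lk_out (q := p.+4) isT vK pr.
by have := lb_spx_facets sp HF; rewrite !addn0.
Qed.

End Complex.

(** * From configurations to complexes *)

Section ConfigPair.

Local Open Scope ring_scope.

Variables (R : realFieldType) (N : nat) (I : finType) (y : I -> 'rV[R]_N).
Implicit Types S F G : {set I}.

Lemma rk0 : rk y set0 = 0%N.
Proof. by rewrite /rk /spn big_set0 mxrank0. Qed.

Lemma rkU S F : (rk y (S :|: F) <= rk y S + rk y F)%N.
Proof.
apply: leq_trans (mxrank_adds_leqif _ _); apply: mxrankS.
apply/spn_subP => i; rewrite inE => /orP[h|h]; apply: submx_trans (spn_mem y h) _.
  exact: addsmxSl.
exact: addsmxSr.
Qed.

Lemma rk_card S : (rk y S <= #|S|)%N.
Proof.
rewrite /rk /spn; apply: (leq_trans (mxrank_sum_leqif _)).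
rewrite -sum1_card; apply: leq_sum => i _; rewrite /= mxrank_gen; exact: rank_leq_row.
Qed.

Lemma free_rk F S : rk y F = #|F| -> S \subset F -> rk y S = #|S|.
Proof.
move=> h SF; apply/eqP; rewrite eqn_leq rk_card /=.
have e : F = S :|: (F :\: S) by apply/esym/eqP; rewrite -[X in _ == X](setID F S) (setIidPr SF).
have := rkU S (F :\: S); rewrite -e h -(cardsID S F) (setIidPr SF).
by have := rk_card (F :\: S); lia.
Qed.

(** S is exposed by the sum of the dual functionals of the points off S; the minus sign undoes the
    value -1 of [sep]. *)
Lemma free_face F S : rk y F = #|F| -> S \subset F -> faceof y F S.
Proof.
move=> h SF.
have sp i : exists c, i \in F -> (forall j, j \in F -> j != i -> ev (y j) c = 0) /\ ev (y i) c = -1.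
  case: (boolP (i \in F)) => iF; last by exists 0.
  have [|c c0 ci] := @sep _ _ _ (spn y (F :\ i)) (y i).
    apply/negP => le; have : (spn y F <= spn y (F :\ i))%MS.
      apply/spn_subP => j jF; case: (eqVneq j i) => [-> //|n].
      by apply: spn_mem; rewrite !inE n.
    move=> /mxrankS; rewrite -/(rk y F) h; have := rk_card (F :\ i); rewrite /rk.
    by rewrite (cardsD1 i F) iF; lia.
  exists c => _; split=> // j jF n; apply: c0; apply: spn_mem; by rewrite !inE n.
have /choice[c cP] := sp.
pose C := - \sum_(i in F :\: S) c i.
have evC j : j \in F -> ev (y j) C = (j \notin S)%:R.
  move=> jF; rewrite evNr.
  have -> : ev (y j) (\sum_(i in F :\: S) c i) = \sum_(i in F :\: S) ev (y j) (c i).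
    by rewrite /ev mulmx_sumr summxE.
  case: (boolP (j \in S)) => jS /=.
    rewrite big1 ?oppr0 // => i; rewrite inE => /andP[iS iF].
    by apply: (cP i iF).1 => //; apply: contraNneq iS => <-.
  rewrite (bigD1 j) ?inE ?jS //= (cP j jF).2 big1 ?addr0 ?opprK // => i.
  by rewrite inE => /andP[/andP[iS iF] n]; apply: (cP i iF).1 => //; rewrite eq_sym.
exists C; split=> [i iF|]; first by rewrite evC // ler0n.
apply/setP => i; rewrite inE; case: (boolP (i \in F)) => [iF|].
  by rewrite evC // pnatr_eq0 eqb0 negbK.
by move=> /(contraNN (subsetP SF i)) /negbTE.
Qed.

Lemma faceof_trans F S T : faceof y T F -> faceof y F S -> faceof y T S.
Proof. by move=> [c e] [c' e']; have [c'' e'' _] := expo_trans e e'; exists c''. Qed.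

Lemma faceof_restr F S T : faceof y T S -> S \subset F -> F \subset T -> faceof y F S.
Proof. by move=> [c e] SF FT; exists c; apply: expo_restr e SF FT. Qed.

Lemma faceof_sub F T : faceof y T F -> F \subset T.
Proof. by move=> [c /expo_sub]. Qed.

Lemma faceof_eq F G T : faceof y T F -> faceof y T G -> F \subset G -> rk y F = rk y G -> F = G.
Proof.
move=> fF fG FG; have [c e] := faceof_restr fF FG (faceof_sub fG).
exact: expo_rk_eq e.
Qed.

Lemma coatom_ex T S : faceof y T S -> S != T ->
  exists F, [/\ faceof y T F, S \subset F & (rk y F).+1 = rk y T].
Proof.
move=> [c e] n; have [i iT iS] : exists2 i, i \in T & i \notin S.
  by apply/subsetPn; apply: contra n => TS; rewrite eqEsubset (expo_sub e).
have [||c' [F [e' SF r _]]] := @coatom_neg _ _ _ _ _ _ _ (- y i) e.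
- by rewrite eqmx_opp spn_mem.
- by rewrite evNl oppr_lt0 (expo_gt0 e).
by exists F; split=> //; exists c'.
Qed.

Variable T : {set I}.

Lemma other_facet F S : faceof y T S -> faceof y T F -> S \subset F ->
  (rk y S).+1 = rk y F -> (rk y F).+1 = rk y T ->
  exists F', [/\ faceof y T F', (rk y F').+1 = rk y T, F' != F & F' :&: F = S].
Proof.
move=> [c e] [c1 e1] SF r1 r2.
have FT : F != T by apply: contraTneq isT => h; move: r2; rewrite h => /esym/n_Sn.
have [c2 [F' [e2 SF' r' I']]] := diamond_ex e e1 SF FT.
exists F'; split=> //; [by exists c2 | by rewrite r' r1 |].
by apply: contraTneq isT => h; move: I' r1; rewrite h setIid => ->; move/esym/n_Sn.
Qed.

Lemma facetI F G S : faceof y T S -> faceof y T F -> faceof y T G -> S \subset F -> S \subset G ->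
  (rk y S).+1 = rk y F -> (rk y S).+1 = rk y G -> F != G -> F :&: G = S.
Proof. by move=> [c e] [c1 e1] [c2 e2] *; apply: (atomI e e1 e2). Qed.

Lemma facet_three S F G H : faceof y T S -> (rk y S).+2 = rk y T ->
  (forall X, X \in [:: F; G; H] -> [/\ faceof y T X, S \subset X & (rk y X).+1 = rk y T]) ->
  F != G -> H != F -> H != G -> False.
Proof.
move=> [c e] r h n1 n2 n3.
have [[c1 e1] S1 r1] := h F (mem_head _ _).
have [[c2 e2] S2 r2] : [/\ faceof y T G, S \subset G & (rk y G).+1 = rk y T].
  by apply: h; rewrite !inE eqxx orbT.
have [[c3 e3] S3 r3] : [/\ faceof y T H, S \subset H & (rk y H).+1 = rk y T].
  by apply: h; rewrite !inE eqxx !orbT.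
have rr X : (rk y X).+1 = rk y T -> rk y X = (rk y S).+1 by rewrite -r => -[].
exact: (diamond_uniq e e1 e2 e3 S1 S2 S3 (rr _ r1) (rr _ r2) (rr _ r3) (esym r) n1 n2 n3).
Qed.

(** If the facet found above S is G itself, a ridge of G above S is crossed to its other facet. For
    G = K this puts every proper face other than K on a simplex; for stackings it keeps old vertices
    away from the facet that disappears. *)
Lemma facet_avoid S G : faceof y T S -> S != T -> faceof y T G -> (rk y G).+1 = rk y T ->
  S != G -> exists F, [/\ faceof y T F, (rk y F).+1 = rk y T, F != G & S \subset F].
Proof.
move=> fS nT fG rG nG; have [F [fF SF rF]] := coatom_ex fS nT.
case: (eqVneq F G) => [FG|nFG]; last by exists F.
subst F; have [U [fU SU rU]] := coatom_ex (faceof_restr fS SF (faceof_sub fG)) nG.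
have [F' [fF' rF' nF' I']] := other_facet (faceof_trans fG fU) fG (faceof_sub fU) rU rG.
by exists F'; split=> //; apply: subset_trans SU _; rewrite -I' subsetIl.
Qed.

Variables (K : {set I}) (q : nat).
Hypothesis fK : faceof y T K.
Hypothesis rK : rk y K = q.
Hypothesis rT : rk y T = q.+1.
Hypothesis q2 : (1 < q)%N.
Hypothesis simp : forall F, faceof y T F -> rk y F = q -> F != K -> #|F| = q.

Lemma rKT : (rk y K).+1 = rk y T. Proof. by rewrite rK rT. Qed.

Definition facets := [set F | `[< [/\ faceof y T F, rk y F = q & F != K] >]].

Lemma facetsP F : reflect [/\ faceof y T F, rk y F = q & F != K] (F \in facets).
Proof. by rewrite inE; apply: asboolP. Qed.

Lemma facets_sub F S : F \in facets -> S \subset F -> faceof y T S /\ rk y S = #|S|.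
Proof.
move=> /facetsP[fF rF nF] SF.
have fr : rk y F = #|F| by rewrite rF simp.
by split; [apply: faceof_trans fF (free_face fr SF) | apply: free_rk fr SF].
Qed.

Lemma face_cover S : faceof y T S -> S != T -> S != K -> isf facets S.
Proof.
move=> fS nT nK; have [F [fF rF nF SF]] := facet_avoid fS nT fK rKT nK.
by apply/isfP; exists F => //; apply/facetsP; split=> //; apply/eq_add_S; rewrite rF.
Qed.

Lemma face_rk S : faceof y T S -> S != T -> S != K -> rk y S = #|S|.
Proof. by move=> fS nT nK; have /isfP[F FF SF] := face_cover fS nT nK; case: (facets_sub FF SF). Qed.

Lemma rk_neT S : (rk y S <= q)%N -> S != T.
Proof. by move=> h; apply: contraTneq h => ->; rewrite rT ltnn. Qed.

Lemma facet_notK F : F \in facets -> ~~ (F \subset K).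
Proof.
move=> /facetsP[fF rF]; apply: contra => FK; apply/eqP.
by apply: (faceof_eq fF fK FK); rewrite rF rK.
Qed.

Lemma mem_bd S : S \in bd q facets K <-> [/\ faceof y T S, S \subset K & (rk y S).+1 = q].
Proof.
split=> [/bdP[F [FF c ->]]|[fS SK rS]].
  have [h1 h2] := facets_sub FF (subsetIl F K); split=> //; first exact: subsetIr.
  by rewrite h2 c; move: q2; clear; lia.
have [F [fF rF nF IF]] := other_facet fS fK SK (etrans rS (esym rK)) rKT.
have FF : F \in facets by apply/facetsP; split=> //; apply/eq_add_S; rewrite rF.
apply/bdP; exists F; split=> //; have [_] := facets_sub FF (subsetIl F K).
by rewrite IF => <-; rewrite -rS.
Qed.

(** Ridges are handled by the diamond property, stars by [coatom_connected] (in T, and in K for the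
    boundary of K), and the vertices off K by [atom_connected]. *)
Lemma config_pair : pair q facets K.
Proof.
have cF F : F \in facets -> #|F| = q by move=> /facetsP[? ? ?]; apply: simp.
have coat F S : F \in facets -> S \subset F -> coatom y T S F.
  by move=> /facetsP[fF rF _] SF; split=> //; rewrite rF rT.
have coatK S : S \subset K -> coatom y T S K by move=> SK; split=> //; rewrite rK rT.
have coatI F S : coatom y T S F -> F != K -> F \in facets.
  by move=> [fF rF _] nF; apply/facetsP; split=> //; apply/eq_add_S; rewrite rF.
split=> //.
- move=> F S FF SF cS; have [fS rS] := facets_sub FF SF.
  have /facetsP[fF rF nF] := FF.
  have rSF : (rk y S).+1 = rk y F by rewrite rS cS rF; move: q2; clear; lia.
  have rFT : (rk y F).+1 = rk y T by rewrite rF rT.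
  have [F' [fF' rF' nF' I']] := other_facet fS fF SF rSF rFT.
  have SF' : S \subset F' by rewrite -I' subsetIl.
  have uniq H : coatom y T S H -> H = F \/ H = F'.
    move=> [fH rH SH]; case: (eqVneq H F) => [|n1]; first by left.
    case: (eqVneq H F') => [|n2]; first by right.
    exfalso; apply: (@facet_three S F F' H fS) => //; first by rewrite -rFT -rSF.
      move=> X; rewrite !inE => /or3P[] /eqP ->; split=> //.
    by rewrite eq_sym.
  (* The second facet at the ridge S may be K, which [facets] leaves out; the summand for S inside K
     makes up for it. *)
  case: (eqVneq F' K) => [FK|nFK].
    rewrite -FK SF' (_ : [set G in facets | S \subset G] = [set F]) ?cards1 //.
    apply/setP => G; rewrite inE [RHS]inE; apply/andP/eqP => [[GF SG]|->]; last by split.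
    have [//|GF'] := uniq G (coat _ _ GF SG).
    by have /facetsP[_ _] := GF; rewrite GF' FK eqxx.
  have FF' : F' \in facets by apply: (coatI _ S).
  have -> : (S \subset K) = false.
    apply: contraNF nFK => SK; have [h|<- //] := uniq K (coatK _ SK).
    by rewrite h eqxx in nF.
  rewrite addn0 (_ : [set G in facets | S \subset G] = [set F; F']) ?cards2 1?eq_sym ?nF' //.
  apply/setP => G; rewrite inE [RHS]inE !in_set1; apply/andP/orP => [[GF SG]|].
    by have [->|->] := uniq G (coat _ _ GF SG); [left | right].
  by case=> /eqP ->; split.
- move=> S nS cS P F G FF GF SF SG PF cl.
  have [fS rS] := facets_sub FF SF.
  apply: (coatom_connected fS _ PF (coat _ _ FF SF) (coat _ _ GF SG)).
  have nK (X : {set I}) : S \subset X -> X != K by move=> SX; apply: contraNneq nS => <-.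
  move=> X X' U PX cX cX' fU rU SU UX UX'.
  have [fX rX SX] := cX; have [fX' rX' SX'] := cX'.
  have XF := coatI _ _ cX (nK _ SX); have XF' := coatI _ _ cX' (nK _ SX').
  case: (eqVneq X X') => [<- //|n].
  apply: (cl X X') => //.
  have r1 : (rk y U).+1 = rk y X by apply/eq_add_S; rewrite rU rX.
  have r2 : (rk y U).+1 = rk y X' by apply/eq_add_S; rewrite rU rX'.
  rewrite (facetI fU fX fX' UX UX' r1 r2 n).
  have [_ <-] := facets_sub XF UX.
  by move: rU; rewrite rT; clear; lia.
- have bdK B : B \in bd q facets K -> [/\ faceof y K B, (rk y B).+1 = rk y K & #|B| = rk y B].
    move=> BB; have /mem_bd[fB BK rB] := BB; split; first exact: faceof_restr fB BK (faceof_sub fK).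
      by rewrite rB rK.
    by have /bdP[F [FF c E]] := BB; rewrite E; have [_ ->] := facets_sub FF (subsetIl F K).
  have Kbd B : faceof y K B -> (rk y B).+1 = rk y K -> B \in bd q facets K.
    move=> fB rB; apply/mem_bd; split; [exact: faceof_trans fK fB | exact: faceof_sub fB|].
    by rewrite rB rK.
  have bsub (B S : {set I}) : B \in bd q facets K -> S \subset B -> faceof y K S /\ rk y S = #|S|.
    move=> BB SB; have [fB rB cB] := bdK _ BB.
    by split; [apply: faceof_trans fB (free_face (esym cB) SB) | apply: free_rk (esym cB) SB].
  split.
  + by move=> B /bdK[_ rB ->]; move: rB; rewrite rK => <-.
  + move=> B S BB SB cS; have [fS rS] := bsub _ _ BB SB.
    have [fB rB cB] := bdK _ BB.
    have rSB : (rk y S).+1 = rk y B.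
      by move: rB; rewrite rK rS cS; case: q q2 => [|[|n]] // _ []; clear; lia.
    have [[cS' eS] [cB' eB]] := (fS, fB).
    have BK : B != K by apply: contraTneq isT => h; move: rB; rewrite h => /esym/n_Sn.
    have [c2 [B' [e2 SB' r' I']]] := diamond_ex eS eB SB BK.
    have nB : B != B' by apply: contraTneq isT => h; move: I' rSB; rewrite -h setIid => ->; move/esym/n_Sn.
    have B'B : B' \in bd q facets K by apply: Kbd; [exists c2 | rewrite r' rSB].
    rewrite (_ : [set G in bd q facets K | S \subset G] = [set B; B']) ?cards2 ?nB //.
    apply/setP => G; rewrite inE [RHS]inE !in_set1; apply/andP/orP => [[GB SG]|].
      case: (eqVneq G B) => [|n1]; first by left.
      case: (eqVneq G B') => [|n2]; first by right.
      have [[cG eG] rG _] := bdK _ GB.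
      have rG' : rk y G = (rk y S).+1 by apply/eq_add_S; rewrite rG -rB -rSB.
      by case: (diamond_uniq eS eB e2 eG SB SB' SG (esym rSB) r' rG' _ nB n1 n2); rewrite -rB -rSB.
    by case=> /eqP ->; split.
  + move=> S cS P F G FF GF SF SG PF cl.
    have [fS rS] := bsub _ _ FF SF.
    have coa (B : {set I}) : B \in bd q facets K -> S \subset B -> coatom y K S B.
      by move=> /bdK[? ? ?].
    apply: (coatom_connected fS _ PF (coa _ FF SF) (coa _ GF SG)).
    move=> X X' U PX [fX rX SX] [fX' rX' SX'] fU rU SU UX UX'.
    have XF := Kbd _ fX rX; have XF' := Kbd _ fX' rX'.
    case: (eqVneq X X') => [<- //|n].
    apply: (cl X X') => //.
    have r1 : rk y X = (rk y U).+1 by apply/eq_add_S; rewrite rU rX.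
    have r2 : rk y X' = (rk y U).+1 by apply/eq_add_S; rewrite rU rX'.
    have [[cU eU] [[cX eX] [cX' eX']]] := (fU, (fX, fX')).
    rewrite (atomI eU eX eX' UX UX' r1 r2 n).
    have [_ <-] := bsub _ _ XF UX.
    by move: rU; rewrite rK; clear; lia.
- exact: facet_notK.
- move=> S /isfP[F FF SF] SK; have [fS rS] := facets_sub FF SF.
  have nK : S != K.
    apply: contra (facet_notK FF) => /eqP SK'; have /facetsP[fF rF _] := FF.
    by rewrite -(faceof_eq fK fF _ _) ?rK ?rF // -SK'.
  have [B [fB SB rB]] := coatom_ex (faceof_restr fS SK (faceof_sub fK)) nK.
  apply/isfP; exists B => //; apply/mem_bd; split; [exact: faceof_trans fK fB | exact: faceof_sub fB|].
  by rewrite rB rK.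
move=> S SK cS P a b aK bK ha hb Pa cl.
have nin x : x \notin K -> x \notin S by apply: contra; apply: (subsetP SK).
have at_ x : x \notin K -> isf facets (x |: S) -> atom y T S K (x |: S) /\ rk y S = #|S| /\ faceof y T S.
  move=> xK /isfP[F FF s]; have [f1 r1] := facets_sub FF s.
  have [f2 r2] := facets_sub FF (subset_trans (subsetUr _ _) s).
  split=> //; split=> //; last by rewrite subUset sub1set (negbTE xK).
    by rewrite r1 r2 cardsU1 (nin _ xK).
  exact: subsetUr.
have [aA [rS fS]] := at_ a aK ha; have [bA _] := at_ b bK hb.
have [h eK] := fK.
(* The atoms above S not contained in K are the sets S plus one vertex off K, so a predicate on
   vertices becomes one on atoms. *)
pose P' (A : {set I}) := forall x, x \notin K -> A = x |: S -> P x.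
suff : P' (b |: S) by apply.
apply: (atom_connected (T := T) fS eK SK (P := P') _ (A := a |: S)) => //; last first.
  move=> x xK e; have : x \in a |: S by rewrite e setU11.
  by rewrite in_setU1 (negbTE (nin _ xK)) orbF => /eqP ->.
move=> A B U PA [fA rA SA nA] [fB rB SB nB] fU rU AU BU z zK Bz.
have rkq X : rk y X = (rk y S).+1 -> X != T.
  by move=> rX; apply: rk_neT; rewrite rX rS; move: cS; clear; lia.
have nK (X : {set I}) : ~~ (X \subset K) -> X != K by apply: contraNneq => ->.
have cA : #|A| = (#|S|).+1 by rewrite -(face_rk fA (rkq _ rA) (nK _ nA)) rA rS.
have /subsetPn[x xA xK] := nA.
have Ax : A = x |: S.
  apply/esym/eqP; rewrite eqEcard cA cardsU1 (nin _ xK) leqnn andbT.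
  by rewrite subUset sub1set xA.
have UT : U != T by apply: rk_neT; rewrite rU rS.
have UK : U != K.
  by apply: contraNneq nA => <-.
have /isfP[F FF UF] := face_cover fU UT UK.
apply: (cl x z) => //; last exact: PA.
apply/isfP; exists F => //; apply: subset_trans UF.
by rewrite subUset sub1set (subsetP AU) //= -Bz.
Qed.

Lemma isf_face S : isf facets S -> faceof y T S /\ rk y S = #|S|.
Proof. by move=> /isfP[F FF SF]; apply: facets_sub FF SF. Qed.

Lemma card_faces k : (k < q)%N ->
  #|[set S | `[< faceof y T S /\ rk y S = k >]]| = #|fk k facets|.
Proof.
move=> kq; apply: eq_card => S; rewrite inE [RHS]inE; apply/asboolP/andP.
  move=> [fS rS]; have nT : S != T by apply: rk_neT; rewrite rS ltnW.
  have nK : S != K by apply: contraTneq kq => h; rewrite -rS h rK ltnn.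
  by rewrite -(face_rk fS nT nK) rS; split=> //; apply: face_cover.
by move=> [/eqP cS h]; have [fS rS] := isf_face h; rewrite rS cS.
Qed.

Lemma card_facets : #|[set S | `[< faceof y T S /\ rk y S = q >]]| = #|facets|.+1.
Proof.
have nK : K \notin facets by apply/negP => /facetsP[_ _]; rewrite eqxx.
have -> : [set S | `[< faceof y T S /\ rk y S = q >]] = K |: facets.
  apply/setP => S; rewrite inE in_setU1; apply/asboolP/orP.
    move=> [fS rS]; case: (eqVneq S K) => [|n]; first by left.
    by right; apply/facetsP.
  by case=> [/eqP ->|/facetsP[]].
by rewrite cardsU1 nK.
Qed.

Lemma cover_facets : (forall i, i \in T -> faceof y T [set i] /\ rk y [set i] = 1%N) -> cover facets = T.
Proof.
move=> h; apply/setP => i; apply/idP/idP => [/bigcupP[F /facetsP[fF _ _] iF]|iT].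
  exact: (subsetP (faceof_sub fF)).
have [fi ri] := h i iT; rewrite mem_cover; apply: face_cover => //.
  by apply: rk_neT; rewrite ri ltnW.
by apply: contraTneq q2 => e; rewrite -rK -e ri.
Qed.

End ConfigPair.

(** * Discarding the points that are not vertices *)

Section Vertices.

Local Open Scope ring_scope.

Variables (R : realFieldType) (N : nat) (I : finType) (y : I -> 'rV[R]_N) (T : {set I}).
Implicit Types S F G : {set I}.

Definition nface k := #|[set S | `[< faceof y T S /\ rk y S = k >]]|.

Hypothesis face0 : faceof y T set0.
(* Points are not repeated, so a vertex is a singleton. *)
Hypothesis single : forall S, faceof y T S -> rk y S = 1%N -> #|S| = 1%N.

Definition vtx := [set i in T | `[< faceof y T [set i] >]].

Lemma vtxP i : reflect (faceof y T [set i]) (i \in vtx).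
Proof.
rewrite inE; apply: (iffP andP) => [[_ /asboolP]//|f]; split; last exact/asboolP.
by rewrite -sub1set; apply: faceof_sub f.
Qed.

Lemma rk_vtx i : i \in vtx -> rk y [set i] = 1%N.
Proof.
move=> /vtxP f; apply/eqP; rewrite eqn_leq; apply/andP; split.
  by have := rk_card y [set i]; rewrite cards1.
have [c e] := faceof_restr face0 (sub0set _) (faceof_sub f).
by apply: (leq_ltn_trans (leq0n (rk y set0)) (expo_rk_lt e _)); apply/eqP => /setP/(_ i); rewrite !inE eqxx.
Qed.

(** An atom above the empty face is a vertex, so [atom_neg] yields a negative vertex. In effect, the
    vertices generate the cone. *)
Lemma neg_vtx S X : faceof y T S -> (exists2 i, i \in S & ev (y i) X < 0) ->
  exists2 i, i \in S :&: vtx & ev (y i) X < 0.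
Proof.
move=> fS [i iS Xi]; have [c e] := faceof_restr face0 (sub0set _) (faceof_sub fS).
have [|c' [A [e' _ rA neg]]] := atom_neg e _ iS Xi; first by move=> j; rewrite inE.
have fA : faceof y T A by apply: faceof_trans fS _; exists c'.
have /eqP/cards1P[a Aa] := single fA (etrans rA (congr1 succn (rk0 y))).
have aA : a \in A by rewrite Aa set11.
exists a; last by apply: neg; rewrite ?inE.
by rewrite inE (subsetP (expo_sub e')) //=; apply/vtxP; rewrite -Aa.
Qed.

Lemma spn_vtx S : faceof y T S -> (spn y S <= spn y (S :&: vtx))%MS.
Proof.
move=> fS; apply/spn_subP => i iS; apply: contraT => /sep[X X0 Xi].
have [|j jA] := neg_vtx (X := X) fS; first by exists i; rewrite // Xi ltrN10.
by rewrite X0 ?ltxx // spn_mem.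
Qed.

Lemma rk_vtxI S : faceof y T S -> rk y (S :&: vtx) = rk y S.
Proof.
move=> fS; apply/eqP; rewrite eqn_leq rkS ?subsetIl //=.
by apply: mxrankS; apply: spn_vtx.
Qed.

Lemma vtx_sub : vtx \subset T.
Proof. by apply/subsetP => i; rewrite inE => /andP[]. Qed.

Lemma faceof_vtx S : faceof y T S -> faceof y vtx (S :&: vtx).
Proof.
move=> [c e]; exists c; split=> [i /(subsetP vtx_sub) iT|]; first by case: e => h _; apply: h.
apply/setP => i; rewrite in_setI [RHS]in_set andbC; case: (boolP (i \in vtx)) => //= iv.
by have /setP/(_ i) := e.2; rewrite [RHS]in_set (subsetP vtx_sub).
Qed.

(** A functional that is nonnegative on the vertices is so on all of T by [neg_vtx], hence exposes a
    face of T too. *)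
Lemma faceof_vtx_ex S' : faceof y vtx S' -> exists2 S, faceof y T S & S' = S :&: vtx.
Proof.
move=> [c [h1 h2]].
have h i : i \in T -> 0 <= ev (y i) c.
  move=> iT; rewrite leNgt; apply/negP => ci.
  have fT : faceof y T T by exists 0; apply: expo_refl.
  have [|j] := neg_vtx (X := c) fT; first by exists i.
  by rewrite inE => /andP[_ /h1]; rewrite leNgt => /negP.
exists [set i in T | ev (y i) c == 0]; first by exists c.
apply/setP => i; rewrite in_setI h2 [LHS]in_set [X in _ = X && _]in_set andbC.
by case: (boolP (i \in vtx)) => [/(subsetP vtx_sub) ->|]; rewrite ?andbT ?andbF.
Qed.

Lemma vtx_inj S F : faceof y T S -> faceof y T F -> S :&: vtx = F :&: vtx -> S = F.
Proof.
have sub A B : faceof y T A -> faceof y T B -> A :&: vtx = B :&: vtx -> A \subset B.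
  move=> fA [c e] h; apply/subsetP => i iA.
  apply: (expo_closed e); first exact: (subsetP (faceof_sub fA)).
  by apply: submx_trans (spn_mem y iA) (submx_trans (spn_vtx fA) _); rewrite h spnS // subsetIl.
by move=> fS fF h; apply/eqP; rewrite eqEsubset !sub.
Qed.

Lemma card_faces_vtx k : nface k = #|[set S | `[< faceof y vtx S /\ rk y S = k >]]|.
Proof.
rewrite /nface -(card_in_imset (f := fun S => S :&: vtx) (D := [set S | `[< faceof y T S /\ rk y S = k >]])).
  apply: eq_card => S; rewrite [RHS]inE; apply/imsetP/asboolP => [[F]|[fS rS]].
    by rewrite inE => /asboolP[fF rF] ->; split; [apply: faceof_vtx | rewrite rk_vtxI].
  have [F fF E] := faceof_vtx_ex fS; exists F => //.
  by rewrite inE; apply/asboolP; split=> //; rewrite -rk_vtxI // -E.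
by move=> S F; rewrite !inE => /asboolP[fS _] /asboolP[fF _]; apply: vtx_inj.
Qed.

Lemma nface1 : nface 1 = #|vtx|.
Proof.
rewrite /nface -(card_imset _ (@set1_inj I)); apply: eq_card => S; rewrite inE.
apply/asboolP/imsetP => [[fS rS]|[i iv ->]].
  by have /eqP/cards1P[i E] := single fS rS; exists i => //; apply/vtxP; rewrite -E.
by split; [apply/vtxP | apply: rk_vtx].
Qed.

Lemma nface1_sub K : faceof y T K ->
  #|[set S | `[< faceof y K S /\ rk y S = 1%N >]]| = #|K :&: vtx|.
Proof.
move=> fK; rewrite -(card_imset _ (@set1_inj I)); apply: eq_card => S; rewrite inE.
apply/asboolP/imsetP => [[fS rS]|[i]].
  have /eqP/cards1P[i E] := single (faceof_trans fK fS) rS; exists i => //.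
  rewrite inE -sub1set -E (faceof_sub fS); apply/vtxP; rewrite -E; exact: faceof_trans fK fS.
rewrite inE => /andP[iK iv] ->; split; last exact: rk_vtx.
by apply: faceof_restr (vtxP _ iv) _ (faceof_sub fK); rewrite sub1set.
Qed.

Variables (K : {set I}) (q : nat).
Hypothesis fK : faceof y T K.
Hypothesis rK : rk y K = q.
Hypothesis rT : rk y T = q.+1.
Hypothesis q2 : (1 < q)%N.
Hypothesis simp : forall F, faceof y T F -> rk y F = q -> F != K -> #|F :&: vtx| = q.

Let Fs := facets y vtx (K :&: vtx) q.

Lemma vtx_hyps : [/\ faceof y vtx (K :&: vtx), rk y (K :&: vtx) = q, rk y vtx = q.+1 &
  forall F, faceof y vtx F -> rk y F = q -> F != K :&: vtx -> #|F| = q].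
Proof.
split; [exact: faceof_vtx | by rewrite rk_vtxI | |].
  have fT : faceof y T T by exists 0; apply: expo_refl.
  by rewrite -rT -(rk_vtxI fT) (setIidPr vtx_sub).
move=> F /faceof_vtx_ex[S fS ->]; rewrite rk_vtxI // => rS n; apply: simp => //.
by apply: contraNneq n => ->.
Qed.

Lemma vtx_pair : pair q Fs (K :&: vtx).
Proof. by have [h1 h2 h3 h4] := vtx_hyps; apply: config_pair. Qed.

Lemma nface_fk k : (k < q)%N -> nface k = #|fk k Fs|.
Proof.
by move=> kq; rewrite card_faces_vtx; have [h1 h2 h3 h4] := vtx_hyps; apply: card_faces.
Qed.

Lemma nface_facets : nface q = #|Fs|.+1.
Proof.
by rewrite card_faces_vtx; have [h1 h2 h3 h4] := vtx_hyps; apply: card_facets.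
Qed.

Lemma cover_vtx : cover Fs = vtx.
Proof.
have [h1 h2 h3 h4] := vtx_hyps; apply: cover_facets => // i iv; split; last exact: rk_vtx.
by have := faceof_vtx (vtxP _ iv); rewrite (setIidPl _) // sub1set.
Qed.

End Vertices.

Section ConfigBound.

Local Open Scope ring_scope.

Variables (R : realFieldType) (N : nat) (I : finType) (y : I -> 'rV[R]_N) (T K : {set I}).

Theorem config_lower_bound p :
  faceof y T set0 -> (forall S, faceof y T S -> rk y S = 1%N -> #|S| = 1%N) ->
  faceof y T K -> rk y K = p.+3 -> rk y T = p.+4 ->
  (forall F, faceof y T F -> rk y F = p.+3 -> F != K -> #|F :&: vtx y T| = p.+3) ->
  let n := #|vtx y T| in let k0 := #|K :&: vtx y T| in
  [/\ forall k, (k < p)%N ->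
        ('C(p.+3, k.+1) * n <= nface y T k.+2 + k.+1 * 'C(p.+4, k.+2))%N,
      (p.+3 * p.+2 * n + 2 * p.+3 <=
         2 * nface y T p.+2 + 2 * k0 + p.+1 * p.+4 * p.+3)%N &
      (p.+2 * n + p.+3 <= nface y T p.+3 + k0 + p.+4 * p.+1)%N].
Proof.
move=> f0 si fK rK rT simp n k0.
have pr := vtx_pair f0 si fK rK rT isT simp.
have cv := cover_vtx f0 si fK rK rT isT simp.
have [G GF] : exists G, G \in facets y (vtx y T) (K :&: vtx y T) p.+3.
  have : set0 \in fk 0 (facets y (vtx y T) (K :&: vtx y T) p.+3).
    have := nface_fk f0 si fK rK rT simp (ltn0Sn _).
    rewrite inE cards0 eqxx /= => e.
    have : (0 < nface y T 0)%N.
      by apply/card_gt0P; exists set0; rewrite inE; apply/asboolP; split; rewrite ?rk0.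
    rewrite e => /card_gt0P[S]; rewrite inE => /andP[_]; apply: isf_sub; exact: sub0set.
  by rewrite inE => /andP[_ /isfP[G GF _]]; exists G.
have kE : #|(K :&: vtx y T) :&: cover (facets y (vtx y T) (K :&: vtx y T) p.+3)| = k0.
  by rewrite cv -setIA setIid.
split.
- move=> k kp; have k3 : (k.+3 < p.+3)%N by move: kp; clear; lia.
  have := lb_pair_faces pr GF k3; rewrite cv.
  by rewrite (nface_fk f0 si fK rK rT simp) //; move: kp; clear; lia.
- have := lb_pair_ridges pr GF; rewrite kE cv.
  by rewrite (nface_fk f0 si fK rK rT simp).
by have := lb_pair_facets pr GF; rewrite kE cv (nface_facets f0 si fK rK rT simp) addn1.
Qed.

End ConfigBound.

(** * Pyramids and stackings of configurations *)

Section Cone.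

Local Open Scope ring_scope.

Variables (R : realFieldType) (N : nat) (I : finType) (y : I -> 'rV[R]_N) (u : 'rV[R]_N).
Implicit Types (S G H T : {set I}) (B : {set option I}).

Definition cone_pt (o : option I) := if o is Some i then y i else u.
(** One construction for both operations: it is a pyramid if the new point u is outside the span of
    T, and it covers stacking if u is inside. *)
Definition cone T : {set option I} := None |: Some @: T.
Definition base B : {set I} := [set i | Some i \in B].

Let yo := cone_pt.

Lemma Some_inj : injective (@Some I). Proof. by move=> ? ? []. Qed.

Lemma mem_Some S i : (Some i \in Some @: S) = (i \in S).
Proof. by rewrite mem_imset //; apply: Some_inj. Qed.

Lemma None_Some S : None \notin Some @: S.
Proof. by apply/imsetP => -[]. Qed.

Lemma base_Some S : base (Some @: S) = S.
Proof. by apply/setP => i; rewrite inE mem_Some. Qed.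

Lemma None_cone S : None \in cone S. Proof. exact: setU11. Qed.

Lemma baseK B : B = if None \in B then cone (base B) else Some @: base B.
Proof.
apply/setP => -[i|]; case: ifP => h; rewrite ?in_setU1 ?mem_Some ?inE ?h ?eqxx //.
by rewrite (negbTE (None_Some _)).
Qed.

Lemma rk_Some S : rk yo (Some @: S) = rk y S.
Proof.
apply/eqP; rewrite eqn_leq; apply/andP; split; apply: mxrankS; apply/spn_subP.
  by move=> o /imsetP[i iS ->]; exact: (spn_mem y iS).
by move=> i iS; apply: (@spn_mem _ _ _ yo _ (Some i)); rewrite mem_Some.
Qed.

Lemma rk_cone S : ~~ (u <= spn y S)%MS -> rk yo (cone S) = (rk y S).+1.
Proof.
move=> nu; rewrite -(rk_addmx_eq nu); apply/eqP; rewrite eqn_leq.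
apply/andP; split; apply: mxrankS.
  apply/spn_subP => -[i|] h; last exact: addsmxSr.
  rewrite in_setU1 mem_Some /= in h.
  by apply: submx_trans (spn_mem y h) (addsmxSl _ _).
rewrite addsmx_sub; apply/andP; split; last exact: (@spn_mem _ _ _ yo _ None (None_cone S)).
apply/spn_subP => i iS; apply: (@spn_mem _ _ _ yo _ (Some i)).
by rewrite in_setU1 mem_Some iS orbT.
Qed.

Lemma rk_cone_in S : (u <= spn y S)%MS -> rk yo (cone S) = rk y S.
Proof.
move=> uS; rewrite -rk_Some; apply/eqP; rewrite eqn_leq; apply/andP; split; last first.
  by apply: rkS; apply: subsetUr.
apply: mxrankS; apply/spn_subP => -[i|] h.
  by apply: (@spn_mem _ _ _ yo _ (Some i)); move: h; rewrite in_setU1 mem_Some.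
apply: submx_trans uS _; apply/spn_subP => i iS; apply: (@spn_mem _ _ _ yo _ (Some i)).
by rewrite mem_Some.
Qed.

Lemma expo_base c T B : expo yo c (cone T) B -> expo y c T (base B).
Proof.
move=> [h e]; split=> [i iT|].
  by apply: (h (Some i)); rewrite in_setU1 mem_Some iT orbT.
by apply/setP => i; rewrite [LHS]inE e !inE mem_Some.
Qed.

Lemma expo_Some c T S : expo y c T S -> 0 < ev u c -> expo yo c (cone T) (Some @: S).
Proof.
move=> [h e] uc; split=> [[i|] |].
- by rewrite in_setU1 mem_Some /= => iT; apply: h.
- by move=> _; apply: ltW.
apply/setP => -[i|]; last by rewrite (negbTE (None_Some _)) inE /= gt_eqF // andbF.
by rewrite mem_Some e !inE mem_Some.
Qed.

Lemma cone_expo0 c T B : expo yo c (cone T) B -> None \in B -> ev u c = 0.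
Proof. exact: (@expo0 _ _ _ yo _ _ _ None). Qed.

Lemma cone_expo_gt0 c T B : expo yo c (cone T) B -> None \notin B -> 0 < ev u c.
Proof. by move=> e; apply: (expo_gt0 e (None_cone T)). Qed.

(* The two kinds of faces of the cone: those avoiding the apex and those
   through it, each determined by its trace on the base. *)
Lemma card_cone_faces T k (X Y : {set {set I}}) :
  (forall B, faceof yo (cone T) B -> rk yo B = k -> None \notin B -> base B \in X) ->
  (forall B, faceof yo (cone T) B -> rk yo B = k -> None \in B -> base B \in Y) ->
  (nface yo (cone T) k <= #|X| + #|Y|)%N.
Proof.
move=> hX hY; rewrite /nface; set E := [set B | _].
rewrite -(cardsID [set B : {set option I} | None \in B] E) addnC; apply: leq_add.
  rewrite -(card_in_imset (f := base)).
    apply/subset_leq_card/subsetP => S /imsetP[B]; rewrite !inE.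
    by move=> /andP[nB /asboolP[fB rB]] ->; apply: hX.
  move=> B B'; rewrite !inE => /andP[nB _] /andP[nB' _] e.
  by rewrite [B]baseK [B']baseK (negbTE nB) (negbTE nB') e.
rewrite -(card_in_imset (f := base)).
  apply/subset_leq_card/subsetP => S /imsetP[B]; rewrite !inE.
  by move=> /andP[/asboolP[fB rB] nB] ->; apply: hY.
by move=> B B'; rewrite !inE => /andP[_ nB] /andP[_ nB'] e; rewrite [B]baseK [B']baseK nB nB' e.
Qed.

Lemma pyramid_faces T k : ~~ (u <= spn y T)%MS ->
  (nface yo (cone T) k.+1 <= nface y T k.+1 + nface y T k)%N.
Proof.
move=> nu; apply: card_cone_faces => B [c e] rB nB; rewrite inE; apply/asboolP.
  have fB : faceof y T (base B) by exists c; apply: expo_base e.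
  by split=> //; rewrite -rB [in RHS](baseK B) (negbTE nB) rk_Some.
have fB : faceof y T (base B) by exists c; apply: expo_base e.
split=> //; apply/eq_add_S; rewrite -rB [in RHS](baseK B) nB rk_cone //.
by apply: contra nu => h; apply: submx_trans h (spnS _ (faceof_sub fB)).
Qed.

Section Stack.

Variables (T G : {set I}) (g h : 'cV[R]_N).
Hypothesis uT : (u <= spn y T)%MS.
Hypothesis eG : expo y g T G.
Hypothesis rG : (rk y G).+1 = rk y T.
Hypothesis ug : ev u g < 0.
Hypothesis under : forall H, faceof y T H -> (rk y H).+1 = rk y T -> H != G ->
  exists2 c, expo y c T H & 0 < ev u c.
Hypothesis h_gt0 : forall i, i \in T -> 0 < ev (y i) h.
Hypothesis uh : 0 < ev u h.

(** On the span of T, two functionals exposing the same facet differ by a positive factor; so the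
    side of a facet on which the apex lies is well defined. *)
Lemma facet_proportional H c c' x : expo y c T H -> expo y c' T H -> (rk y H).+1 = rk y T ->
  (x <= spn y T)%MS -> ev x c < 0 -> ev x c' < 0.
Proof.
move=> e e' rH xT xc.
have [j jT jH] : exists2 j, j \in T & j \notin H.
  by apply/subsetPn; apply/negP => /(rkS y); rewrite -rH ltnn.
have [a ha] := spn_cover e (esym rH) jT jH xT.
have := spn_ev0 ha (fun i => @expo0 _ _ _ y _ _ _ i e).
have := spn_ev0 ha (fun i => @expo0 _ _ _ y _ _ _ i e').
rewrite !evDl !evNl !evZl => /subr0_eq e1 /subr0_eq e2.
have a0 : a < 0 by rewrite -(pmulr_llt0 _ (expo_gt0 e jT jH)) -e2.
by rewrite e1 pmulr_llt0 // (expo_gt0 e').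
Qed.

Lemma stack_old B : faceof yo (cone T) B -> None \notin B -> base B != G.
Proof.
move=> [c e] nB; apply: contraTneq (cone_expo_gt0 e nB) => bG.
have e' := expo_base e; rewrite bG in e'.
by rewrite -leNgt ltW // (facet_proportional eG e' rG uT ug).
Qed.

Lemma eps_ex (Q : pred {set I}) (a b : {set I} -> R) : (forall H, Q H -> 0 < a H) ->
  exists2 t, 0 < t & forall H, Q H -> t * b H <= a H.
Proof.
move=> a0; pose s := 1 + \sum_(H | Q H) `|b H| / a H.
have s0 : 0 < s.
  by rewrite ltr_wpDr // sumr_ge0 // => H /a0 aH; rewrite divr_ge0 // ltW.
exists s^-1 => [|H QH]; first by rewrite invr_gt0.
rewrite ler_pdivrMl //; have aH := a0 _ QH.
have : `|b H| / a H <= s.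
  rewrite /s (bigD1 H) //= addrCA lerDl addr_ge0 ?ler01 // sumr_ge0 // => H' /andP[/a0 aH' _].
  by rewrite divr_ge0 // ltW.
by rewrite ler_pdivrMr //; apply: le_trans; apply: ler_norm.
Qed.

(* If base B is not in G, all facets through it have the apex on their inner
   side; so a functional vanishing at the apex cannot support B. *)
Lemma stack_new B : faceof yo (cone T) B -> None \in B -> (rk yo B < rk y T)%N ->
  base B \subset G.
Proof.
move=> [c e] nB rB; have eb := expo_base e; set S := base B in eb *.
have ST : S != T.
  apply: contraTneq rB => ST; rewrite -leqNgt [B]baseK nB -/S ST.
  by rewrite rk_cone_in.
apply: contraT => nSG.
have /choice[phi phiP] : forall H, exists d, [/\ faceof y T H, (rk y H).+1 = rk y T & H != G] ->
    expo y d T H /\ 0 < ev u d.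
  move=> H; have [[fH rH nH]|] := pselect [/\ faceof y T H, (rk y H).+1 = rk y T & H != G].
    by have [d ed ud] := under fH rH nH; exists d.
  by exists 0.
pose p := \sum_(i in T) y i.
pose Q H := `[< [/\ faceof y T H, (rk y H).+1 = rk y T & H != G] >].
have [|t t0 tP] := @eps_ex Q (fun H => ev u (phi H)) (fun H => ev p (phi H)).
  by move=> H /asboolP/phiP[].
have pT : (p <= spn y T)%MS by apply: summx_sub => i iT; apply: spn_mem.
(* The apex is pushed slightly away from the interior point p, by so little that it stays on the
   inner side of all facets except G. As c vanishes at the apex, it is negative at x, so x violates
   a facet through base B. That facet is not G, a contradiction. *)
pose x := u - t *: p.
have xT : (x <= spn y T)%MS by apply: addmx_sub => //; rewrite eqmx_opp scalemx_sub.
have [i iT iS] : exists2 i, i \in T & i \notin S.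
  by apply/subsetPn; apply: contra ST => TS; rewrite eqEsubset (expo_sub eb).
have xc : ev x c < 0.
  rewrite evDl evNl evZl (cone_expo0 e nB) add0r oppr_lt0 mulr_gt0 //.
  exact: (ev_sum_gt0 eb (subxx _) iT iS).
have [d [H [eH SH rH xd]]] := coatom_neg eb xT xc.
have nH : H != G by apply: contraNneq nSG => <-.
have fH : faceof y T H by exists d.
have [eH' _] := phiP H (And3 fH rH nH).
have := facet_proportional eH eH' rH xT xd.
rewrite evDl evNl evZl subr_lt0 ltNge => /negP[]; apply: tP.
by apply/asboolP.
Qed.

Lemma stack_rk B : None \in B -> base B \subset G -> rk yo B = (rk y (base B)).+1.
Proof.
move=> nB sG; rewrite [B in LHS]baseK nB rk_cone //; apply/negP => us.
have : ev u g = 0.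
  by apply: (spn_ev0 us) => i /(subsetP sG); apply: (expo0 eG).
by move=> h0; move: ug; rewrite h0 ltxx.
Qed.

(** Faces off the apex are old faces other than G, and those through the apex are cones over faces
    of G. The extra term on the left records the loss of G in the rank of facets. *)
Lemma stack_faces k : (k.+1 < rk y T)%N ->
  (nface yo (cone T) k.+1 + ((k.+2 == rk y T) : nat) <= nface y T k.+1 + nface y G k)%N.
Proof.
move=> kT; set E := [set S | `[< faceof y T S /\ rk y S = k.+1 >]].
have le : (nface yo (cone T) k.+1 <= #|E :\ G| + nface y G k)%N.
  apply: card_cone_faces => B fB rB nB; have [c e] := fB; have eb := expo_base e.
    rewrite !inE stack_old //=; apply/asboolP; split; first by exists c.
    by rewrite -rB [in RHS](baseK B) (negbTE nB) rk_Some.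
  have sG : base B \subset G by apply: stack_new; rewrite ?rB.
  rewrite inE; apply/asboolP; split; first by exists c; apply: expo_restr eb sG (expo_sub eG).
  by apply/eq_add_S; rewrite -rB stack_rk.
apply: leq_trans (leq_add le (leqnn _)) _; rewrite addnAC leq_add2r.
have -> : nface y T k.+1 = #|E| by [].
rewrite (cardsD1 G E) addnC leq_add2r.
case: eqP => // kE; rewrite inE lt0b; apply/asboolP; split; first by exists g.
by apply/eq_add_S; rewrite rG.
Qed.

(** The apex is exposed by g minus a negative multiple of h, chosen to vanish there. An old vertex
    lies on a facet other than G; adding a large multiple of the functional of that facet makes the
    apex positive. *)
Lemma stack_vertices : (forall S, faceof y T S -> rk y S = 1%N ->
   exists H, [/\ faceof y T H, (rk y H).+1 = rk y T, H != G & S \subset H]) ->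
  ((nface y T 1).+1 <= nface yo (cone T) 1)%N.
Proof.
move=> hH; rewrite /nface; set E := [set S | _]; set E' := [set B | _].
pose f S : {set option I} := Some @: S.
have inj_f : injective f by move=> S S' /(congr1 base); rewrite !base_Some.
rewrite -(card_imset E inj_f).
have n0 : cone set0 \notin f @: E.
  by apply/imsetP => -[S _ e]; have := None_cone set0; rewrite e (negbTE (None_Some _)).
have := cardsU1 (cone set0) (f @: E); rewrite n0 add1n => <-.
apply/subset_leq_card/subsetP => B; rewrite in_setU1 => /orP[/eqP ->|/imsetP[S]].
  rewrite inE; apply/asboolP; split; last first.
    rewrite rk_cone ?rk0 //; apply/negP => us; move: ug.
    by rewrite (spn_ev0 us) ?ltxx // => i; rewrite inE.
  pose l := ev u g / ev u h; have l0 : l < 0 by rewrite pmulr_llt0 // invr_gt0.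
  exists (g - l *: h).
  have cu : ev u (g - l *: h) = 0 by rewrite evDr evNr evZr /l divfK ?subrr // gt_eqF.
  have cT i : i \in T -> 0 < ev (y i) (g - l *: h).
    move=> iT; rewrite evDr evNr evZr -mulNr ltr_wpDl ?mulr_gt0 ?oppr_gt0 ?h_gt0 //.
    by case: eG => q _; apply: q.
  split=> [[i|]|].
  - by rewrite in_setU1 mem_Some /= => iT; apply: ltW; apply: cT.
  - by rewrite /= cu.
  apply/setP => -[i|]; rewrite !inE ?mem_Some ?inE /= ?cu ?eqxx //.
  by case: (boolP (i \in T)) => //= iT; rewrite gt_eqF // cT.
rewrite inE => /asboolP[fS rS] ->; rewrite inE; apply/asboolP; split; last by rewrite rk_Some.
have [H [fH rH nH SH]] := hH _ fS rS; have [d eH ud] := under fH rH nH.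
have [c eS] := fS.
pose M := (`|ev u c| + 1) / ev u d.
have M0 : 0 < M by rewrite divr_gt0 // ltr_wpDl.
exists (c + M *: d); apply: expo_Some; last first.
  rewrite evDr evZr /M divfK ?gt_eqF //; have := ler_norm (- ev u c); rewrite normrN; lra.
have eMH : expo y (M *: d) T H.
  case: eH => q ->; split=> [i iT|]; first by rewrite evZr mulr_ge0 ?q // ltW.
  by apply/setP => i; rewrite !inE evZr mulf_eq0 (gt_eqF M0).
by have := expoI eS eMH; rewrite (setIidPl SH).
Qed.

End Stack.

End Cone.

Require Import Defs.
From mathcomp Require Import finmap.
From mathcomp Require Import classical_sets functions cardinality reals.
From mathcomp Require Import interval_inference convex.

(** * Polytopes as configurations *)

Section Hull.

Local Open Scope ring_scope.

Variables (R : realType) (m : nat).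

Lemma conv_hull_sub (A : set 'rV[R]_m) z : A z -> conv_hull A z.
Proof. by apply: sub_gen_smallest. Qed.

Lemma conv_hullP (A : set 'rV[R]_m) z : conv_hull A z <->
  forall B : set 'rV[R]_m, (forall u v t, B u -> B v -> 0 <= t -> t <= 1 -> B (t *: u + (1 - t) *: v)) ->
    (forall u, A u -> B u) -> B z.
Proof.
split=> [h B cB AB|h].
  apply: (h B); split=> // u v t /set_mem Bu /set_mem Bv; apply/mem_set.
  by apply: (cB u v).
move=> B [cB AB]; apply: h => // u v t Bu Bv t0 t1.
by have := cB u v (Itv01 t0 t1) (mem_set Bu) (mem_set Bv) => /set_mem.
Qed.

Section Points.

Variables (I : finType) (x : I -> 'rV[R]_m).
Implicit Types S T : {set I}.

Definition pts S : set 'rV[R]_m := conv_hull [set z | exists2 i, i \in S & z = x i].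

Definition comb (w : I -> R) S z := [/\ forall i, 0 <= w i, forall i, i \notin S -> w i = 0,
  \sum_i w i = 1 & z = \sum_i w i *: x i].

Lemma pts_mem S i : i \in S -> pts S (x i).
Proof. by move=> iS; apply: conv_hull_sub; exists i. Qed.

Lemma ptsP S z : pts S z <-> exists w, comb w S z.
Proof.
split=> [/conv_hullP h|[w [w0 wS w1 ->]]].
  suff : [set z | exists w, comb w S z]%classic z by [].
  apply: h => [u v t [w [w0 wS w1 ->]] [w' [w0' wS' w1' ->]] t0 t1|u [i iS ->]].
    exists (fun i => t * w i + (1 - t) * w' i); split.
    - by move=> i; rewrite addr_ge0 // mulr_ge0 // subr_ge0.
    - by move=> i iS; rewrite wS // wS' // !mulr0 addr0.
    - by rewrite big_split /= -!mulr_sumr w1 w1' !mulr1 subrKC.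
    rewrite !scaler_sumr -big_split /=; apply: eq_bigr => i _.
    by rewrite [RHS]scalerDl !scalerA.
  exists (fun j => (j == i)%:R); split.
  - by move=> j; rewrite ler0n.
  - by move=> j jS; case: eqP => // e; rewrite e iS in jS.
  - by rewrite (bigD1 i) //= eqxx big1 ?addr0 // => j /negbTE ->.
  by rewrite (bigD1 i) //= eqxx scale1r big1 ?addr0 // => j /negbTE ->; rewrite scale0r.
apply/conv_hullP => B cB AB.
(* Partial sums are normalised so that only convex combinations of two points occur; a vanishing
   partial sum is treated apart. *)
have key (r : seq I) : 0 < \sum_(i <- r) w i ->
    B ((\sum_(i <- r) w i)^-1 *: \sum_(i <- r) w i *: x i).
  elim: r => [|i r IH]; first by rewrite big_nil ltxx.
  rewrite !big_cons.
  have [wi|wi] := eqVneq (w i) 0; first by rewrite wi scale0r !add0r.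
  have iS : i \in S by apply: contraNT wi => /wS ->.
  have wi0 : 0 < w i by rewrite lt0r wi w0.
  have r0 : 0 <= \sum_(j <- r) w j by apply: sumr_ge0.
  move=> s0; have [r1|r1] := eqVneq (\sum_(j <- r) w j) 0.
    have z0 j : j \in r -> w j = 0.
      by move=> jr; apply/eqP; move/eqP: r1; rewrite psumr_eq0 // => /allP/(_ j jr).
    rewrite r1 addr0 [X in _ + X]big_seq big1 => [|j /z0 ->]; last by rewrite scale0r.
    by rewrite addr0 scalerA mulVf // scale1r; apply: AB; exists i.
  have r2 : 0 < \sum_(j <- r) w j by rewrite lt0r r1.
  set s' := \sum_(j <- r) w j in s0 r0 r1 r2 IH *; set z' := \sum_(j <- r) w j *: x j in IH *.
  have t1 : w i / (w i + s') <= 1 by rewrite ler_pdivrMr // mul1r lerDl.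
  have := cB _ _ (w i / (w i + s')) (AB (x i) (ex_intro2 _ _ i iS erefl)) (IH r2) _ t1.
  rewrite divr_ge0 ?w0 ?(ltW s0) // => /(_ isT); congr B.
  rewrite scalerDr !scalerA; congr (_ *: _ + _ *: _); first by rewrite mulrC.
  have n := lt0r_neq0 s0.
  have -> : 1 - w i / (w i + s') = s' / (w i + s').
    by rewrite -{1}(divff n) -mulrBl addrAC subrr add0r.
  by rewrite mulrAC divff // mul1r.
have := key (index_enum I); rewrite w1 => /(_ ltr01).
by rewrite invr1 scale1r.
Qed.

(* Homogenization: affine functionals become linear, and dimensions become ranks minus 1. *)
Definition yv (z : 'rV[R]_m) : 'rV[R]_(1 + m) := row_mx 1%:M z.

Let y i := yv (x i).

Lemma yv_sum (J : finType) (A : {set J}) (w : J -> R) (v : J -> 'rV[R]_m) :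
  \sum_(j in A) w j = 1 -> yv (\sum_(j in A) w j *: v j) = \sum_(j in A) w j *: yv (v j).
Proof.
move=> w1; rewrite -[RHS]hsubmxK !linear_sum /=; congr row_mx.
  rewrite -[LHS]scale1r -{1}w1 scaler_suml; apply: eq_bigr => j _.
  by rewrite linearZ /= /yv row_mxKl.
by apply: eq_bigr => j _; rewrite linearZ /= /yv row_mxKr.
Qed.

Lemma comb_sum w S z : comb w S z -> \sum_(i in S) w i = 1 /\ z = \sum_(i in S) w i *: x i.
Proof.
move=> [_ wS w1 ->]; rewrite -w1; split.
  by rewrite [LHS]big_mkcond; apply: eq_bigr => i _; case: ifP => // /negbT /wS.
rewrite [RHS]big_mkcond; apply: eq_bigr => i _; case: ifP => // /negbT /wS ->.
by rewrite scale0r.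
Qed.

Lemma ev_comb w S z c : comb w S z -> ev (yv z) c = \sum_(i in S) w i * ev (y i) c.
Proof.
move=> /comb_sum[w1 ->]; rewrite yv_sum // ev_suml.
by apply: eq_bigr => i _; rewrite evZl.
Qed.

(** The slack of an affine inequality is linear in the homogenized point. With the converse
    [ev_form], supporting pairs and exposing functionals correspond. *)
Lemma form_ev (f : {scalar 'rV[R]_m}) (b : R) :
  exists c : 'cV_(1 + m), forall z, ev (yv z) c = b - f z.
Proof.
exists (col_mx b%:M (- \col_j f (delta_mx 0 j))) => z.
rewrite /ev mul_row_col mul1mx mulmxN mxE [X in X + _]mxE eqxx mulr1n; congr (_ + _).
rewrite mxE; congr (- _); rewrite mxE {2}(row_sum_delta z) linear_sum.
by apply: eq_bigr => j _; rewrite mxE linearZ.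
Qed.

Definition dotf (c : 'cV[R]_m) (z : 'rV[R]_m) : R := (z *m c) 0 0.

Fact dotf_is_linear c : scalar (dotf c).
Proof. by move=> a u v; rewrite /dotf mulmxDl -scalemxAl !mxE. Qed.

HB.instance Definition _ c :=
  GRing.isLinear.Build R 'rV[R]_m R *%R (dotf c) (dotf_is_linear c).

Lemma ev_form (c : 'cV[R]_(1 + m)) :
  exists (f : {scalar 'rV[R]_m}) (b : R), forall z, ev (yv z) c = b - f z.
Proof.
exists (dotf (- dsubmx c)), (usubmx c 0 0) => z.
rewrite /ev -{1}[c]vsubmxK mul_row_col mul1mx mxE; congr (_ + _).
by rewrite /= /dotf mulmxN [X in - X]mxE opprK.
Qed.

Lemma ev_pts_ge0 c T z : (forall i, i \in T -> 0 <= ev (y i) c) -> pts T z -> 0 <= ev (yv z) c.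
Proof.
move=> h /ptsP[w cw]; rewrite (ev_comb _ cw); apply: sumr_ge0 => i iT.
by case: cw => w0 _ _ _; rewrite mulr_ge0 // h.
Qed.

Lemma pts_face c T S z : expo y c T S -> (pts T z /\ ev (yv z) c = 0) <-> pts S z.
Proof.
move=> e; split=> [[/ptsP[w cw] z0]|/ptsP[w cw]].
  apply/ptsP; exists w; have [w0 wT w1 zE] := cw; split=> // i iS.
  case: (boolP (i \in T)) => [iT|/wT //].
  have := z0; rewrite (ev_comb _ cw) => /eqP; rewrite psumr_eq0 => [|j jT]; last first.
    by rewrite mulr_ge0 //; case: e => h _; apply: h.
  move=> /allP/(_ i); rewrite mem_index_enum iT => /(_ isT) /=.
  by rewrite mulf_eq0 [X in _ || X]gt_eqF ?(expo_gt0 e) // orbF => /eqP.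
split; last by rewrite (ev_comb _ cw) big1 // => i iS; rewrite (expo0 e iS) mulr0.
apply/ptsP; exists w; case: cw => w0 wS w1 zE; split=> // i iT; apply: wS.
by apply: contra iT; apply: (fintype.subsetP (expo_sub e)).
Qed.

Lemma is_faceP T F : is_face (pts T) F <-> exists2 S, faceof y T S & F = pts S.
Proof.
split=> [[f [b [le ->]]]|[S [c e] ->]].
  have [c cE] := form_ev f b.
  have e : expo y c T [set i in T | ev (y i) c == 0].
    split=> // i iT; rewrite /y cE subr_ge0; apply: le; exact: pts_mem.
  exists [set i in T | ev (y i) c == 0]; first by exists c.
  apply/seteqP; split=> z /=.
    by move=> [Pz fz]; apply/(pts_face z e); rewrite cE fz subrr.
  by move=> /(pts_face z e)[Pz]; rewrite cE => /eqP; rewrite subr_eq0 => /eqP.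
have [f [b fE]] := ev_form c; exists f, b; split.
  move=> z Tz; rewrite -subr_ge0 -fE; apply: ev_pts_ge0 Tz => i iT.
  by case: e => h _; apply: h.
apply/seteqP; split=> z /=.
  by move=> /(pts_face z e)[Pz]; rewrite fE => /eqP; rewrite subr_eq0 => /eqP.
by move=> [Pz fz]; apply/(pts_face z e); rewrite fE fz subrr.
Qed.

Lemma pts_sub T S (F : {set I}) : faceof y T S -> F \subset T -> (pts F `<=` pts S)%classic -> F \subset S.
Proof.
move=> [c e] /fintype.subsetP FT FS; apply/fintype.subsetP => i iF.
have /(pts_face _ e)[_ h] := FS _ (pts_mem iF).
by case: e => _ ->; rewrite finset.inE FT //=; apply/eqP.
Qed.

Lemma pts_inj T S (F : {set I}) : faceof y T S -> faceof y T F -> pts S = pts F -> S = F.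
Proof.
move=> fS fF e; apply/eqP; rewrite finset.eqEsubset.
by rewrite (pts_sub fF (faceof_sub fS)) ?(pts_sub fS (faceof_sub fF)) // e.
Qed.

(** The leading coordinate 1 forces the coefficients of a linear combination to sum to 1. *)
Lemma aff_hullP S z : aff_hull (pts S) z <-> (yv z <= spn y S)%MS.
Proof.
split=> [[k [v [w [vS w1 ->]]]]|].
  have E : yv (\sum_i w i *: v i) = \sum_i w i *: yv (v i).
    have := @yv_sum _ [set: 'I_k]%SET w v.
    have sT (V : nmodType) (F : 'I_k -> V) : \sum_(j in [set: 'I_k]%SET) F j = \sum_j F j.
      by apply: eq_bigl => j; rewrite finset.inE.
    by rewrite !sT; apply.
  rewrite E; apply: summx_sub => i _; apply: scalemx_sub.
  have /ptsP[u /comb_sum[u1 ->]] := vS i; rewrite yv_sum //.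
  by apply: summx_sub => j jS; apply: scalemx_sub; apply: spn_mem.
move=> /sub_sumsmxP[u uE].
have uy i : exists a, u i *m <<y i>>%MS = a *: y i.
  have : (u i *m <<y i>>%MS <= y i)%MS by rewrite (submx_trans (submxMl _ _)) // genmxE.
  by move=> /submxP[D ->]; exists (D 0 0); rewrite [D]mx11_scalar mul_scalar_mx mxE eqxx mulr1n.
have /choice[a aE] := uy.
have zE : yv z = \sum_(i in S) a i *: y i by rewrite uE; apply: eq_bigr => i _; rewrite aE.
have a1 : \sum_(i in S) a i = 1.
  have := congr1 (fun r => lsubmx r 0 0) zE; rewrite /yv row_mxKl mxE eqxx mulr1n => h.
  rewrite [RHS]h linear_sum summxE; apply: eq_bigr => i _.
  by rewrite linearZ /= /y /yv row_mxKl !mxE eqxx mulr1.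
exists #|S|, (fun i => x (enum_val i)), (fun i => a (enum_val i)); split.
- by move=> i; apply: pts_mem; apply: enum_valP.
- by rewrite -a1 [RHS]big_enum_val.
have := congr1 rsubmx zE; rewrite /yv row_mxKr => ->.
rewrite linear_sum [LHS]big_enum_val; apply: eq_bigr => i _.
by rewrite linearZ /= /y /yv row_mxKr.
Qed.

Lemma row0_sum n (a : 'I_n -> R) (u : 'I_n -> 'rV[R]_m) :
  row_mx (0 : 'M[R]_1) (\sum_j a j *: u j) = \sum_j a j *: row_mx (0 : 'M[R]_1) (u j).
Proof.
rewrite -[RHS]hsubmxK !linear_sum /=; congr row_mx.
  by rewrite big1 // => j _; rewrite linearZ /= row_mxKl scaler0.
by apply: eq_bigr => j _; rewrite linearZ /= row_mxKr.
Qed.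

(** The homogenized base point, together with a basis of U padded by a leading 0, is a basis of the
    span; the base point accounts for the successor. *)
Lemma dim_rk S z0 (U : {vspace 'rV[R]_m}) :
  (forall z, (yv z <= spn y S)%MS <-> exists2 u, u \in U & z = z0 + u) ->
  rk y S = (\dim U).+1.
Proof.
move=> h.
pose B := \matrix_(j < \dim U) (vbasis U)`_j : 'M[R]_(\dim U, m).
pose M := col_mx (yv z0) (row_mx (0 : 'cV_(\dim U)) B).
have fM : row_free M.
  apply: inj_row_free => v; rewrite -[v]hsubmxK mul_row_col.
  set v1 := lsubmx v; set v2 := rsubmx v; rewrite /yv !mul_mx_row mulmx0 mulmx1 add_row_mx addr0.
  move=> e; have v10 : v1 = 0 by have := congr1 lsubmx e; rewrite row_mxKl linear0.
  have := congr1 rsubmx e; rewrite row_mxKr linear0 v10 mul0mx add0r => vB.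
  rewrite (_ : v2 = 0) ?row_mx0 //; apply/rowP => j; rewrite [RHS]mxE.
  have fr := basis_free (vbasisP U).
  move: vB; rewrite mulmx_sum_row; under eq_bigr do rewrite rowK.
  by move=> h0; apply: (elimT freeP fr (fun i => v2 0 i) h0 j).
have MS : (M :=: spn y S)%MS.
  apply/eqmxP/andP; split.
    have y0 : (yv z0 <= spn y S)%MS by apply/h; exists 0; rewrite ?mem0v ?addr0.
    rewrite col_mx_sub y0 /=; apply/row_subP => j; rewrite row_row_mx row0 rowK.
    have : (yv (z0 + (vbasis U)`_j) <= spn y S)%MS.
      by apply/h; exists (vbasis U)`_j => //; apply: vbasis_mem; apply: mem_nth; rewrite size_tuple.
    move=> hj; have := addmx_sub hj (_ : (- yv z0 <= spn y S)%MS); rewrite eqmx_opp y0 => /(_ isT).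
    by rewrite /yv opp_row_mx add_row_mx subrr addrAC subrr add0r.
  apply/spn_subP => i iS; have /h[u uU xE] := spn_mem y iS.
  have -> : y i = yv z0 + \sum_(j < \dim U) coord (vbasis U) j u *: row j (row_mx (0 : 'cV_(\dim U)) B).
    rewrite /y xE {1}(coord_vbasis uU) /yv.
    under [X in _ = _ + X]eq_bigr do rewrite row_row_mx row0 rowK.
    by rewrite -row0_sum add_row_mx addr0.
  apply: addmx_sub; first by rewrite /M -addsmxE addsmxSl.
  apply: summx_sub => j _; apply: scalemx_sub; apply: submx_trans (row_sub _ _) _.
  by rewrite /M -addsmxE addsmxSr.
by rewrite /rk -MS; move: fM; rewrite /row_free => /eqP ->; rewrite add1n.
Qed.

Lemma has_dimP S k : has_dim (pts S) k <-> rk y S = k.+1.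
Proof.
split=> [[z0 [U [aE <-]]]|rS].
  apply: (dim_rk (z0 := z0)) => z; rewrite -aff_hullP aE.
  by split=> [[u uU <-]|[u uU ->]]; exists u.
have [i iS] : exists i, i \in S.
  apply/card_gt0P; rewrite lt0n cards_eq0; apply/eqP => e.
  by move: rS; rewrite e rk0.
pose U := <<[seq x j - x i | j <- enum S]>>%VS.
have hU z : (yv z <= spn y S)%MS <-> exists2 u, u \in U & z = x i + u.
  split.
    move=> /aff_hullP[k' [v [w [vS w1 ->]]]].
    have vU j : v j - x i \in U.
      have /ptsP[u /comb_sum[u1 ->]] := vS j.
      rewrite -[x i]scale1r -u1 scaler_suml -sumrB; apply: memv_suml => l lS.
      by rewrite -scalerBr; apply/memvZ/memv_span/map_f; rewrite mem_enum.
    exists (\sum_j w j *: (v j - x i)); first by apply: memv_suml => j _; apply: memvZ.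
    under [X in _ = _ + X]eq_bigr do rewrite scalerBr.
    by rewrite sumrB -scaler_suml w1 scale1r addrC subrK.
  move=> [u uU ->].
  have : (row_mx (0 : 'M_1) u <= spn y S)%MS.
    have uU' : u \in <<in_tuple [seq x j - x i | j <- enum S]>>%VS by [].
    rewrite (coord_span uU') row0_sum; set e := in_tuple _.
    apply: summx_sub => j _; apply: scalemx_sub.
    have : e`_j \in [seq x j - x i | j <- enum S] by apply: mem_nth.
    move=> /mapP[l]; rewrite mem_enum => lS ->.
    have := addmx_sub (spn_mem y lS) (_ : (- y i <= spn y S)%MS); rewrite eqmx_opp spn_mem // => /(_ isT).
    by rewrite /y /yv opp_row_mx add_row_mx subrr.
  move=> h; have := addmx_sub (spn_mem y iS) h.
  by rewrite /y /yv add_row_mx addr0.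
exists (x i), U; split.
  apply/seteqP; split=> z.
    by move=> /aff_hullP/hU[u uU ->]; exists u.
  by move=> [u uU <-]; apply/aff_hullP/hU; exists u.
by apply/eq_add_S; rewrite -rS (dim_rk hU).
Qed.

Lemma fnum_pts k T : fnum k (pts T) = nface y T k.+1.
Proof.
rewrite /fnum /nface; set E := [set B | _]%SET.
set A := [set F | _]%classic.
have AE F : A F <-> F \in [seq pts B | B <- enum E].
  split.
    move=> [/is_faceP[S fS ->] /has_dimP rS]; apply/map_f; rewrite mem_enum finset.inE.
    by apply/asboolP.
  move=> /mapP[S]; rewrite mem_enum finset.inE => /asboolP[fS rS] ->.
  by split; [apply/is_faceP; exists S | apply/has_dimP].
have fA : finite_set A.
  rewrite (_ : A = [set` [seq pts B | B <- enum E]]%classic); first exact: finite_seq.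
  by apply/seteqP; split=> F /AE.
have uE : uniq [seq pts B | B <- enum E].
  rewrite map_inj_in_uniq ?enum_uniq // => S F; rewrite !mem_enum !finset.inE.
  by move=> /asboolP[fS _] /asboolP[fF _]; apply: pts_inj fS fF.
have pm : perm_eq (enum_fset (fset_set A)) [seq pts B | B <- enum E].
  apply: uniq_perm (fset_uniq _) uE _ => F.
  rewrite [LHS](in_fset_set fA); apply/idP/idP => [/set_mem/AE //|/AE h]; exact: mem_set.
by rewrite -[LHS]/(size _) (perm_size pm) size_map -cardE.
Qed.

End Points.
End Hull.

(** * Lower bounds for the polytopes of the family *)

Section LowerBound.

Local Open Scope ring_scope.

Variables (R : realType) (m : nat).
Implicit Types (P F G : set 'rV[R]_m).

Lemma range_pts (I : finType) (x : I -> 'rV[R]_m) :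
  conv_hull (range x) = pts x [set: I]%SET.
Proof.
congr conv_hull; apply/seteqP; split=> z; first by move=> [i _ <-]; exists i.
by move=> [i _ ->]; exists i.
Qed.

(** Repetitions are removed from the generating list, so that faces of rank 1 are singletons. *)
Lemma polytope_pts P : is_polytope P ->
  exists (I : finType) (x : I -> 'rV[R]_m), injective x /\ P = pts x [set: I]%SET.
Proof.
move=> [V ->]; exists (seq_sub V), val; split; first exact: val_inj.
congr conv_hull; apply/seteqP; split=> z /=; last by move=> [i _ ->]; apply: ssvalP.
by move=> zV; exists (SeqSub zV); rewrite ?finset.inE.
Qed.

Lemma aff_independent_rk k (v : 'I_k -> 'rV[R]_m) : aff_independent v ->
  rk (fun i => yv (v i)) [set: 'I_k]%SET = k.
Proof.
move=> ind; pose M := \matrix_i yv (v i).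
have fM : row_free M.
  apply: inj_row_free => w; rewrite mulmx_sum_row => e.
  have w1 : \sum_i w 0 i = 0.
    have := congr1 (fun r => lsubmx r 0 0) e; rewrite linear_sum summxE linear0 mxE => h.
    rewrite -[RHS]h; apply: eq_bigr => i _.
    by rewrite linearZ /= rowK row_mxKl !mxE eqxx mulr1.
  have w2 : \sum_i w 0 i *: v i = 0.
    have := congr1 rsubmx e; rewrite linear_sum linear0 => h.
    rewrite -[RHS]h; apply: eq_bigr => i _.
    by rewrite linearZ /= rowK row_mxKr.
  by apply/rowP => i; rewrite [RHS]mxE; apply: (ind (fun i => w 0 i)).
rewrite -[RHS](eqP (fM : \rank M == k)); apply/eqP; rewrite eqn_leq; apply/andP; split.
  by apply: mxrankS; apply/spn_subP => i _; rewrite -[yv _](rowK (fun i => yv (v i))) row_sub.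
by apply: mxrankS; apply/row_subP => i; rewrite rowK; apply: spn_mem; rewrite finset.inE.
Qed.

Lemma has_dim_uniq (I : finType) (x : I -> 'rV[R]_m) S k k' :
  has_dim (pts x S) k -> has_dim (pts x S) k' -> k = k'.
Proof. by move=> /has_dimP h /has_dimP; rewrite h => -[]. Qed.

Lemma simplex_fnum G e j : is_simplex G -> has_dim G e -> (fnum j G <= 'C(e.+1, j.+1))%N.
Proof.
move=> [k [v [ind ->]]]; rewrite range_pts => /has_dimP.
have rk_k := aff_independent_rk ind; rewrite rk_k => -[<-].
have free : rk (fun i => yv (v i)) [set: 'I_k.+1]%SET = #|[set: 'I_k.+1]%SET|.
  by rewrite rk_k cardsT card_ord.
rewrite fnum_pts -[X in 'C(X, _)]card_ord -card_draws; apply/subset_leq_card/fintype.subsetP => S.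
rewrite !finset.inE => /asboolP[_ <-]; apply/eqP/esym.
exact: free_rk free (finset.subsetT S).
Qed.

Lemma faceof_yv0 (I : finType) (x : I -> 'rV[R]_m) T : faceof (fun i => yv (x i)) T finset.set0.
Proof.
have [c cE] := form_ev (dotf (0 : 'cV[R]_m)) 1.
have c1 i : ev (yv (x i)) c = 1 by rewrite cE /= /dotf mulmx0 mxE subr0.
exists c; split=> [i _|]; first by rewrite c1.
by apply/setP => i; rewrite !finset.inE c1 oner_eq0 andbF.
Qed.

Lemma single_yv (I : finType) (x : I -> 'rV[R]_m) (S : {set I}) : injective x ->
  rk (fun i => yv (x i)) S = 1%N -> #|S| = 1%N.
Proof.
move=> inj rS; set y := fun i => _ in rS.
have [i iS] : exists i, i \in S.
  by apply/card_gt0P; rewrite lt0n cards_eq0; apply/eqP => e; rewrite e rk0 in rS.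
apply/eqP/cards1P; exists i; apply/setP => j; rewrite finset.inE; apply/idP/eqP => [jS|-> //].
have [c e] := faceof_yv0 x S.
have i0 : i \notin finset.set0 by rewrite finset.inE.
have [|a] := spn_cover e _ iS i0 (spn_mem y jS); first by rewrite rS rk0.
rewrite /spn finset.big_set0 submx0 subr_eq0 => /eqP h.
have := congr1 (fun r => lsubmx r 0 0) h; have := congr1 rsubmx h.
rewrite !linearZ /= /y /yv !row_mxKl !row_mxKr !mxE eqxx mulr1 => h1 h2.
by apply: inj; rewrite h1 -h2 scale1r.
Qed.

Theorem family_lower_bound p n s P : polytope_family p.+3 n s P ->
  [/\ forall k, (k < p)%N -> ('C(p.+3, k.+1) * n <= fnum k.+1 P + k.+1 * 'C(p.+4, k.+2))%N,
      (p.+3 * p.+2 * n + 2 * p.+3 <=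
         2 * fnum p.+1 P + 2 * (p.+3 + s) + p.+1 * p.+4 * p.+3)%N &
      (p.+2 * n + p.+3 <= fnum p.+2 P + (p.+3 + s) + p.+4 * p.+1)%N].
Proof.
move=> [/polytope_pts[I [x [inj PE]]] dP nP [F [[fF [k [dPk dFk]]] nF simp]]].
set T := [set: I]%SET in PE; pose y i := yv (x i).
have rT : rk y T = p.+4 by apply/has_dimP; rewrite -PE.
have kE : k = p.+2.
  by apply/eq_add_S; rewrite PE in dP dPk; rewrite (has_dim_uniq dPk dP).
rewrite PE in fF; have /is_faceP[K fK KE] := fF.
have rK : rk y K = p.+3 by apply/has_dimP; rewrite -KE -kE.
have f0 : faceof y T finset.set0 by apply: faceof_yv0.
have si S : faceof y T S -> rk y S = 1%N -> #|S| = 1%N by move=> _; apply: single_yv.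
(* The rank bounds the number of vertices from below, the simplex from above. *)
have simp' S : faceof y T S -> rk y S = p.+3 -> S != K -> #|S :&: vtx y T|%SET = p.+3.
  move=> fS rS nK; apply/eqP; rewrite eqn_leq; apply/andP; split; last first.
    by rewrite -[X in (X <= _)%N]rS -(rk_vtxI f0 si fS) rk_card.
  have dS : has_dim (pts x S) p.+2 by apply/has_dimP.
  have sS : is_simplex (pts x S).
    apply: simp; last by rewrite KE => /(pts_inj fS fK) e; rewrite e eqxx in nK.
    by rewrite PE; split; [apply/is_faceP; exists S | exists p.+2; split=> //; rewrite -PE].
  have := simplex_fnum 0 sS dS; rewrite bin1 fnum_pts.
  by rewrite /nface (nface1_sub f0 si fS).
have [h1 h2 h3] := config_lower_bound f0 si fK rK rT simp'.
have nE : #|vtx y T| = n by rewrite -nP PE fnum_pts (nface1 f0 si).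
have kK : #|K :&: vtx y T|%SET = (p.+3 + s)%N.
  by rewrite -nF KE fnum_pts /nface (nface1_sub f0 si fK).
rewrite nE kK in h1 h2 h3; rewrite PE !fnum_pts; split=> // k' kp.
by rewrite fnum_pts; apply: h1.
Qed.

End LowerBound.

(** * Upper bounds for simplices, stackings and pyramids *)

Section UpperBound.

Local Open Scope ring_scope.

Variables (R : realType) (m : nat).
Implicit Types (P F G H : set 'rV[R]_m).

Lemma simplex_pts (J : finType) (v : J -> 'rV[R]_m) (B : {set J}) : (0 < #|B|)%N ->
  rk (fun i => yv (v i)) B = #|B| -> is_simplex (pts v B).
Proof.
move=> B0 rB; pose k := #|B|.-1; have kE : k.+1 = #|B| by rewrite prednK.
pose v' (i : 'I_k.+1) := v (enum_val (cast_ord kE i)); exists k, v'; split; last first.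
  congr conv_hull; apply/seteqP; split=> z.
    move=> [i iB ->]; exists (cast_ord (esym kE) (enum_rank_in iB i)) => //.
    by rewrite /v' cast_ordKV enum_rankK_in.
  by move=> [i _ <-]; exists (enum_val (cast_ord kE i)) => //; apply: enum_valP.
move=> w w1 w2.
pose M := \matrix_i yv (v' i).
have fM : row_free M.
  rewrite /row_free eqn_leq rank_leq_row /= [X in (X <= _)%N]kE -rB; apply: mxrankS.
  apply/spn_subP => i iB.
  have -> : yv (v i) = row (cast_ord (esym kE) (enum_rank_in iB i)) M.
    by rewrite rowK /v' cast_ordKV enum_rankK_in.
  exact: row_sub.
have w0 : (\row_i w i) *m M = 0.
  rewrite mulmx_sum_row; under eq_bigr do rewrite mxE rowK.
  rewrite -[LHS]hsubmxK !linear_sum /= -[RHS]hsubmxK !linear0; congr row_mx.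
    under eq_bigr do rewrite linearZ /= row_mxKl.
    by rewrite -scaler_suml w1 scale0r.
  by under eq_bigr do rewrite linearZ /= row_mxKr.
move=> i; have := row_free_inj fM (etrans w0 (esym (mul0mx _ _))).
by move=> /(congr1 (fun r : 'rV_ _ => r 0 i)); rewrite !mxE.
Qed.

Lemma simplex_ex G : is_simplex G -> exists k (v : 'I_k.+1 -> 'rV[R]_m),
  rk (fun i => yv (v i)) [set: 'I_k.+1]%SET = k.+1 /\ G = pts v [set: 'I_k.+1]%SET.
Proof.
by move=> [k [v [ind ->]]]; exists k, v; rewrite range_pts; split=> //; apply: aff_independent_rk.
Qed.

Lemma simplex_face G F e : is_simplex G -> is_face G F -> has_dim F e -> is_simplex F.
Proof.
move=> /simplex_ex[k [v [rv ->]]] /is_faceP[B fB ->] /has_dimP rB.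
have fr : rk (fun i => yv (v i)) [set: 'I_k.+1]%SET = #|[set: 'I_k.+1]%SET|.
  by rewrite cardsT card_ord.
have cB := free_rk fr (finset.subsetT B).
by apply: simplex_pts; rewrite -cB // rB.
Qed.

Lemma simplex_has_dim G : is_simplex G -> exists e, has_dim G e.
Proof. by move=> /simplex_ex[k [v [rv ->]]]; exists k; apply/has_dimP. Qed.

Lemma pts_polytope (I : finType) (x : I -> 'rV[R]_m) (S : {set I}) : is_polytope (pts x S).
Proof.
exists [seq x i | i <- enum S]; congr conv_hull; apply/seteqP; split=> z /=.
  by move=> [i iS ->]; apply: map_f; rewrite mem_enum.
by move=> /mapP[i]; rewrite mem_enum => iS ->; exists i.
Qed.

Lemma simplex_polytope G : is_simplex G -> is_polytope G.
Proof. by move=> /simplex_ex[k [v [_ ->]]]; apply: pts_polytope. Qed.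

Section ConePoints.

Variables (I : finType) (x : I -> 'rV[R]_m) (a : 'rV[R]_m).

Definition add_pt (o : option I) := if o is Some i then x i else a.

Lemma add_pt_yv : (fun o => yv (add_pt o)) = cone_pt (fun i => yv (x i)) (yv a).
Proof. by apply/funext => -[]. Qed.

Lemma pts_cone (S : {set I}) : conv_hull (pts x S `|` [set a])%classic = pts add_pt (cone S).
Proof.
have cvx (A B : set 'rV[R]_m) : (forall u, A u -> conv_hull B u) -> forall u, conv_hull A u -> conv_hull B u.
  move=> AB u /conv_hullP h; apply/conv_hullP => C cC BC; apply: h => // w /AB/conv_hullP; exact.
apply/seteqP; split=> z; apply: (cvx _ _) => {}z.
  move=> [|->]; last by apply: conv_hull_sub; exists None; rewrite ?None_cone.
  apply: (cvx _ _) => {}z [i iS ->]; apply: conv_hull_sub; exists (Some i) => //.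
  by rewrite in_setU1 mem_Some iS orbT.
move=> [[i|] h ->]; apply: conv_hull_sub; last by right.
by left; apply: pts_mem; move: h; rewrite in_setU1 mem_Some.
Qed.

Lemma pts_Some (S : {set I}) : pts add_pt (Some @: S)%SET = pts x S.
Proof.
congr conv_hull; apply/seteqP; split=> z.
  by move=> [o /imsetP[i iS ->] ->]; exists i.
by move=> [i iS ->]; exists (Some i) => //; rewrite mem_Some.
Qed.

End ConePoints.

Lemma simplex_cone G a : is_simplex G -> ~ aff_hull G a ->
  is_simplex (conv_hull (G `|` [set a])%classic).
Proof.
move=> /simplex_ex[k [v [rv ->]]] na; rewrite pts_cone.
have c : #|cone [set: 'I_k.+1]%SET| = k.+2.
  by rewrite cardsU1 None_Some (card_imset _ (@Some_inj _)) cardsT card_ord.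
apply: simplex_pts; rewrite c // add_pt_yv rk_cone ?rv //.
by apply/negP => h; apply: na; apply/aff_hullP.
Qed.

(** Unlike [is_faceP], this keeps the value of the functional at every point of the space, as
    [beyond] and [beneath] concern points outside the polytope. *)
Lemma supporting_expo (I : finType) (x : I -> 'rV[R]_m) T f b F :
  supporting (pts x T) f b F -> exists c S,
    [/\ expo (fun i => yv (x i)) c T S, F = pts x S & forall z, ev (yv z) c = b - f z].
Proof.
move=> [le ->]; have [c cE] := form_ev f b.
have e : expo (fun i => yv (x i)) c T [set i in T | ev (yv (x i)) c == 0]%SET.
  by split=> // i iT; rewrite cE subr_ge0; apply: le; apply: pts_mem.
exists c, [set i in T | ev (yv (x i)) c == 0]%SET; split=> //.
apply/seteqP; split=> z /=.
  by move=> [Pz fz]; apply/(pts_face z e); rewrite cE fz subrr.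
by move=> /(pts_face z e)[Pz]; rewrite cE => /eqP; rewrite subr_eq0 => /eqP.
Qed.

Lemma one_form : exists c : 'cV[R]_(1 + m), forall z, ev (yv z) c = 1.
Proof.
have [c cE] := form_ev (dotf (0 : 'cV[R]_m)) 1; exists c => z.
by rewrite cE /= /dotf mulmx0 mxE subr0.
Qed.

Lemma facetP (I : finType) (x : I -> 'rV[R]_m) T F e : rk (fun i => yv (x i)) T = e.+2 ->
  is_facet (pts x T) F <->
  exists S, [/\ faceof (fun i => yv (x i)) T S, rk (fun i => yv (x i)) S = e.+1 & F = pts x S].
Proof.
move=> rT; split.
  move=> [/is_faceP[S fS ->] [k [/has_dimP]]]; rewrite rT => -[<-] /has_dimP rS.
  by exists S.
move=> [S [fS rS ->]]; split; first by apply/is_faceP; exists S.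
by exists e; split; apply/has_dimP.
Qed.

Lemma stacking_dim P G Q e : is_polytope P -> has_dim P e -> stacking P G Q ->
  is_polytope Q /\ has_dim Q e.
Proof.
move=> /polytope_pts[I [x [_ ->]]] /has_dimP rT [_ [v [/aff_hullP av _ _ ->]]].
rewrite pts_cone; split; first exact: pts_polytope.
by apply/has_dimP; rewrite add_pt_yv rk_cone_in.
Qed.

(** The last part makes iteration possible: a new facet is a pyramid over a face of G, hence a
    simplex if G is one. *)
Lemma stacking_step P G Q e : is_polytope P -> has_dim P e.+2 -> stacking P G Q ->
  [/\ forall k, (k < e.+1)%N -> (fnum k.+1 Q + (k == e) <= fnum k.+1 P + fnum k G)%N,
      ((fnum 0 P).+1 <= fnum 0 Q)%N &
      forall H, is_facet Q H -> is_facet P H \/ (is_simplex G -> is_simplex H)].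
Proof.
move=> /polytope_pts[I [x [_ ->]]]; set T := [set: I]%SET => /has_dimP rT.
pose y i := yv (x i); rewrite -/y in rT.
move=> [fG [v [/aff_hullP av [f [b [sG bv]]] bn ->]]]; rewrite pts_cone.
have [g [K [eK GE gE]]] := supporting_expo sG; rewrite -/y in eK.
have [K' [fK' rK' GE']] := (facetP G rT).1 fG.
have KK : K' = K.
  by apply: (pts_inj (x := x) fK' _ (etrans (esym GE') GE)); exists g.
subst K'; have rK : (rk y K).+1 = rk y T by rewrite rT rK'.
have ug : ev (yv v) g < 0 by rewrite gE subr_lt0.
have under B : faceof y T B -> (rk y B).+1 = rk y T -> B != K ->
    exists2 c, expo y c T B & 0 < ev (yv v) c.
  move=> fB rB nB; have fH : is_facet (pts x T) (pts x B).
    by apply/(facetP _ rT); exists B; split=> //; apply/eq_add_S; rewrite rB rT.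
  have [|f' [b' [s' lt']]] := bn _ fH.
    by move=> e'; case/eqP: nB; apply: (pts_inj (x := x) fB fK'); rewrite e' GE.
  have [c [B' [eB' BE cE]]] := supporting_expo s'; exists c; last by rewrite cE subr_gt0.
  have -> // : B = B' by apply: (pts_inj (x := x) fB _ BE); exists c.
have [h hE] := one_form.
have h0 i : i \in T -> 0 < ev (y i) h by rewrite hE ltr01.
have uh : 0 < ev (yv v) h by rewrite hE ltr01.
have rQ : rk (fun o => yv (add_pt x v o)) (cone T) = e.+3.
  by rewrite add_pt_yv rk_cone_in.
split.
- move=> k ke; rewrite GE !fnum_pts add_pt_yv.
  have := stack_faces av eK rK ug under (k := k.+1); rewrite rT !ltnS => /(_ ke).
  by rewrite !eqSS.
- rewrite !fnum_pts add_pt_yv; apply: (stack_vertices eK ug under h0 uh) => B fB rB.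
  have nT : B != T by apply/eqP => E; move: rB; rewrite E rT.
  have nK : B != K by apply/eqP => E; move: rK; rewrite -E rB rT.
  by have [C [fC rC nC BC]] := facet_avoid fB nT fK' rK nK; exists C.
move=> H /(facetP _ rQ)[B [fB rB ->]].
rewrite add_pt_yv in fB rB; have [c ec] := fB; have eb := expo_base ec.
case: (boolP (None \in B)) => nB; last first.
  left; rewrite [B]baseK (negbTE nB) pts_Some; apply/(facetP _ rT); exists (base B).
  split=> //; first by exists c.
  by move: rB; rewrite [B]baseK (negbTE nB) rk_Some base_Some.
right=> sG'; rewrite [B]baseK nB -pts_cone.
have rlt : (rk (cone_pt y (yv v)) B < rk y T)%N by rewrite rB rT.
have sK := stack_new av under fB nB rlt.
have rb : rk y (base B) = e.+1.
  by apply/eq_add_S; rewrite -(stack_rk eK ug nB sK) rB.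
apply: simplex_cone.
  apply: (simplex_face (e := e) sG'); last by apply/has_dimP.
  by rewrite GE; apply/is_faceP; exists (base B) => //; exists c; apply: expo_restr eb sK (expo_sub eK).
move=> /aff_hullP h'; move: ug; rewrite (spn_ev0 h') ?ltxx // => i /(fintype.subsetP sK).
exact: expo0 eK.
Qed.

Lemma iter_stacking_dim allowed k P Q e : is_polytope P -> has_dim P e ->
  iter_stacking allowed k P Q -> is_polytope Q /\ has_dim Q e.
Proof.
elim: k P => [|k IH] P pP dP /= => [<- //|[G [P' [_ st it]]]].
by have [pP' dP'] := stacking_dim pP dP st; apply: IH it.
Qed.

(** Each stacking is over a simplex of dimension e + 1, whose faces with j + 1 vertices number at
    most C(e + 2, j + 1). For facets this is e + 2, less the one for the facet that is covered. *)
Lemma iter_stacking_fnum allowed k P Q e : is_polytope P -> has_dim P e.+2 ->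
  (forall H, is_facet P H -> allowed H -> is_simplex H) ->
  iter_stacking allowed k P Q ->
  [/\ forall j, (j < e)%N -> (fnum j.+1 Q <= fnum j.+1 P + k * 'C(e.+2, j.+1))%N,
      (fnum e.+1 Q <= fnum e.+1 P + k * e.+1)%N &
      (fnum 0 P + k <= fnum 0 Q)%N].
Proof.
elim: k P => [|k IH] P pP dP sP /= => [<-|[G [P' [aG st it]]]].
  by rewrite !mul0n !addn0; split=> // j _; rewrite mul0n addn0.
have [pP' dP'] := stacking_dim pP dP st.
have [h1 h2 h3] := stacking_step pP dP st.
have fG : is_facet P G by case: st.
have sG := sP _ fG aG.
have [|i1 i2 i3] := IH P' pP' dP' _ it.
  by move=> H /h3[fH aH|sH _]; [apply: sP | apply: sH].
have dG : has_dim G e.+1.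
  have [I [x [_ PE]]] := polytope_pts pP; rewrite PE in dP fG.
  by move: fG => /(facetP _ ((has_dimP _ _ _).1 dP))[S [_ rS ->]]; apply/has_dimP.
have cG j := simplex_fnum j sG dG.
split.
- move=> j je; have := i1 j je; have := h1 j (ltnW je).
  rewrite ltn_eqF // addn0; have := cG j; rewrite mulSn; clear; lia.
- have := h1 e (leqnn _); rewrite eqxx; have := cG e; rewrite binSn mulSn.
  by move: i2; clear; lia.
by move: h2 i3; clear; lia.
Qed.

Lemma simplex_fnum0 G e : is_simplex G -> has_dim G e -> (e.+1 <= fnum 0 G)%N.
Proof.
move=> /simplex_ex[k [v [rv ->]]] /has_dimP; rewrite rv => -[<-].
have fr : rk (fun i => yv (v i)) [set: 'I_k.+1]%SET = #|[set: 'I_k.+1]%SET|.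
  by rewrite cardsT card_ord.
rewrite fnum_pts /nface; set E := [set S | _]%SET.
have c : #|(@finset.set1 'I_k.+1) @: [set: 'I_k.+1]%SET| = k.+1.
  by rewrite (card_imset _ (@set1_inj _)) cardsT card_ord.
rewrite -[X in (X <= _)%N]c; apply/subset_leq_card/fintype.subsetP => S /imsetP[i _ ->].
rewrite finset.inE; apply/asboolP.
split; first by apply: free_face fr (finset.subsetT _).
by rewrite (free_rk fr (finset.subsetT _)) cards1.
Qed.

Lemma fnum_self F e : is_polytope F -> has_dim F e -> (fnum e F <= 1)%N.
Proof.
move=> /polytope_pts[I [x [_ ->]]] /has_dimP rT; rewrite fnum_pts /nface.
rewrite -[X in (_ <= X)%N](cards1 [set: I]%SET); apply/subset_leq_card/fintype.subsetP => S.
rewrite !finset.inE => /asboolP[[c ec] rS]; apply/eqP/(expo_rk_eq ec).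
by rewrite rS rT.
Qed.

(** The number of stackings is not given; it is at most s because the simplex has at least e + 3
    vertices and every stacking adds at least one. *)
Lemma stacked_fnum F e s : stacked F -> has_dim F e.+2 -> fnum 0 F = (e.+3 + s)%N ->
  (forall j, (j <= e)%N -> (fnum j F <= 'C(e.+3, j.+1) + s * 'C(e.+2, j))%N) /\
  (fnum e.+1 F <= e.+3 + s * e.+1)%N.
Proof.
move=> [_ [T [k [sT it]]]] dF n0; have pT := simplex_polytope sT.
have [e' dT'] := simplex_has_dim sT.
have [pF dF'] := iter_stacking_dim pT dT' it.
have dT : has_dim T e.+2.
  have [I [x [_ FE]]] := polytope_pts pF; rewrite FE in dF dF'.
  by rewrite (has_dim_uniq dF dF').
have [h1 h2 h3] : [/\ forall j, (j < e)%N -> (fnum j.+1 F <= fnum j.+1 T + k * 'C(e.+2, j.+1))%N,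
      (fnum e.+1 F <= fnum e.+1 T + k * e.+1)%N & (fnum 0 T + k <= fnum 0 F)%N].
  apply: iter_stacking_fnum it => // H [fH [l [dl dH]]] _.
  exact: simplex_face sT fH dH.
have ks : (k <= s)%N by have := simplex_fnum0 sT dT; move: h3; rewrite n0; clear; lia.
have cT j := simplex_fnum j sT dT.
split=> [[_|j je]|].
- by rewrite n0 bin1 bin0 muln1.
- apply: leq_trans (h1 j je) _; apply: leq_add; first exact: cT.
  by rewrite leq_mul2r ks orbT.
apply: leq_trans h2 _; apply: leq_add; last by rewrite leq_mul2r ks orbT.
by have := cT e.+1; rewrite binSn.
Qed.

Lemma pyramid_step F T e : is_polytope F -> has_dim F e.+1 -> is_pyramid F T ->
  [/\ is_polytope T, has_dim T e.+2,
      forall k, (fnum k.+1 T <= fnum k.+1 F + fnum k F)%N &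
      simplicial F -> forall H, is_facet T H -> H <> F -> is_simplex H].
Proof.
move=> pF dF [a [na ->]]; move: (pF) dF na => /polytope_pts[I [x [_ ->]]] /has_dimP rT na.
set S0 := [set: I]%SET in rT na *; pose y i := yv (x i); rewrite -/y in rT.
have nu : ~~ (yv a <= spn y S0)%MS by apply/negP => h; apply: na; apply/aff_hullP.
have rC : rk (fun o => yv (add_pt x a o)) (cone S0) = e.+3 by rewrite add_pt_yv rk_cone // rT.
rewrite pts_cone; split; first exact: pts_polytope.
- exact/has_dimP.
- by move=> k; rewrite !fnum_pts add_pt_yv; apply: pyramid_faces.
move=> [_ sF] H /(facetP _ rC)[B [[c ec] rB ->]].
rewrite add_pt_yv in ec rB; have eb := expo_base ec.
have fb : faceof y S0 (base B) by exists c.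
case: (boolP (None \in B)) => nB.
  move=> _; rewrite [B]baseK nB -pts_cone.
  have nb : ~~ (yv a <= spn y (base B))%MS.
    by apply: contra nu => h; apply: submx_trans h (spnS _ (faceof_sub fb)).
  have rb : rk y (base B) = e.+1.
    by apply/eq_add_S; rewrite -rB [in RHS](baseK B) nB rk_cone.
  apply: simplex_cone; last by move=> /aff_hullP h; case/negP: nb.
  apply: sF; split; first by apply/is_faceP; exists (base B).
  exists e; split; apply/has_dimP => //; exact: rT.
have rb : rk y (base B) = e.+2 by rewrite -rB [in RHS](baseK B) (negbTE nB) rk_Some.
case; rewrite [B]baseK (negbTE nB) pts_Some; congr pts.
by apply: (expo_rk_eq eb); rewrite rb rT.
Qed.

End UpperBound.

Theorem theorem3p1 (R : realType) (d s n : nat)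
    (hd : (3 <= d)%N) (hn : (d + s + 1 <= n)%N)
    (m : nat) (P : set 'rV[R]_m) (hP : polytope_family d n s P)
    (m' : nat) (Q : set 'rV[R]_m') (hS : is_S d n s Q)
    (i : nat) (hi : (1 <= i <= d - 1)%N) :
  (fnum i Q <= fnum i P)%N.
Proof.
move: d hd hn hP hS hi => [|[|[|p]]] // _ hn hP [F [T [[sF dF] nF pT it]]] hi.
have [P1 P2 P3] := family_lower_bound hP.
have pF : is_polytope F by case: sF => -[].
have [F1 F2] := stacked_fnum sF dF nF; have F3 : (fnum p.+2 F <= 1)%N := fnum_self pF dF.
have [pT' dT T1 T2] := pyramid_step pF dF pT.
have [|Q1 Q2 _] := iter_stacking_fnum pT' dT _ it.
  by move=> H fH nH; apply: T2 fH nH; case: sF.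
set t := (n - p.+3 - s - 1)%N in Q1 Q2.
have nE : n = (p.+4 + s + t)%N by rewrite /t; move: hn; clear; lia.
clearbody t.
move: P1 P2 P3; rewrite {}nE => P1 P2 P3.
case: i hi => [//|k] /= hk.
(* As i = k + 1 and d = p + 3, these are the ranges i <= d - 3, i = d - 2 and i = d - 1. In the last
   one F counts once as a facet of its own pyramid, by [F3]. *)
have [kp|[->|->]] : (k < p)%N \/ k = p \/ k = p.+1.
- by move: hk; clear; lia.
- have := P1 k kp; have := Q1 k (ltnW kp); have := T1 k.
  have := F1 k.+1 kp; have := F1 k (ltnW kp); have := mul_bin_diag p.+4 k.+1.
  rewrite (binS p.+3 k.+1) (binS p.+2 k) /=; clear.
  move: (fnum _ _) (fnum _ _) (fnum _ _) (fnum _ _) (fnum _ _) => f1 f2 f3 f4 f5.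
  by nia.
- have e1 := mul_bin_diag p.+3 1; have e2 := mul_bin_diag p.+2 1; rewrite !bin1 /= in e1 e2.
  have := P2; have := Q1 p (leqnn _); have := T1 p; have := F2; have := F1 p (leqnn _).
  rewrite (_ : 'C(p.+3, p.+1) = 'C(p.+3, 2)); last by rewrite -(@bin_sub p.+3 2).
  rewrite (_ : 'C(p.+2, p) = 'C(p.+2, 2)); last by rewrite -(@bin_sub p.+2 2) // subSS subSS subn0.
  by move: e1 e2; clear; nia.
by have := P3; have := Q2; have := T1 p.+1; have := F2; move: F3; clear; nia.
Qed.
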